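(* Let $\varpi>0$ and let $l\ge1$ be an integer; put $\overline\gamma_l:=\varpi l^{-2}$. Let $\mathcal{R}$ be the closure in $(0,\infty)\times\mathcal{U}$ of the set of nontrivial solutions $(\gamma,f)$, $f\neq0$, of $$\Upsilon(\gamma,f)=0,\qquad(\gamma,f)\in(0,\infty)\times\mathcal{U}.$$ Then $(\overline\gamma_l,0)\in\mathcal{R}$. Denote by $\mathcal{C}_l$ the connected component of $\mathcal{R}$ to which $(\overline\gamma_l,0)$ belongs. Then $\mathcal{C}_l$ is unbounded in $(0,\infty)\times\mathcal{U}$. Additionally, $\mathcal{C}_l$ has, in a small neighbourhood of $(\overline\gamma_l,0)$, an analytic parametrisation $(\gamma_l,f_l):(-\delta_l,\delta_l)\to(0,\infty)\times\mathcal{U}$, and $$\gamma_l(\varepsilon)=\overline\gamma_l+\frac{3\varpi}{8}\varepsilon^2+O(\varepsilon^4),\qquad f_l(\varepsilon)=\varepsilon\cos(lx)+O(\varepsilon^2)\qquad\text{for }\varepsilon\to0.$$ Moreover, any other pair $(\gamma,0)$ with $\gamma>0$ (that is, $\gamma\notin\{\overline\gamma_m: 1\le m\in\mathbb{N}\}$) is not a bifurcation point.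
   Context: $\mathbb{S}$ is the unit circle (functions on $\mathbb{S}$ are $2\pi$-periodic functions of $x$), $\alpha\in(0,1)$ is fixed. $C^{3+\alpha}_{0,e}(\mathbb{S})$ is the subspace of $C^{3+\alpha}(\mathbb{S})$ of even functions with integral mean $0$, and $C^\alpha_{odd}(\mathbb{S})$ is the subspace of odd functions in $C^\alpha(\mathbb{S})$. Put $$\mathcal{U}:=\{f\in C^{3+\alpha}_{0,e}(\mathbb{S}):\|f\|_{C(\mathbb{S})}<1\}$$ and define $\Upsilon:(0,\infty)\times\mathcal{U}\subset\mathbb{R}\times C^{3+\alpha}_{0,e}(\mathbb{S})\to C^\alpha_{odd}(\mathbb{S})$ by $$\Upsilon(\gamma,f):=\gamma\frac{f'''}{(1+f'^2)^{3/2}}-3\gamma\frac{f'f''^2}{(1+f'^2)^{5/2}}+\varpi f'.$$ (So $\Upsilon(\gamma,f)=0$ is the $x$-derivative of $\gamma f''/(1+f'^2)^{3/2}+\varpi f=\mathrm{const}$; its solutions are the even, mean-zero steady states of the Muskat problem with surface tension coefficient $\gamma$ and $\varpi=g(\rho_+-\rho_-)$, $g$ the gravity constant and $\rho_\pm$ the fluid densities.) One has $\Upsilon(\gamma,0)=0$ for all $\gamma>0$ (the trivial solutions); $(\gamma,0)$ is a bifurcation point if it is a limit of nontrivial solutions. That $\mathcal{C}_l$ is unbounded in $(0,\infty)\times\mathcal{U}$ means that either $\mathcal{C}_l$ is unbounded in $\mathbb{R}\times C^{3+\alpha}(\mathbb{S})$, or $\mathcal{C}_l$ reaches the boundary of $(0,\infty)\times\mathcal{U}$.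 *)

(* Defs.v *)
From HB Require Import structures.
From mathcomp Require Import all_boot all_order all_algebra.
From mathcomp Require Import all_classical all_reals all_analysis.
From mathcomp Require Import ring lra.

Set Implicit Arguments.
Unset Strict Implicit.
Unset Printing Implicit Defensive.

Import Order.TTheory GRing.Theory Num.Theory.
Import numFieldNormedType.Exports.

Local Open Scope ring_scope.
Local Open Scope classical_set_scope.

Section sup_norm.
Variables (R : realType) (I : Type) (D : set I).
Implicit Types F G : I -> R.

Definition sup_on F : R := sup [set `|F i| | i in D].

Definition bdd_on F := exists M : R, forall i, D i -> `|F i| <= M.

Lemma sup_on_ub F : bdd_on F -> forall i, D i -> `|F i| <= sup_on F.
Proof.
move=> [M FM] i Di; apply: ub_le_sup; last by exists i.
by exists M => _ [j Dj <-]; exact: FM.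
Qed.

Hypothesis D0 : D !=set0.

Lemma sup_on_le F M : (forall i, D i -> `|F i| <= M) -> sup_on F <= M.
Proof.
case: D0 => i Di FM; apply: ge_sup; first by exists `|F i|, i.
by move=> _ [j Dj <-]; exact: FM.
Qed.

Lemma sup_on_ge0 F : bdd_on F -> 0 <= sup_on F.
Proof. by case: D0 => i Di bF; apply: le_trans (sup_on_ub bF Di). Qed.

Lemma sup_onD F G : bdd_on F -> bdd_on G ->
  sup_on (F \+ G) <= sup_on F + sup_on G.
Proof.
move=> bF bG; apply: sup_on_le => i Di /=.
by rewrite (le_trans (ler_normD _ _))// lerD// sup_on_ub.
Qed.

Lemma sup_onZ c F : bdd_on F -> sup_on (fun i => c * F i) = `|c| * sup_on F.
Proof.
move=> bF; have [->|c0] := eqVneq c 0.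
  rewrite normr0 mul0r; apply/eqP; rewrite eq_le; apply/andP; split.
    by apply: sup_on_le => i _; rewrite mul0r normr0.
  by apply: sup_on_ge0; exists 0 => i _; rewrite mul0r normr0.
have nc0 : 0 < `|c| by rewrite normr_gt0.
have bcF : bdd_on (fun i => c * F i).
  case: bF => M FM; exists (`|c| * M) => i Di.
  by rewrite normrM ler_wpM2l// FM.
apply/eqP; rewrite eq_le; apply/andP; split.
  by apply: sup_on_le => i Di; rewrite normrM ler_wpM2l// sup_on_ub.
rewrite mulrC -ler_pdivlMr//; apply: sup_on_le => i Di.
by rewrite ler_pdivlMr// mulrC -normrM (sup_on_ub bcF).
Qed.

End sup_norm.

Section periodic_functions.
Variable R : realType.
Implicit Types f g : R -> R.

Lemma periodic_int f T : periodic f T -> forall (m : int) u, f (u + T *~ m) = f u.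
Proof.
move=> pf [n|n] u; first exact: periodicn.
by rewrite NegzE mulrNz -[in RHS](subrK (T *~ n.+1) u) (periodicn pf).
Qed.

Lemma periodic_rep f T : 0 < T -> periodic f T ->
  forall x, exists2 y, 0 <= y <= T & f y = f x.
Proof.
move=> T0 pf x; exists (x + T *~ - Num.floor (x / T)); last exact: periodic_int.
have /andP[h1 h2] := floor_itv (x / T).
rewrite mulrNz -mulrzl; apply/andP; split.
  by rewrite subr_ge0 -ler_pdivlMr.
by rewrite lerBlDr -[X in X + _]mul1r -mulrDl -ler_pdivrMr// addrC -intrD1 ltW.
Qed.

Lemma periodic_derive1 f T : periodic f T -> periodic f^`() T.
Proof.
by move=> pf u; rewrite /derive1; under eq_fun do rewrite addrA !pf.
Qed.

Lemma periodic_derive1n f T n : periodic f T -> periodic f^`(n) T.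
Proof. by move=> pf; elim: n => // n; rewrite derive1nS; exact: periodic_derive1. Qed.

Lemma periodic_continuous_bdd f T : 0 < T -> periodic f T -> continuous f ->
  bdd_on setT f.
Proof.
move=> T0 pf cf.
have cn : {within `[0, T], continuous (fun x => `|f x|)}.
  by apply: continuous_subspaceT => x; apply: continuous_comp;
    [exact: cf|exact: norm_continuous].
have [c _ fc] := EVT_max (ltW T0) cn.
exists `|f c| => x _; have [y y0T <-] := periodic_rep T0 pf x.
by apply: fc; rewrite in_itv.
Qed.

End periodic_functions.

Section hoelder_spaces.
Variable R : realType.
Implicit Types (f g : R -> R) (a : R) (k : nat).

Local Notation T := (pi *+ 2 : R).

Lemma T_gt0 : 0 < T.
Proof. by rewrite pmulrn_lgt0// pi_gt0. Qed.

(* Increments of [g] are measured with the distance of the real line; for a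
   periodic [g] this gives the same constants as the arc length on the circle,
   since the latter is the smallest distance between representatives. *)
Definition hoelder_quotient a g (p : R * R) : R :=
  (g p.1 - g p.2) / `|p.1 - p.2| `^ a.

Definition off_diagonal : set (R * R) := [set p | p.1 != p.2].

Definition C_norm g : R := sup_on setT g.

Definition hoelder_seminorm a g : R := sup_on off_diagonal (hoelder_quotient a g).

(* C^{k+a}(S): the 2pi-periodic functions of class C^k with a-Hoelder k-th
   derivative. The derivatives below order k are continuous because they are
   differentiable, the k-th one because of the Hoelder condition. *)
Definition hoelder_fun k a : {pred R -> R} := [pred f | `[<
  [/\ periodic f T,
      forall j, (j < k)%N -> forall x : R, derivable f^`(j) x 1
    & bdd_on off_diagonal (hoelder_quotient a f^`(k))] >]].

Definition hoelder_norm k a f : R :=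
  \sum_(j < k.+1) C_norm (f^`(j))%classic + hoelder_seminorm a f^`(k).

Lemma off_diagonal0 : off_diagonal !=set0.
Proof. by exists (0, 1); rewrite /off_diagonal/= eq_sym oner_neq0. Qed.

Lemma hoelder_quotientD a f g :
  hoelder_quotient a (f \+ g) = hoelder_quotient a f \+ hoelder_quotient a g.
Proof. by apply/funext => p; rewrite /hoelder_quotient/= -mulrDl; congr (_ / _); ring. Qed.

Lemma hoelder_quotientZ a c f :
  hoelder_quotient a (c *: f) = (fun p => c * hoelder_quotient a f p).
Proof. by apply/funext => p; rewrite /hoelder_quotient !fctE/= mulrA mulrBr. Qed.

Lemma hoelder_bdd a g : periodic g T ->
  bdd_on off_diagonal (hoelder_quotient a g) -> bdd_on setT g.
Proof.
move=> pg [M gM]; have T0 := T_gt0.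
have M0 : 0 <= M.
  by have [p /gM] := off_diagonal0; exact: le_trans.
pose B := T `^ a + (T + T) `^ a.
exists (`|g 0| + M * B) => x _; have [y /andP[y0 yT] <-] := periodic_rep T0 pg x.
rewrite -pg; have yT0 : 0 < y + T by rewrite ltr_wpDl.
have /gM : off_diagonal (y + T, 0) by rewrite /off_diagonal/= gt_eqF.
rewrite /hoelder_quotient/= subr0 (gtr0_norm yT0) normrM normfV.
rewrite (ger0_norm (powR_ge0 _ _)) ler_pdivrMr ?powR_gt0// => h.
rewrite -[g (y + T)](subrK (g 0)) (le_trans (ler_normD _ _))// addrC lerD2l.
rewrite (le_trans h)// ler_wpM2l// /B.
have [a0|a0] := leP 0 a.
  rewrite (le_trans (ge0_ler_powR a0 _ _ (_ : y + T <= T + T)))//.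
  - by rewrite nnegrE ltW.
  - by rewrite nnegrE addr_ge0// ltW.
  - by rewrite lerD2r.
  - by rewrite lerDr powR_ge0.
rewrite (@le_trans _ _ (T `^ a))//; last by rewrite lerDl powR_ge0.
rewrite -[a]opprK 2!(powRN _ (- a)) lef_pV2 ?posrE ?powR_gt0//.
by rewrite ge0_ler_powR ?nnegrE ?oppr_ge0 ?(ltW a0) ?(ltW T0) ?(ltW yT0)// lerDr.
Qed.

Lemma hoelder_funP k a f : reflect
  [/\ periodic f T,
      forall j, (j < k)%N -> forall x : R, derivable f^`(j) x 1
    & bdd_on off_diagonal (hoelder_quotient a f^`(k))] (f \in hoelder_fun k a).
Proof. exact: asboolP. Qed.

Lemma hoelder_derive_bdd k a f j : f \in hoelder_fun k a -> (j <= k)%N ->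
  bdd_on setT f^`(j).
Proof.
move=> /hoelder_funP[pf df hf]; rewrite leq_eqVlt => /predU1P[->|jk].
  by apply: hoelder_bdd hf; exact: periodic_derive1n.
apply: (periodic_continuous_bdd T_gt0); first exact: periodic_derive1n.
move=> x; apply: differentiable_continuous.
by apply/derivable1_diffP; exact: df.
Qed.

Lemma derive1n_lin c f g k :
  (forall j, (j < k)%N -> forall x : R, derivable f^`(j) x 1) ->
  (forall j, (j < k)%N -> forall x : R, derivable g^`(j) x 1) ->
  forall j, (j <= k)%N -> 
    (c *: f + g)^`(j) = c *: (f^`(j))%classic + (g^`(j))%classic.
Proof.
move=> df dg; elim=> // j IH jk; rewrite derive1nS IH ?(ltnW jk)//.
apply/funext => x; rewrite derive1E deriveD.
- rewrite deriveZ; last exact: df.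
  by rewrite -!derive1E.
- by apply: derivableZ; exact: df.
- exact: dg.
Qed.

Lemma derive1n_0 j : (0 : R -> R)^`(j) = 0.
Proof.
elim: j => // j IH; rewrite derive1nS IH; apply/funext => x.
by rewrite derive1E -[0 in LHS]/(cst 0) derive_cst.
Qed.

Lemma hoelder_fun_submod k a : submod_closed (hoelder_fun k a).
Proof.
split.
  apply/hoelder_funP; split => //.
  - by move=> j _ x; rewrite derive1n_0; exact: derivable_cst.
  - by exists 0 => p _; rewrite derive1n_0 /hoelder_quotient subrr mul0r normr0.
move=> c f g /hoelder_funP[pf df hf] /hoelder_funP[pg dg hg].
apply/hoelder_funP; split.
- by move=> u; rewrite !fctE /= pf pg.
- move=> j jk x; rewrite (derive1n_lin c df dg (ltnW jk)).
  by apply: derivableD; [apply: derivableZ; exact: df|exact: dg].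
- rewrite (derive1n_lin c df dg (leqnn k)).
  rewrite -[_ + _]/(_ \+ _) hoelder_quotientD hoelder_quotientZ.
  case: hf hg => M fM [N gN]; exists (`|c| * M + N) => p pD /=.
  rewrite (le_trans (ler_normD _ _))// lerD ?gN// normrM ler_wpM2l//.
  exact: fM.
Qed.

HB.instance Definition _ k a := GRing.isSubmodClosed.Build R (R -> R)
  (hoelder_fun k a) (hoelder_fun_submod k a).

Lemma hoelder_norm_lin k a c f g : f \in hoelder_fun k a -> g \in hoelder_fun k a ->
  hoelder_norm k a (c *: f + g) <= `|c| * hoelder_norm k a f + hoelder_norm k a g.
Proof.
move=> fk gk; have /hoelder_funP[pf df hf] := fk; have /hoelder_funP[pg dg hg] := gk.
rewrite /hoelder_norm mulrDr addrACA mulr_sumr -big_split/= lerD//.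
  apply: ler_sum => -[j /= jk] _; rewrite (derive1n_lin c df dg)//.
  have bf := hoelder_derive_bdd fk jk; have bg := hoelder_derive_bdd gk jk.
  rewrite /C_norm -(sup_onZ _ c bf); last by exists 0.
  apply: sup_onD => //; first by exists 0.
  by case: bf => M fM; exists (`|c| * M) => x _; rewrite normrM ler_wpM2l ?fM.
rewrite (derive1n_lin c df dg)// /hoelder_seminorm.
rewrite -(sup_onZ off_diagonal0 c hf).
rewrite -[_ + _]/(_ \+ _) hoelder_quotientD hoelder_quotientZ.
apply: (sup_onD off_diagonal0) => //.
by case: hf => M fM; exists (`|c| * M) => x Dx; rewrite normrM ler_wpM2l ?fM.
Qed.

Lemma C_norm_ge0 g : bdd_on setT g -> 0 <= C_norm g.
Proof. by move=> bg; apply: sup_on_ge0 bg; exists 0. Qed.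

Lemma hoelder_norm_ge0 k a f : f \in hoelder_fun k a -> 0 <= hoelder_norm k a f.
Proof.
move=> fk; have /hoelder_funP[_ _ hf] := fk; apply: addr_ge0.
  apply: sumr_ge0 => -[j /= jk] _; apply: C_norm_ge0.
  exact: hoelder_derive_bdd fk jk.
exact: (sup_on_ge0 off_diagonal0 hf).
Qed.

Lemma C_norm_le_hoelder_norm k a f : f \in hoelder_fun k a ->
  C_norm f <= hoelder_norm k a f.
Proof.
move=> fk; have /hoelder_funP[_ _ hf] := fk.
rewrite /hoelder_norm big_ord_recl/= -addrA lerDl addr_ge0//.
  apply: sumr_ge0 => -[j /= jk] _; apply: C_norm_ge0.
  exact: hoelder_derive_bdd fk jk.
exact: (sup_on_ge0 off_diagonal0 hf).
Qed.

Lemma hoelder_norm0 k a : hoelder_norm k a 0 = 0.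
Proof.
have z (I : Type) (D : set I) : D !=set0 -> sup_on D (fun _ : I => 0 : R) = 0.
  move=> D0; apply/eqP; rewrite eq_le; apply/andP; split.
    by apply: sup_on_le => // i _; rewrite normr0.
  by apply: sup_on_ge0 => //; exists 0 => i _; rewrite normr0.
rewrite /hoelder_norm big1 => [|j _]; last first.
  by rewrite derive1n_0 /C_norm z//; exists 0.
rewrite add0r derive1n_0 /hoelder_seminorm (_ : hoelder_quotient a 0 = fun=> 0).
  by rewrite z//; exact: off_diagonal0.
by apply/funext => p; rewrite /hoelder_quotient subrr mul0r.
Qed.

End hoelder_spaces.

Section mean_zero_even.
Variable R : realType.
Implicit Types (f g : R -> R) (a : R).

Local Notation T := (pi *+ 2 : R).

Definition mean f : R :=
  T^-1 * (\int[lebesgue_measure]_(x in `[0%R, T]) f x)%R.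

Definition even_fun f := forall x, f (- x) = f x.

Definition odd_fun f := forall x, f (- x) = - f x.

(* C^{3+a}_{0,e}(S) *)
Definition C30e_fun a : {pred R -> R} := [pred f |
  [&& f \in hoelder_fun 3 a, `[< even_fun f >] & mean f == 0]].

(* C^a_odd(S) *)
Definition Codd_fun a : {pred R -> R} := [pred f |
  (f \in hoelder_fun 0 a) && `[< odd_fun f >]].

Lemma hoelder_continuous k a f : f \in hoelder_fun k.+1 a -> continuous f.
Proof.
move=> /hoelder_funP[_ df _] x; apply: differentiable_continuous.
by apply/derivable1_diffP; exact: (df 0%N).
Qed.

Lemma continuous_integrableT f : continuous f ->
  lebesgue_measure.-integrable `[0%R, T] (EFin \o f).
Proof.
move=> cf; apply: continuous_compact_integrable; first exact: segment_compact.
exact: continuous_subspaceT.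
Qed.

Lemma meanD f g : continuous f -> continuous g -> mean (f \+ g) = mean f + mean g.
Proof.
move=> cf cg; rewrite /mean RintegralD ?mulrDr//; exact: continuous_integrableT.
Qed.

Lemma meanZ c f : continuous f -> mean (c *: f) = c * mean f.
Proof.
move=> cf; rewrite /mean RintegralZl//; last exact: continuous_integrableT.
by rewrite mulrCA.
Qed.

Lemma C30e_submod a : submod_closed (C30e_fun a).
Proof.
split.
  apply/and3P; split; first exact: (hoelder_fun_submod 3 a).1.
    by apply/asboolP => x.
  by rewrite /mean Rintegral_cst//= mul0r mulr0.
move=> c f g /and3P[fh /asboolP fe /eqP f0] /and3P[gh /asboolP ge /eqP g0].
apply/and3P; split.
- exact: ((hoelder_fun_submod 3 a).2 c f g fh gh).
- by apply/asboolP => x; rewrite !fctE/= fe ge.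
- have cf := hoelder_continuous fh; have cg := hoelder_continuous gh.
  rewrite meanD ?meanZ ?f0 ?g0 ?mulr0 ?addr0// => x.
  exact/continuousZl_tmp/cf.
Qed.

HB.instance Definition _ a := GRing.isSubmodClosed.Build R (R -> R)
  (C30e_fun a) (C30e_submod a).

End mean_zero_even.

Record C30e (R : realType) (a : R) := MkC30e {
  C30e_val :> R -> R ;
  _ : C30e_val \in C30e_fun a }.

Section C30e_normed.
Variables (R : realType) (a : R).

HB.instance Definition _ := [isSub for @C30e_val R a].
HB.instance Definition _ := [Choice of C30e a by <:].
HB.instance Definition _ := [SubChoice_isSubLmodule of C30e a by <:].

Lemma C30e_hoelder (f : C30e a) : (f : R -> R) \in hoelder_fun 3 a.
Proof. by case: f => f /= /and3P[]. Qed.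

Let norm (f : C30e a) := hoelder_norm 3 a f.

Let ler_normD f g : norm (f + g) <= norm f + norm g.
Proof.
have := hoelder_norm_lin 1 (C30e_hoelder f) (C30e_hoelder g).
by rewrite normr1 mul1r scale1r.
Qed.

Let norm_le c f : norm (c *: f) <= `|c| * norm f.
Proof.
have := hoelder_norm_lin c (C30e_hoelder f) (C30e_hoelder 0).
by rewrite hoelder_norm0 !addr0.
Qed.

Let normrZ c f : norm (c *: f) = `|c| * norm f.
Proof.
apply/eqP; rewrite eq_le norm_le/=; have [->|c0] := eqVneq c 0.
  by rewrite normr0 mul0r hoelder_norm_ge0// C30e_hoelder.
have := norm_le c^-1 (c *: f); rewrite scalerA mulVf// scale1r normfV.
by rewrite ler_pdivlMl ?normr_gt0.
Qed.

Let normr0_eq0 f : norm f = 0 -> f = 0.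
Proof.
move=> f0; apply/val_inj/funext => x; apply/eqP; rewrite -normr_le0 -f0.
have fh := C30e_hoelder f.
apply: le_trans (C_norm_le_hoelder_norm fh).
exact: (sup_on_ub (hoelder_derive_bdd fh (leq0n _))).
Qed.

HB.instance Definition _ := Lmodule_isNormed.Build R (C30e a)
  ler_normD normrZ normr0_eq0.

Lemma C30e_normE (f : C30e a) : `|f| = hoelder_norm 3 a f.
Proof. by []. Qed.

End C30e_normed.

Section hoelder_calculus.
Variable R : realType.
Implicit Types (f g : R -> R) (a : R).

Local Notation T := (pi *+ 2 : R).

Lemma derivable_lipschitz g M : (forall x : R, derivable g x 1) ->
  (forall x, `|g^`() x| <= M) -> forall x y, `|g x - g y| <= M * `|x - y|.
Proof.
move=> dg gM.
have le_case x y : x <= y -> `|g y - g x| <= M * `|y - x|.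
  move=> xy; have dgz (z : R) : is_derive z 1 g (g^`() z).
    by rewrite derive1E; apply: derivableP; exact: dg.
  have cg : {within `[x, y], continuous g}.
    apply: continuous_subspaceT => z; apply: differentiable_continuous.
    exact/derivable1_diffP.
  have [z _ ->] := MVT_segment xy (fun z _ => dgz z) cg.
  by rewrite normrM ler_wpM2r.
move=> x y; have [xy|/ltW yx] := leP x y; last exact: le_case.
by rewrite distrC (distrC x); exact: le_case.
Qed.

Lemma derivable_hoelder a g : 0 < a < 1 -> periodic g T ->
  (forall x : R, derivable g x 1) -> bdd_on setT g^`() ->
  bdd_on (@off_diagonal R) (hoelder_quotient a g).
Proof.
move=> /andP[a0 a1] pg dg [L gL].
have [M gM] : bdd_on setT g.
  apply: (periodic_continuous_bdd (@T_gt0 R) pg) => x.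
  exact/differentiable_continuous/derivable1_diffP.
have L0 : 0 <= L by apply: le_trans (gL 0 I).
have M0 : 0 <= M by apply: le_trans (gM 0 I).
have lip := derivable_lipschitz dg (fun x => gL x I).
exists (L + (M + M)) => -[x y]; rewrite /off_diagonal/= => xy.
have d0 : 0 < `|x - y| by rewrite normr_gt0 subr_eq0.
rewrite /hoelder_quotient/= normrM normfV (ger0_norm (powR_ge0 _ _)).
rewrite ler_pdivrMr ?powR_gt0//.
have [d1|/ltW d1] := leP `|x - y| 1.
  rewrite (le_trans (lip x y))// ler_pM//; first by rewrite lerDl addr_ge0.
  by rewrite ger1_powR ?d0// ltW.
rewrite (@le_trans _ _ (M + M))//.
  by rewrite (le_trans (ler_normB _ _))// lerD// gM.
rewrite (@le_trans _ _ (L + (M + M)))//; first by rewrite lerDr.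
rewrite ler_peMr ?addr_ge0// -[1](powRr0 `|x - y|).
by apply: ler_powR => //; exact: ltW.
Qed.

Lemma hoelder_quotientM a f g : bdd_on setT f -> bdd_on setT g ->
  bdd_on (@off_diagonal R) (hoelder_quotient a f) ->
  bdd_on (@off_diagonal R) (hoelder_quotient a g) ->
  bdd_on (@off_diagonal R) (hoelder_quotient a (f \* g)).
Proof.
move=> [Mf fM] [Mg gM] [Hf fH] [Hg gH]; exists (Mf * Hg + Hf * Mg) => p pD.
have -> : hoelder_quotient a (f \* g) p =
    f p.1 * hoelder_quotient a g p + hoelder_quotient a f p * g p.2.
  by rewrite /hoelder_quotient/=; set c := _^-1; ring.
rewrite (le_trans (ler_normD _ _))// (normrM (f p.1)).
rewrite (normrM (hoelder_quotient a f p)) lerD//.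
  exact: (ler_pM (normr_ge0 _) (normr_ge0 _) (fM _ I) (gH _ pD)).
exact: (ler_pM (normr_ge0 _) (normr_ge0 _) (fH _ pD) (gM _ I)).
Qed.

Lemma hoelder_fun0P a f : reflect
  (periodic f T /\ bdd_on (@off_diagonal R) (hoelder_quotient a f))
  (f \in hoelder_fun 0 a).
Proof.
apply: (iffP (hoelder_funP 0 a f)) => [[]|[]] //; by split.
Qed.

Lemma hoelder_funM a f g : f \in hoelder_fun 0 a -> g \in hoelder_fun 0 a ->
  f \* g \in hoelder_fun 0 a.
Proof.
move=> fh gh; have bf := hoelder_derive_bdd fh (leqnn 0).
have bg := hoelder_derive_bdd gh (leqnn 0).
move: fh gh => /hoelder_fun0P[pf hf] /hoelder_fun0P[pg hg].
apply/hoelder_fun0P; split; first by move=> u /=; rewrite pf pg.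
exact: hoelder_quotientM.
Qed.

Lemma hoelder_fun_derive a k f j : 0 < a < 1 -> f \in hoelder_fun k a ->
  (j <= k)%N -> f^`(j) \in hoelder_fun 0 a.
Proof.
move=> a01 fh jk; have /hoelder_funP[pf df hf] := fh.
apply/hoelder_fun0P; split; first exact: periodic_derive1n.
move: jk; rewrite leq_eqVlt => /predU1P[->//|jk].
apply: derivable_hoelder => //; first exact: periodic_derive1n.
- exact: df.
- exact: (hoelder_derive_bdd fh jk).
Qed.

Lemma derive1_parity c f : (forall x : R, derivable f x 1) ->
  (forall x, f (- x) = c * f x) -> forall x, f^`() (- x) = - c * (f^`())%classic x.
Proof.
move=> df fc x.
have dN : is_derive x 1 (f \o -%R) ((f^`())%classic (- x) * -1).
  apply: is_derive1_comp; rewrite derive1E; apply: derivableP; exact: df.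
have dZ : is_derive x 1 (c *: f) (c *: (f^`())%classic x).
  by apply: is_deriveZ; rewrite derive1E; apply: derivableP; exact: df.
have E : f \o -%R = c *: f by apply/funext => y /=; rewrite fc.
move: dN; rewrite E => dN; have := @derive_val _ _ _ _ _ _ _ dN.
rewrite (@derive_val _ _ _ _ _ _ _ dZ) => h.
have {}h : c * (f^`())%classic x = - (f^`())%classic (- x) := etrans h (mulrN1 _).
by rewrite mulNr h opprK.
Qed.

End hoelder_calculus.

Section cosine_modes.
Variable R : realType.

Local Notation T := (pi *+ 2 : R).

Let trig (c d : R) (m : nat) : R -> R :=
  fun x => c * cos (m%:R * x) + d * sin (m%:R * x).

Let is_derive_trig c d m (x : R) :
  is_derive x 1 (trig c d m) (trig (d * m%:R) (- (c * m%:R)) m x).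
Proof.
have dm : is_derive x 1 ( *%R m%:R : R -> R) m%:R.
  by apply: is_derive_eq; rewrite /GRing.scale/= mulr1.
have dc : is_derive x 1 (cos \o *%R m%:R) (- sin (m%:R * x) * m%:R).
  exact: is_derive1_comp.
have ds : is_derive x 1 (sin \o *%R m%:R) (cos (m%:R * x) * m%:R).
  exact: is_derive1_comp.
have -> : trig c d m = c *: (cos \o *%R m%:R) + d *: (sin \o *%R m%:R) by [].
have -> : trig (d * m%:R) (- (c * m%:R)) m x =
    c *: (- sin (m%:R * x) * m%:R) + d *: (cos (m%:R * x) * m%:R).
  by rewrite /trig /GRing.scale/=; ring.
exact: (is_deriveD (is_deriveZ c dc) (is_deriveZ d ds)).
Qed.

Let derive1_trig c d m :
  (trig c d m)^`() = trig (d * m%:R) (- (c * m%:R)) m.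
Proof.
by apply/funext => x; rewrite derive1E; exact: (@derive_val _ _ _ _ _ _ _ (is_derive_trig c d m x)).
Qed.

Let derive1n_trig c d m j : exists c' d', (trig c d m)^`(j) = trig c' d' m.
Proof.
elim: j => [|j [c' [d' IH]]]; first by exists c, d.
by rewrite derive1nS IH derive1_trig; eexists; eexists.
Qed.

Let periodic_trig c d m : periodic (trig c d m) T.
Proof.
move=> x; rewrite /trig mulrDr.
have -> : m%:R * T = T *+ m by rewrite mulr_natl.
by rewrite (periodicn (@cosD2pi R)) (periodicn (@sinD2pi R)).
Qed.

Let bdd_trig c d m : bdd_on setT (trig c d m).
Proof.
exists (`|c| + `|d|) => x _; rewrite (le_trans (ler_normD _ _))// !normrM.
rewrite lerD// ler_piMr// ler_norml.
  by rewrite cos_geN1 cos_le1.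
by rewrite sin_geN1 sin_le1.
Qed.

Lemma cos_mode_subproof (a : R) (l : nat) : 0 < a < 1 -> (1 <= l)%N ->
  (fun x => cos (l%:R * x)) \in C30e_fun a.
Proof.
move=> a01 l1; have l0 : l%:R != 0 :> R by rewrite pnatr_eq0 -lt0n.
have E : (fun x : R => cos (l%:R * x)) = trig 1 0 l.
  by apply/funext => x; rewrite /trig mul1r mul0r addr0.
have dtrig c d x : derivable (trig c d l) x 1.
  exact: (@ex_derive _ _ _ _ _ _ _ (is_derive_trig c d l x)).
have ctrig c d : continuous (trig c d l).
  by move=> x; exact/differentiable_continuous/derivable1_diffP.
apply/and3P; split.
- rewrite E; apply/hoelder_funP; split; first exact: periodic_trig.
    by move=> j _ x; have [c [d ->]] := derive1n_trig 1 0 l j.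
  have [c [d ->]] := derive1n_trig 1 0 l 3.
  apply: (derivable_hoelder a01 (@periodic_trig c d l) (dtrig c d)).
  by rewrite derive1_trig; exact: bdd_trig.
- by apply/asboolP => x; rewrite mulrN cosN.
- rewrite E /mean /Rintegral.
  rewrite (@continuous_FTC2 _ _ (trig 0 l%:R^-1 l)); first last.
  + by move=> x _; rewrite derive1_trig mulVf// mul0r oppr0.
  + split; first by move=> x _; exact: dtrig.
      exact/cvg_at_right_filter/ctrig.
    exact/cvg_at_left_filter/ctrig.
  + exact: continuous_subspaceT.
  + exact: T_gt0.
  by rewrite /= -[X in trig _ _ _ X]add0r periodic_trig subrr mulr0.
Qed.

Definition cos_mode (a : R) (l : nat) (a01 : 0 < a < 1) (l1 : (1 <= l)%N) : C30e a :=
  MkC30e (cos_mode_subproof a01 l1).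

End cosine_modes.

Section Upsilon.
Variables (R : realType) (w : R).
Implicit Types (f g : R -> R) (a gam : R).

(* Its values lie in C^a_odd(S), see [Upsilon_odd]. *)
Definition Upsilon gam f : R -> R :=
  let f1 := f^`() in let f2 := f^`(2) in let f3 := f^`(3) in
  fun x => gam * (f3 x / (1 + f1 x ^+ 2) `^ (3 / 2))
    - 3 * gam * (f1 x * f2 x ^+ 2 / (1 + f1 x ^+ 2) `^ (5 / 2))
    + w * f1 x.

Lemma hoelder_powRV a (p : R) g : 0 < a < 1 -> 0 <= p ->
  g \in hoelder_fun 0 a -> (forall x : R, derivable g x 1) ->
  bdd_on setT g^`() ->
  (fun x => ((1 + g x ^+ 2) `^ p)^-1) \in hoelder_fun 0 a.
Proof.
move=> a01 p0 gh dg [M' gM'].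
have [M gM] := hoelder_derive_bdd gh (leqnn 0).
have [pg _] := hoelder_fun0P a g gh.
have b1 x : 1 <= 1 + g x ^+ 2 by rewrite lerDl sqr_ge0.
have b0 x : 0 < 1 + g x ^+ 2 by exact: lt_le_trans (b1 x).
set h := fun x => _.
pose D (x : R) := (- p * (1 + g x ^+ 2) `^ (- p - 1)) * (g x * g^`()%classic x *+ 2).
have dh (x : R) : is_derive x 1 h (D x).
  have -> : h = ((@powR R) ^~ (- p)) \o (fun y => 1 + g y ^+ 2).
    by apply/funext => y; rewrite /h /= powRN.
  apply: is_derive1_comp; first exact: is_derive1_powR.
  have dgx : is_derive x 1 g (g^`()%classic x).
    by rewrite derive1E; apply: derivableP; exact: dg.
  have -> : (fun y => 1 + g y ^+ 2) = cst 1 + g * g.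
    by apply/funext => y; rewrite !fctE /= expr2.
  have := is_deriveD (is_derive_cst (1 : R) x (1 : R)) (is_deriveM dgx dgx).
  by rewrite add0r /GRing.scale/= mulr2n.
have ph : periodic h (pi *+ 2) by move=> x; rewrite /h pg.
apply/hoelder_fun0P; split => //.
have dh' (x : R) : derivable h x 1 by exact: (@ex_derive _ _ _ _ _ _ _ (dh x)).
apply: (derivable_hoelder a01 ph dh').
exists (p * (M * M' *+ 2)) => x _.
rewrite derive1E (@derive_val _ _ _ _ _ _ _ (dh x)) /D normrM normrM normrN.
rewrite (ger0_norm p0) (ger0_norm (powR_ge0 _ _)) normrMn normrM.
have q1 : (1 + g x ^+ 2) `^ (- p - 1) <= 1.
  rewrite -[leRHS](powRr0 (1 + g x ^+ 2)) ler_powR// subr_le0.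
  by rewrite (@le_trans _ _ 0)// oppr_le0.
apply: ler_pM.
- by rewrite mulr_ge0// powR_ge0.
- by rewrite mulrn_wge0// mulr_ge0.
- by rewrite ler_piMr.
- by rewrite lerMn2r/= ler_pM//; [exact: gM|exact: gM'].
Qed.

Lemma Upsilon_odd a gam (f : C30e a) : 0 < a < 1 -> Upsilon gam f \in Codd_fun a.
Proof.
move=> a01; case: f => f /= /and3P[fh /asboolP fe _].
have /hoelder_funP[_ df _] := fh.
have f1h := hoelder_fun_derive a01 fh (isT : 1 <= 3)%N.
have f2h := hoelder_fun_derive a01 fh (isT : 2 <= 3)%N.
have f3h := hoelder_fun_derive a01 fh (isT : 3 <= 3)%N.
have b2 := hoelder_derive_bdd fh (isT : 2 <= 3)%N.
have p1 x : (f^`())%classic (- x) = - (f^`())%classic x.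
  rewrite (@derive1_parity _ 1 f) ?mulN1r//; first exact: (df 0%N).
  by move=> y; rewrite mul1r fe.
have p2 x : (f^`(2))%classic (- x) = (f^`(2))%classic x.
  rewrite -[f^`(2)]/((f^`()%classic)^`()%classic) (@derive1_parity _ (-1) f^`()).
  - by rewrite opprK mul1r.
  - exact: (df 1%N).
  - by move=> y; rewrite mulN1r p1.
have p3 x : (f^`(3))%classic (- x) = - (f^`(3))%classic x.
  rewrite -[f^`(3)]/((f^`(2)%classic)^`()%classic) (@derive1_parity _ 1 f^`(2)).
  - by rewrite mulN1r.
  - exact: (df 2%N).
  - by move=> y; rewrite mul1r p2.
have vh (p : R) : 0 <= p ->
    (fun x => ((1 + (f^`())%classic x ^+ 2) `^ p)^-1) \in hoelder_fun 0 a.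
  by move=> p0; exact: (hoelder_powRV a01 p0 f1h (df 1%N isT) b2).
apply/andP; split; last first.
  apply/asboolP => x; rewrite /Upsilon p1 p2 p3 sqrrN.
  move: ((f^`())%classic x) ((f^`(2))%classic x) ((f^`(3))%classic x) => u v z.
  by move: ((1 + u ^+ 2) `^ (3 / 2))^-1 ((1 + u ^+ 2) `^ (5 / 2))^-1 => p q; ring.
have v3 : 0 <= 3 / 2 :> R by lra.
have v5 : 0 <= 5 / 2 :> R by lra.
have t1 := hoelder_funM f3h (vh _ v3).
have t2 := hoelder_funM (hoelder_funM f1h (hoelder_funM f2h f2h)) (vh _ v5).
have [cZ_0 cZ] := hoelder_fun_submod 0 a.
have H := cZ gam _ _ t1 (cZ (- (3 * gam)) _ _ t2 (cZ w _ _ f1h cZ_0)).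
have E (u v z p q : R) :
    gam * (z * p) + (- (3 * gam) * (u * (v * v) * q) + (w * u + 0)) =
    gam * (z * p) - 3 * gam * (u * v ^+ 2 * q) + w * u by ring.
refine (eq_ind _ (fun h => is_true (h \in hoelder_fun 0 a)) H _ _).
by apply/funext => x; exact: E.
Qed.

End Upsilon.

Section bifurcation.
Variables (R : realType) (a w : R).

Definition Uset : set (C30e a) := [set f | C_norm f < 1].

Definition admissible : set (R * C30e a) := `]0, +oo[ `*` Uset.

Definition nontrivial_solution : set (R * C30e a) :=
  [set p | [/\ admissible p, p.2 != 0 & Upsilon w p.1 p.2 = cst 0]].

Definition solution_closure : set (R * C30e a) :=
  closure nontrivial_solution `&` admissible.

Definition bifurcation_point (gam : R) := exists u : nat -> R * C30e a,
  (forall n, nontrivial_solution (u n)) /\ u @ \oo --> (gam, 0 : C30e a).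

End bifurcation.

Section topology_and_analyticity.
Variables (R : realType) (V : normedModType R).

Definition boundary (A : set V) : set V := closure A `\` A^°.

(* [O] is meant to be open; [C] reaches its boundary when the closure of [C] in
   the ambient space [V] meets it. *)
Definition unbounded_in (O C : set V) :=
  ~ bounded_set C \/ closure C `&` boundary O !=set0.

(* The radius of convergence is positive since the power series converges at
   every [t] of a neighbourhood of [t0]. *)
Definition analytic_at (u : R -> V) (t0 : R) := exists c : nat -> V,
  \forall t \near t0, series (fun n => (t - t0) ^+ n *: c n) @ \oo --> u t.

End topology_and_analyticity.

(* Main.v *)
(* With m := f(0), lam := w / gam and k := lam m^2 / 4, integrating the equation
   twice turns steady states into f = m h, where h'' = - lam h / (1 - 2k(1 - h^2))^3,
   h(0) = 1, h'(0) = 0. This oscillator is solved by quadrature: h is the cosine of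
   the inverse of an elliptic-type integral, it is even and changes sign under a
   half period, and it is 2pi-periodic iff sqrt lam = n Omega(k) for an integer
   n >= 1, where pi Omega(k) is the integral over [0, pi]. Hence every nontrivial
   solution is determined by its mode n and by f(0), which excludes bifurcation
   from other points. For fixed n = l, the parameter k in [0, 1/2[ describes a
   continuous curve of solutions along which either f(0) reaches 1 or, as k tends
   to 1/2, the slope blows up, so that the component is unbounded.

   Near gam = w / l^2 the analytic parametrisation by eps = f(0) comes from a
   Lindstedt expansion. The equation is rewritten as a fixed point problem for the
   Taylor coefficients (functions of x) in which the multiplication by eps^2 / 2
   makes every coefficient depend on earlier ones; the weights C^n / (n + 1)^2,
   submultiplicative under convolution up to a constant, give geometric bounds in
   C^4, hence convergence in the Hoelder space. By uniqueness of the solution of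
   mode l with given f(0), the sum of the series fills a neighbourhood of the
   bifurcation point in the component. *)
Require Import Defs.
From HB Require Import structures.
From mathcomp Require Import all_boot all_order all_algebra.
From mathcomp Require Import all_classical all_reals all_analysis.
From mathcomp Require Import ring lra.

Set Implicit Arguments.
Unset Strict Implicit.
Unset Printing Implicit Defensive.

Import Order.TTheory GRing.Theory Num.Theory.
Import numFieldNormedType.Exports.

Local Open Scope ring_scope.
Local Open Scope classical_set_scope.

(** Evenness fixes the phase and zero mean removes the integration constant, so only lam and f(0)
    remain free in a steady state. The solutions are rigid because [Omega] does not increase with k:
    for a fixed mode n, |f(0)| = 2 sqrt k / (n Omega(k)) is strictly increasing, so |f(0)| recovers
    k and k recovers gamma. Since Omega(0) = 1, small solutions near (gamma, 0) force sqrt(w /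
    gamma) to be an integer.

    The quadrature curve is shown to be continuous in k, has f(0) >= 0 and carries the global
    statement. Analyticity needs both signs of f(0) and convergence in the Hoelder norm. Therefore
    the Lindstedt coefficients are kept in C^2 together with their symmetries, which products
    preserve, and inverting u'' + u gains the two derivatives that lead to C^4. This inversion is
    resonant at cos; the correction rho of lam is the number spent on it. At lowest order the
    resonant part of 3 sin^2 cos is 3/4, and half of it is the 3/8 in the expansion of gamma. Mode l
    is the mode 1 solution at l eps, scaled by 1/l in both directions, so l cancels from that
    coefficient. *)

Section calculus.
Variable R : realType.
Implicit Types (f g F : R -> R) (x y a b c : R).

(** * Derivatives of real functions, primitives and a Gronwall bound *)

Definition has_deriv f f1 := forall x, is_derive x (1 : R) f (f1 x).

(** The difference quotient is cleared of its denominator, so that h = 0 needs no separate treatment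
    and uniform estimates can be inserted directly. *)
Lemma is_derive1P f x a : is_derive x (1 : R) f a <->
  forall e, 0 < e -> exists2 d, 0 < d &
    forall h, `|h| < d -> `|f (x + h) - f x - h * a| <= e * `|h|.
Proof.
split=> [[df fa] e e0|fa].
  have : h^-1 *: (f (h *: 1 + x) - f x) @[h --> 0^'] --> a.
    by rewrite -fa; exact: df.
  move/cvgrPdist_le => /(_ _ e0); rewrite near_withinE => /nbhs_ballP[d /= d0 dP].
  exists d => // h hd; have [->|h0] := eqVneq h 0.
    by rewrite addr0 subrr mul0r subrr normr0 mulr0.
  have /dP := h0; rewrite /ball/= sub0r normrN => /(_ hd).
  rewrite /GRing.scale/= mulr1 (addrC h) -(ler_pM2r (_ : 0 < `|h|)) ?normr_gt0//.
  rewrite -normrM mulrBl mulrAC mulVf// mul1r distrC.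
  by rewrite (mulrC a).
have cv : h^-1 *: (f (h *: 1 + x) - f x) @[h --> 0^'] --> a.
  apply/cvgrPdist_le => e e0; have [d d0 dP] := fa _ e0.
  rewrite near_withinE; apply/nbhs_ballP; exists d => // h.
  rewrite /ball/= sub0r normrN => hd h0.
  rewrite /GRing.scale/= mulr1 (addrC h) -(ler_pM2r (_ : 0 < `|h|)) ?normr_gt0//.
  rewrite -normrM mulrBl mulrAC mulVf// mul1r distrC (mulrC a).
  exact: dP.
have D : derivable f x (1 : R) by apply/cvg_ex; exists a.
by split => //; apply: cvg_lim.
Qed.

Lemma is_derive1_eq f x a b : is_derive x (1 : R) f a -> a = b ->
  is_derive x (1 : R) f b.
Proof. by move=> ? <-. Qed.

Lemma derivD f g x a b : is_derive x (1 : R) f a -> is_derive x (1 : R) g b ->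
  is_derive x (1 : R) (fun y => f y + g y) (a + b).
Proof. exact: is_deriveD. Qed.

Lemma derivB f g x a b : is_derive x (1 : R) f a -> is_derive x (1 : R) g b ->
  is_derive x (1 : R) (fun y => f y - g y) (a - b).
Proof. exact: is_deriveB. Qed.

Lemma derivN f x a : is_derive x (1 : R) f a ->
  is_derive x (1 : R) (fun y => - f y) (- a).
Proof. exact: is_deriveN. Qed.

Lemma derivM f g x a b : is_derive x (1 : R) f a -> is_derive x (1 : R) g b ->
  is_derive x (1 : R) (fun y => f y * g y) (a * g x + f x * b).
Proof.
move=> df dg; have -> : a * g x + f x * b = f x *: b + g x *: a.
  by rewrite /GRing.scale/=; ring.
exact: (is_deriveM df dg).
Qed.

Lemma derivZ c f x a : is_derive x (1 : R) f a ->
  is_derive x (1 : R) (fun y => c * f y) (c * a).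
Proof. exact: is_deriveZ. Qed.

Lemma derivX n f x a : is_derive x (1 : R) f a ->
  is_derive x (1 : R) (fun y => f y ^+ n.+1) (n.+1%:R * f x ^+ n * a).
Proof.
move=> df.
have -> : n.+1%:R * f x ^+ n * a = n.+1%:R * f x ^+ n *: a by [].
have -> : (fun y => f y ^+ n.+1) = f ^+ n.+1.
  by apply/funext => y; rewrite exprfctE.
exact: is_deriveX.
Qed.

Lemma derivV f x a : is_derive x (1 : R) f a -> f x != 0 ->
  is_derive x (1 : R) (fun y => (f y)^-1) (- a / f x ^+ 2).
Proof.
move=> df f0; have -> : - a / f x ^+ 2 = - f x ^- 2 *: a.
  by rewrite /GRing.scale/=; ring.
exact: is_deriveV.
Qed.

Lemma deriv_comp f g x a b : is_derive (g x) (1 : R) f a ->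
  is_derive x (1 : R) g b -> is_derive x (1 : R) (fun y => f (g y)) (a * b).
Proof. exact: is_derive1_comp. Qed.

Lemma deriv_cst c x : is_derive x (1 : R) (fun=> c) 0.
Proof. exact: is_derive_cst. Qed.

Lemma deriv_id x : is_derive x (1 : R) (fun y => y) 1.
Proof. exact: is_derive_id. Qed.

Lemma deriv_sqrt f x a : is_derive x (1 : R) f a -> 0 < f x ->
  is_derive x (1 : R) (fun y => Num.sqrt (f y)) (a / (2 * Num.sqrt (f x))).
Proof.
move=> df f0; apply: is_derive1_eq.
  by apply: deriv_comp df; exact: is_derive1_sqrt.
by rewrite mulrC.
Qed.

Lemma has_deriv_continuous f f1 : has_deriv f f1 -> continuous f.
Proof.
move=> df x; apply: differentiable_continuous; apply/derivable1_diffP.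
exact: (@ex_derive _ _ _ _ _ _ _ (df x)).
Qed.

Lemma has_derivE f f1 : has_deriv f f1 -> f^`() = f1.
Proof.
move=> df; apply/funext => x.
by rewrite derive1E; exact: (@derive_val _ _ _ _ _ _ _ (df x)).
Qed.

Lemma has_deriv_uniq f f1 f2 : has_deriv f f1 -> has_deriv f f2 -> f1 = f2.
Proof. by move=> /has_derivE <- /has_derivE <-. Qed.

Lemma has_deriv_MVT f f1 x y : has_deriv f f1 -> x <= y ->
  exists2 c, x <= c <= y & f y - f x = f1 c * (y - x).
Proof.
move=> df xy; have cf := continuous_subspaceT (has_deriv_continuous df).
have [c cxy ->] := MVT_segment xy (fun z _ => df z) (cf _).
by exists c => //; move: cxy; rewrite in_itv.
Qed.

Lemma has_deriv_lip f f1 M : has_deriv f f1 -> (forall x, `|f1 x| <= M) ->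
  forall x y, `|f x - f y| <= M * `|x - y|.
Proof.
move=> df fM; apply: derivable_lipschitz; last by rewrite (has_derivE df).
by move=> x; exact: (@ex_derive _ _ _ _ _ _ _ (df x)).
Qed.

Lemma has_deriv_const f x y : has_deriv f (fun=> 0) -> f x = f y.
Proof. by move=> df; apply: is_derive_0_is_cst. Qed.

(** By the mean value theorem [s n - s m] is Lipschitz with constant [t n + t m]; letting m grow,
    [s n - f] is Lipschitz with constant [t n]. Hence the difference quotients of f stay within
    [t n] of those of [s n], whatever the increment. *)
Lemma has_deriv_limit (s s1 : nat -> R -> R) (t : nat -> R) f f1 :
  t @ \oo --> 0 -> (forall n, has_deriv (s n) (s1 n)) ->
  (forall n x, `|s n x - f x| <= t n) -> (forall n x, `|s1 n x - f1 x| <= t n) ->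
  has_deriv f f1.
Proof.
move=> t0 ds sf s1f x; apply/is_derive1P => e e0.
have key n y : `|(s n y - f y) - (s n x - f x)| <= t n * `|y - x|.
  have step m : `|(s n y - f y) - (s n x - f x)| <=
      t n * `|y - x| + t m * (`|y - x| + 2).
    have dnm : has_deriv (fun z => s n z - s m z) (fun z => s1 n z - s1 m z).
      by move=> z; apply: derivB; exact: ds.
    have bnm z : `|s1 n z - s1 m z| <= t n + t m.
      rewrite -(subrKA (f1 z)) (le_trans (ler_normD _ _))// lerD//.
      by rewrite distrC.
    have := has_deriv_lip dnm bnm y x => /= L.
    have -> : s n y - f y - (s n x - f x) = (s n y - s m y - (s n x - s m x)) +
       ((s m y - f y) - (s m x - f x)) by ring.
    rewrite (le_trans (ler_normD _ _))//.
    have := ler_normB (s m y - f y) (s m x - f x).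
    have := sf m y; have := sf m x; lra.
  apply/ler_addgt0Pr => d d0.
  have /cvgrPdist_lt/(_ (d / (`|y - x| + 2))) := t0.
  have p0 : 0 < `|y - x| + 2 by rewrite ltr_wpDl.
  case; first by rewrite divr_gt0.
  move=> m _ /(_ m (leqnn m)); rewrite sub0r normrN => tm.
  rewrite (le_trans (step m))// lerD2l -ler_pdivlMr//.
  by rewrite (le_trans (ler_norm _))// ltW.
have /cvgrPdist_lt/(_ (e / 3)) := t0.
case; first by rewrite divr_gt0.
move=> n _ /(_ n (leqnn n)); rewrite sub0r normrN => tn.
have {}tn : t n <= e / 3 by rewrite (le_trans (ler_norm _))// ltW.
have [d d0 dP] := (is_derive1P _ _ _).1 (ds n x) (e / 3) ltac:(by rewrite divr_gt0).
exists d => // h /dP dh.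
have -> : f (x + h) - f x - h * f1 x = (s n (x + h) - s n x - h * s1 n x)
   - ((s n (x + h) - f (x + h)) - (s n x - f x)) + h * (s1 n x - f1 x) by ring.
rewrite (le_trans (ler_normD _ _))//.
have := ler_normB (s n (x + h) - s n x - h * s1 n x) 
  ((s n (x + h) - f (x + h)) - (s n x - f x)).
have := key n (x + h); rewrite (addrC x h) addrK.
rewrite normrM; have := s1f n x.
have := normr_ge0 h; move: (`|h|) (`|s1 n x - f1 x|) dh => k q; rewrite (addrC x h).
move=> h1 k0 h2 h3 h4.
have : t n * k <= e / 3 * k by rewrite ler_wpM2r.
have : k * q <= k * (e / 3) by rewrite ler_wpM2l// (le_trans h2).
lra.
Qed.

Lemma antiderivative_itv f (c : R) : 0 < c -> continuous f -> exists2 F, F 0 = 0 &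
  forall x, - c < x < c -> is_derive x (1 : R) F (f x).
Proof.
move=> c0 cf.
(* Integration starts at - c, which makes 0 an interior point of the interval; subtracting [G 0]
   then moves the base point to 0. *)
pose G x := (\int[lebesgue_measure]_(t in [set` `[- c, x]]) f t)%R.
exists (fun x => G x - G 0); first by rewrite subrr.
move=> x /andP[cx xc].
have fi : lebesgue_measure.-integrable `[- c, c] (EFin \o f).
  apply: continuous_compact_integrable; first exact: segment_compact.
  exact: continuous_subspaceT.
have [dG GE] := continuous_FTC1_closed xc fi cx (cf x).
have dG' : is_derive x (1 : R) G (f x) by rewrite -GE derive1E; apply: derivableP.
by rewrite -[f x]subr0; exact: (derivB dG' (deriv_cst (G 0) x)).
Qed.

(** Primitives on growing symmetric intervals that vanish at 0 agree where both are defined, so the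
    value at x can be read off from any interval that contains x. *)
Lemma antiderivative f : continuous f -> exists2 F, F 0 = 0 & has_deriv F f.
Proof.
move=> cf.
have /choice[F FP] : forall n : nat, exists F, F 0 = 0 /\
    forall x, - n.+1%:R < x < n.+1%:R -> is_derive x (1 : R) F (f x).
  move=> n; have [|F F0 dF] := @antiderivative_itv f n.+1%:R _ cf.
    by rewrite ltr0n.
  by exists F.
have FE n m x : (n <= m)%N -> - n.+1%:R < x < n.+1%:R -> F n x = F m x.
  move=> nm xn; have [Fn0 dFn] := FP n; have [Fm0 dFm] := FP m.
  have nmR : n.+1%:R <= m.+1%:R :> R by rewrite ler_nat.
  have dd y : - n.+1%:R < y < n.+1%:R ->
      is_derive y (1 : R) (fun z => F n z - F m z) 0.
    move=> yn; rewrite -(subrr (f y)); apply: derivB; first exact: dFn.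
    by apply: dFm; lra.
  have n0 : (0 : R) < n.+1%:R by rewrite ltr0n.
  suff H u v : u <= v -> - n.+1%:R < u -> v < n.+1%:R ->
      F n u - F m u = F n v - F m v.
    have [x0|x0] := leP 0 x.
      by have := H _ _ x0; rewrite Fn0 Fm0; lra.
    by have := H _ _ (ltW x0); rewrite Fn0 Fm0; lra.
  move=> uv un vn.
  have [z zuv| |c _] := @MVT_segment _ (fun z => F n z - F m z) (fun=> 0) _ _ uv.
  - by apply: dd; move: zuv; rewrite in_itv/=; lra.
  - apply: derivable_within_continuous => z; rewrite in_itv/= => zuv.
    have /dd dz : - n.+1%:R < z < n.+1%:R by lra.
    exact: (@ex_derive _ _ _ _ _ _ _ dz).
  - by rewrite mul0r => /eqP; rewrite subr_eq0 => /eqP ->.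
exists (fun x => F (Num.truncn `|x|) x).
  by case: (FP (Num.truncn `|0 : R|)).
(* One index to spare: all points within n - |x| of x have an index of at most n, so [F n] is a
   common primitive around x. *)
move=> x; pose n := (Num.truncn `|x|).+1.
have xn : `|x| < n%:R by exact: truncnS_gt.
have d0 : 0 < n%:R - `|x| by rewrite subr_gt0.
have [_ dFn] := FP n.
have nn : n%:R < n.+1%:R :> R by rewrite ltr_nat.
have /dFn/is_derive1P dx : - n.+1%:R < x < n.+1%:R.
  by rewrite -ltr_norml; lra.
apply/is_derive1P => e /dx[d d1 dP].
exists (Num.min d (n%:R - `|x|)); first by rewrite lt_min d1.
move=> h; rewrite lt_min => /andP[hd hn].
have FnE y : `|y| < n%:R -> F (Num.truncn `|y|) y = F n y.
  move=> yn; apply: FE; last by rewrite -ltr_norml; exact: truncnS_gt.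
  have ty : (Num.truncn `|y|)%:R <= `|y| by rewrite truncn_le// normr_ge0.
  by rewrite -(ler_nat R); lra.
have xhn : `|x + h| < n%:R by rewrite (le_lt_trans (ler_normD _ _))//; lra.
by rewrite !FnE// dP.
Qed.

(* The weight is chosen so that exp(-(2+L)x) (g^2 + g1^2 + eta^2) decreases. *)
Lemma gronwall2 g g1 g2 (L eta A : R) : 0 <= L -> 0 <= eta ->
  has_deriv g g1 -> has_deriv g1 g2 -> g 0 = 0 -> g1 0 = 0 ->
  (forall x, 0 <= x <= A -> `|g2 x| <= L * `|g x| + eta) ->
  forall x, 0 <= x <= A ->
    g x ^+ 2 + g1 x ^+ 2 <= eta ^+ 2 * expR ((2 + L) * A).
Proof.
move=> L0 eta0 dg dg1 g0 g10 bg x xA.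
pose k := 2 + L.
pose E y := g y ^+ 2 + g1 y ^+ 2 + eta ^+ 2.
pose E1 y := 2 * g y * g1 y + 2 * g1 y * g2 y.
pose P y := expR (- k * y) * E y.
have dE : has_deriv E E1.
  move=> y; apply: (is_derive1_eq (derivD (derivD (derivX 1 (dg y))
    (derivX 1 (dg1 y))) (deriv_cst (eta ^+ 2) y))).
  by rewrite /E1 !expr1 addr0.
have dP : has_deriv P (fun y => expR (- k * y) * (E1 y - k * E y)).
  move=> y; have de := deriv_comp (is_derive_expR (- k * y))
    (derivZ (- k) (deriv_id y)).
  by apply: (is_derive1_eq (derivM de (dE y))); ring.
have [x0 xA'] := andP xA.
have [c /andP[c0 cx] Pc] := has_deriv_MVT dP x0.
have E1c : E1 c <= k * E c.
  have /bg bc : 0 <= c <= A by rewrite c0 (le_trans cx).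
  rewrite /E1 /E /k.
  have h1 : 2 * g c * g1 c <= g c ^+ 2 + g1 c ^+ 2.
    by have := sqr_ge0 (g c - g1 c); lra.
  have h2 : 2 * g1 c * g2 c <= 2 * `|g1 c| * (L * `|g c| + eta).
    rewrite (le_trans (ler_norm _))// normrM ler_pM// normrM.
    by rewrite ger0_norm.
  have h3 : 2 * `|g1 c| * `|g c| <= g c ^+ 2 + g1 c ^+ 2.
    rewrite -(real_normK (num_real (g c))) -(real_normK (num_real (g1 c))).
    by have := sqr_ge0 (`|g1 c| - `|g c|); lra.
  have h4 : 2 * `|g1 c| * eta <= g1 c ^+ 2 + eta ^+ 2.
    rewrite -(real_normK (num_real (g1 c))).
    by have := sqr_ge0 (`|g1 c| - eta); lra.
  have h5 : L * (2 * `|g1 c| * `|g c|) <= L * (g c ^+ 2 + g1 c ^+ 2).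
    by rewrite ler_wpM2l.
  have h6 : 0 <= L * eta ^+ 2 by rewrite mulr_ge0// sqr_ge0.
  have h7 := sqr_ge0 eta; have h8 := sqr_ge0 (g c); have h9 := sqr_ge0 (g1 c).
  rewrite (le_trans (lerD h1 h2))//.
  have -> : 2 * `|g1 c| * (L * `|g c| + eta) =
    L * (2 * `|g1 c| * `|g c|) + 2 * `|g1 c| * eta by ring.
  lra.
have Px : P x <= P 0.
  rewrite -subr_le0 Pc subr0 mulr_le0_ge0// mulr_ge0_le0 ?expR_ge0//.
  by rewrite subr_le0.
have : E x <= expR (k * x) * eta ^+ 2.
  move: Px; rewrite /P mulr0 expR0 mul1r mulNr expRN.
  rewrite mulrC ler_pdivrMr ?expR_gt0// /E g0 g10 expr0n/= !add0r.
  by rewrite (mulrC (_ ^+ 2)).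
have : expR (k * x) * eta ^+ 2 <= eta ^+ 2 * expR (k * A).
  rewrite mulrC ler_wpM2l ?sqr_ge0// ler_expR ler_wpM2l//.
  by rewrite /k addr_ge0.
by have := sqr_ge0 eta; rewrite /E /k; lra.
Qed.

End calculus.

(** * Half waves in the Hoelder space *)

Section hoelder_tools.
Variables (R : realType) (a : R).
Hypothesis a01 : 0 < a < 1.
Implicit Types (f g h F : R -> R) (d : nat -> R -> R) (x y M : R).

Local Notation T := (pi *+ 2 : R).

(** The successive derivatives are carried along as explicit functions; [jets_derive1n] identifies
    them with iterated derivatives when a norm is computed. *)
Definition jets n d := forall j, (j < n)%N -> has_deriv (d j) (d j.+1).

Lemma jets_derive1n n d j : jets n d -> (j <= n)%N -> (d 0%N)^`(j) = d j.
Proof.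
move=> dd; elim: j => // j IH jn; rewrite derive1nS IH ?(ltnW jn)//.
exact/has_derivE/dd.
Qed.

Lemma jets_scale n d (c : R) : jets n d ->
  jets n (fun j x => c ^+ j * d j (c * x)).
Proof.
move=> dd j jn x; apply: (is_derive1_eq (derivZ (c ^+ j)
  (deriv_comp (dd j jn (c * x)) (derivZ c (deriv_id x))))).
by rewrite exprS; ring.
Qed.

Lemma jets_lin n d1 d2 (c1 c2 : R) : jets n d1 -> jets n d2 ->
  jets n (fun j x => c1 * d1 j x + c2 * d2 j x).
Proof.
move=> dd1 dd2 j jn x.
exact: (derivD (derivZ c1 (dd1 j jn x)) (derivZ c2 (dd2 j jn x))).
Qed.

(** Up to distance 1 the Lipschitz bound suffices because |x - y| <= |x - y|^a; beyond it |x - y|^a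
    >= 1 and the oscillation is at most 2 M. *)
Lemma hoelder_quotient_le g g1 M : has_deriv g g1 ->
  (forall x, `|g x| <= M) -> (forall x, `|g1 x| <= M) ->
  forall p, off_diagonal p -> `|hoelder_quotient a g p| <= 2 * M.
Proof.
have /andP[a0 a1] := a01.
move=> dg gM g1M [x y]; rewrite /off_diagonal/= => xy.
have M0 : 0 <= M by apply: le_trans (gM 0).
have d0 : 0 < `|x - y| by rewrite normr_gt0 subr_eq0.
rewrite /hoelder_quotient/= normrM normfV (ger0_norm (powR_ge0 _ _)).
rewrite ler_pdivrMr ?powR_gt0//.
have [d1|/ltW d1] := leP `|x - y| 1.
  rewrite (le_trans (has_deriv_lip dg g1M x y))// ler_pM//; first by lra.
  by rewrite ger1_powR ?d0// ltW.
rewrite (@le_trans _ _ (2 * M))//.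
  by rewrite (le_trans (ler_normB _ _))//; have := gM x; have := gM y; lra.
rewrite ler_peMr ?mulr_ge0// -[1](powRr0 `|x - y|).
by apply: ler_powR => //; exact: ltW.
Qed.

(** Antiperiodicity under pi yields the period 2 pi and zero mean at once, and both persist for h(l
    x). *)
Definition half_wave h := (forall x, h (- x) = h x) /\
  (forall x, h (x + pi) = - h x).

Lemma half_wave_periodic h : half_wave h -> periodic h T.
Proof. by move=> [_ hp] x; rewrite mulr2n addrA !hp opprK. Qed.

Lemma meanE f F : continuous f -> has_deriv F f ->
  mean f = T^-1 * (F T - F 0).
Proof.
move=> cf dF; rewrite /mean /Rintegral (@continuous_FTC2 _ _ F) //.
- exact: T_gt0.
- exact: continuous_subspaceT.
- have cF := has_deriv_continuous dF; split.
  + by move=> x _; exact: (@ex_derive _ _ _ _ _ _ _ (dF x)).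
  + exact/cvg_at_right_filter/cF.
  + exact/cvg_at_left_filter/cF.
- by move=> x _; rewrite (has_derivE dF).
Qed.

(** Antiperiodicity makes F(x + pi) + F(x) constant for a primitive F, so F has period 2 pi and
    takes equal values at the ends of l periods. *)
Lemma half_wave_mean h (l : nat) : continuous h -> half_wave h -> (0 < l)%N ->
  mean (fun x => h (l%:R * x)) = 0.
Proof.
move=> ch [_ hp] l0; have [F F0 dF] := antiderivative ch.
have l0R : l%:R != 0 :> R by rewrite pnatr_eq0 -lt0n.
have dG : has_deriv (fun x => l%:R^-1 * F (l%:R * x)) (fun x => h (l%:R * x)).
  move=> x; apply: (is_derive1_eq (derivZ l%:R^-1
    (deriv_comp (dF (l%:R * x)) (derivZ l%:R (deriv_id x))))).
  by rewrite mulr1 mulrCA mulVf// mulr1.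
rewrite (meanE _ dG); last first.
  move=> x; apply: continuous_comp; last exact: ch.
  exact: mulrl_continuous.
have Fpi x : F (x + pi) + F x = F pi.
  have : has_deriv (fun x => F (x + pi) + F x) (fun=> 0).
    move=> y; apply: (is_derive1_eq (derivD (deriv_comp (g := fun z => z + pi)
      (dF (y + pi)) (derivD (deriv_id y) (deriv_cst pi y))) (dF y))).
    by rewrite addr0 mulr1 hp addNr.
  by move=> /(has_deriv_const x 0); rewrite F0 add0r addr0.
have FT : periodic F T.
  move=> x; have -> : x + T = x + pi + pi by rewrite mulr2n addrA.
  have e1 := Fpi x; have e2 := Fpi (x + pi); apply: (addIr (F (x + pi))).
  by rewrite e2 addrC e1.
have -> : l%:R * T = 0 + T *+ l by rewrite add0r mulr_natl.
by rewrite (periodicn FT) mulr0 subrr mulr0.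
Qed.

(** The gateway into [C30e_fun]: a bound of order 4 controls the Hoelder seminorm of order 3. The 6
    counts four sup norms and the factor 2 of [hoelder_quotient_le]; l^4 comes from the chain
    rule. *)
Lemma half_wave_C30e d (l : nat) M : jets 4 d ->
  (forall j x, (j <= 4)%N -> `|d j x| <= M) -> half_wave (d 0%N) -> (0 < l)%N ->
  (fun x => d 0%N (l%:R * x)) \in C30e_fun a /\
  hoelder_norm 3 a (fun x => d 0%N (l%:R * x)) <= 6 * l%:R ^+ 4 * M.
Proof.
move=> dd dM hw l0; have [he hp] := hw.
have M0 : 0 <= M by apply: le_trans (dM 0%N 0 isT).
pose e j x := l%:R ^+ j * d j (l%:R * x).
have de : jets 4 e by exact: jets_scale.
have E0 : (fun x => d 0%N (l%:R * x)) = e 0%N.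
  by apply/funext => x; rewrite /e expr0 mul1r.
rewrite E0; have l1R : 1 <= l%:R :> R by rewrite ler1n.
have eM j x : (j <= 4)%N -> `|e j x| <= l%:R ^+ 4 * M.
  move=> j4; rewrite /e normrM ger0_norm ?exprn_ge0// ler_pM//.
  - by rewrite ler_weXn2l.
  - exact: dM.
have pe : periodic (e 0%N) T.
  move=> x; rewrite /e mulrDr.
  have -> : l%:R * T = T *+ l by rewrite mulr_natl.
  by rewrite (periodicn (half_wave_periodic hw)).
have qe p : off_diagonal p -> `|hoelder_quotient a (e 3%N) p| <= 2 * (l%:R ^+ 4 * M).
  by apply: (hoelder_quotient_le (de 3%N isT)) => x; exact: eM.
have derE j : (j <= 4)%N -> (e 0%N)^`(j) = e j by exact: jets_derive1n.
have eh : e 0%N \in hoelder_fun 3 a.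
  apply/hoelder_funP; split => //.
    move=> j j3 x; rewrite derE; last by rewrite (leq_trans (ltnW j3)).
    exact: (@ex_derive _ _ _ _ _ _ _ (de j (ltnW j3) x)).
  by rewrite derE//; eexists; exact: qe.
split.
  apply/and3P; split => //.
  - by apply/asboolP => x; rewrite /e mulrN he.
  - rewrite -E0 half_wave_mean//.
    exact: has_deriv_continuous (dd 0%N isT).
have C : \sum_(j < 4) C_norm ((e 0%N)^`(j))%classic <= \sum_(j < 4) (l%:R ^+ 4 * M).
  apply: ler_sum => -[j /= j4] _; rewrite derE ?(ltnW j4)//.
  by apply: sup_on_le; [exists 0|move=> x _; rewrite eM ?(ltnW j4)].
have Q : hoelder_seminorm a (e 3%N) <= 2 * (l%:R ^+ 4 * M).
  by apply: sup_on_le => //; exact: off_diagonal0.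
rewrite /hoelder_norm derE// (le_trans (lerD C Q))// sumr_const card_ord.
by rewrite -mulr_natl; lra.
Qed.

Lemma C30e_has_deriv (f : C30e a) j : (j < 3)%N ->
  has_deriv (f^`(j))%classic (f^`(j.+1))%classic.
Proof.
move=> j3 x; have /hoelder_funP[_ df _] := C30e_hoelder f.
by rewrite derive1nS derive1E; apply: derivableP; exact: df.
Qed.

Lemma C30e_jets (f : C30e a) : jets 3 (fun j => (f^`(j))%classic).
Proof. by move=> j; exact: C30e_has_deriv. Qed.

Lemma C30e_derive_le (f : C30e a) j x : (j <= 3)%N ->
  `|(f^`(j))%classic x| <= `|f|.
Proof.
move=> j3; have fh := C30e_hoelder f; have /hoelder_funP[_ _ hf] := fh.
apply: (@le_trans _ _ (C_norm (f^`(j))%classic)).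
  by apply: (sup_on_ub (hoelder_derive_bdd fh j3)).
rewrite C30e_normE /hoelder_norm (bigD1 (Ordinal (j3 : (j < 4)%N)))//= -addrA.
rewrite lerDl addr_ge0//; last exact: (sup_on_ge0 (off_diagonal0 _) hf).
apply: sumr_ge0 => -[k /= k3] _; apply: C_norm_ge0.
exact: hoelder_derive_bdd fh k3.
Qed.

Lemma C30e_quotient_le (f : C30e a) p : off_diagonal p ->
  `|hoelder_quotient a (f^`(3))%classic p| <= `|f|.
Proof.
move=> pD; have fh := C30e_hoelder f; have /hoelder_funP[_ _ hf] := fh.
apply: (@le_trans _ _ (hoelder_seminorm a (f^`(3))%classic)).
  exact: (sup_on_ub hf).
rewrite C30e_normE /hoelder_norm lerDr sumr_ge0// => -[k /= k3] _.
by apply: C_norm_ge0; exact: hoelder_derive_bdd fh k3.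
Qed.

Lemma C30e_deriveB (f g : C30e a) j x : (j <= 3)%N ->
  ((C30e_val (f - g))^`(j))%classic x = (f^`(j))%classic x - (g^`(j))%classic x.
Proof.
move=> j3; have dl := jets_lin 1 (-1) (C30e_jets f) (C30e_jets g).
have E := jets_derive1n dl j3.
have -> : C30e_val (f - g) = (fun x => 1 * f x + -1 * g x) :> (R -> R).
  by apply/funext => y; rewrite mul1r mulN1r.
by rewrite [LHS](congr1 (fun k => k x) E) /= mul1r mulN1r.
Qed.

Lemma hoelder_quotientB f g h (p : R * R) : h p.1 = f p.1 - g p.1 ->
  h p.2 = f p.2 - g p.2 ->
  hoelder_quotient a h p = hoelder_quotient a f p - hoelder_quotient a g p.
Proof.
by move=> e1 e2; rewrite /hoelder_quotient e1 e2 -mulrBl; congr (_ / _); ring.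
Qed.

Lemma C30e_quotientB (f g : C30e a) p :
  hoelder_quotient a ((C30e_val (f - g))^`(3))%classic p =
  hoelder_quotient a (f^`(3))%classic p - hoelder_quotient a (g^`(3))%classic p.
Proof.
exact: hoelder_quotientB (C30e_deriveB f g p.1 (leqnn 3))
  (C30e_deriveB f g p.2 (leqnn 3)).
Qed.

Lemma C30e_quotientB_le (f g : C30e a) p : off_diagonal p ->
  `|hoelder_quotient a (f^`(3))%classic p - hoelder_quotient a (g^`(3))%classic p|
    <= `|f - g|.
Proof.
move=> pD; have le := C30e_quotient_le (f - g) pD.
exact: (eq_ind _ (fun z => `|z| <= `|f - g|) le _ (C30e_quotientB f g p)).
Qed.

Lemma C30e_deriveB_le (f g : C30e a) j x : (j <= 3)%N ->
  `|(f^`(j))%classic x - (g^`(j))%classic x| <= `|f - g|.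
Proof.
move=> j3; have le := C30e_derive_le (f - g) x j3.
exact: (eq_ind _ (fun z => `|z| <= `|f - g|) le _ (C30e_deriveB f g x j3)).
Qed.

Lemma C30e_norm_le (f : C30e a) M : (forall j x, (j <= 3)%N ->
    `|(f^`(j))%classic x| <= M) ->
  (forall p, off_diagonal p -> `|hoelder_quotient a (f^`(3))%classic p| <= M) ->
  `|f| <= 5 * M.
Proof.
move=> fM qM; rewrite C30e_normE /hoelder_norm.
have C : \sum_(j < 4) C_norm (f^`(j))%classic <= \sum_(j < 4) M.
  apply: ler_sum => -[j /= j4] _.
  by apply: sup_on_le; [exists 0|move=> x _; exact: fM].
have Q : hoelder_seminorm a (f^`(3))%classic <= M.
  by apply: sup_on_le => //; exact: off_diagonal0.
rewrite (le_trans (lerD C Q))// sumr_const card_ord.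
by rewrite -mulr_natl; lra.
Qed.

(** The derivatives up to order 3 converge uniformly and [has_deriv_limit] keeps them derivatives of
    each other; symmetry, mean and Hoelder quotients pass to the limit. The factor 5 counts four sup
    norms and the seminorm. *)
Lemma C30e_complete (s : nat -> C30e a) (t : nat -> R) : t @ \oo --> 0 ->
  (forall n m, (n <= m)%N -> `|s m - s n| <= t n) ->
  exists S : C30e a, forall n, `|S - s n| <= 5 * t n.
Proof.
move=> t0 st.
have tge0 n : 0 <= t n by apply: le_trans (st n n (leqnn n)).
have small e : 0 < e -> exists n, t n <= e.
  move=> e0; have /cvgrPdist_lt/(_ _ e0)[n _ /(_ n (leqnn n))] := t0.
  by rewrite sub0r normrN => tn; exists n; rewrite (le_trans (ler_norm _))// ltW.
have cauchy (u : nat -> R) : (forall n m, (n <= m)%N -> `|u m - u n| <= t n) ->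
    exists v, forall n, `|v - u n| <= t n.
  move=> ut.
  have cu : cvgn u.
    apply: cauchy_cvg; apply/cauchy_exP => e e0.
    have [|n tn] := small (e / 2); first by rewrite divr_gt0.
    exists (u n); exists n => // m /= nm.
    by rewrite /ball/= distrC (le_lt_trans (ut _ _ nm))//; lra.
  exists (limn u) => n.
  have c : (fun m => `|u m - u n|) @ \oo --> `|limn u - u n|.
    by apply: cvg_norm; apply: cvgB => //; exact: cvg_cst.
  by apply: (cvgr_to_le c); exists n => // m /= nm; exact: ut.
have /choice[v vP] : forall j, exists v : R -> R, (j <= 3)%N -> forall x n,
    `|v x - ((s n)^`(j))%classic x| <= t n.
  move=> j; have [j3|_] := leqP j 3; last by exists (fun=> 0).
  have /choice[v vP] : forall x, exists v, forall n, `|v - ((s n)^`(j))%classic x| <= t n.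
    move=> x; apply: (cauchy (fun n => ((s n)^`(j))%classic x)) => n m nm.
    exact: le_trans (C30e_deriveB_le (s m) (s n) x j3) (st _ _ nm).
  by exists v.
have vd : jets 3 v.
  move=> j j3; apply: (has_deriv_limit t0 (fun n => C30e_has_deriv (s n) j3)) => n x.
    by rewrite distrC; apply: vP; exact: ltnW.
  by rewrite distrC; exact: vP.
have eqv (x y : R) : (forall n, `|x - y| <= 2 * t n) -> x = y.
  move=> xy; apply/eqP; rewrite -subr_eq0 -normr_le0; apply/ler_addgt0Pr => e e0.
  have [|n tn] := small (e / 2); first by rewrite divr_gt0.
  by have := xy n; lra.
have pv : periodic (v 0%N) T.
  move=> x; apply: eqv => n; have := vP 0%N isT (x + T) n; have := vP 0%N isT x n.
  have /hoelder_funP[/(_ x) ps _ _] := C30e_hoelder (s n).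
  rewrite /= ps; move: (v 0%N (x + T)) (v 0%N x) (s n x) => p q r.
  by rewrite !ler_norml; lra.
have ev : even_fun (v 0%N).
  move=> x; apply: eqv => n; have := vP 0%N isT (- x) n; have := vP 0%N isT x n.
  have : s n (- x) = s n x by case: (s n) => ? /= /and3P[_ /asboolP].
  rewrite /= => ->; move: (v 0%N (- x)) (v 0%N x) (s n x) => p q r.
  by rewrite !ler_norml; lra.
have E j : (j <= 3)%N -> ((v 0%N)^`(j))%classic = v j by exact: jets_derive1n.
(* Uniform convergence gives no uniform control of Hoelder quotients. For a fixed pair, however, the
   denominator c is fixed, and an index m late enough in terms of c makes the error of the limit as
   small as desired. *)
have qv n p : off_diagonal p ->
    `|hoelder_quotient a (v 3%N) p - hoelder_quotient a ((s n)^`(3))%classic p| <= t n.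
  move=> pD; apply/ler_addgt0Pr => e e0.
  pose c := `|p.1 - p.2| `^ a.
  have c0 : 0 < c.
    by rewrite powR_gt0// normr_gt0 subr_eq0; exact: pD.
  have [|m' tm'] := small (e * c / 2); first by rewrite divr_gt0// mulr_gt0.
  have [m nm tm] : exists2 m, (n <= m)%N & t m <= e * c / 2.
    have /cvgrPdist_lt/(_ (e * c / 2)) := t0.
    case; first by rewrite divr_gt0// mulr_gt0.
    move=> k _ kP; exists (maxn n k); first exact: leq_maxl.
    have := kP _ (leq_maxr n k); rewrite sub0r normrN => tk.
    by rewrite (le_trans (ler_norm _))// ltW.
  have h1 := le_trans (C30e_quotientB_le (s m) (s n) pD) (st _ _ nm).
  have h2 : `|hoelder_quotient a (v 3%N) p -
      hoelder_quotient a ((s m)^`(3))%classic p| <= e.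
    rewrite /hoelder_quotient -mulrBl normrM normfV (gtr0_norm c0).
    rewrite ler_pdivrMr//.
    have := vP 3%N isT p.1 m; have := vP 3%N isT p.2 m.
    move: tm; rewrite -/c; move: (v 3%N p.1) (v 3%N p.2) (t m) (e * c).
    move: (((s m)^`(3))%classic p.1) (((s m)^`(3))%classic p.2) => s1 s2 v1 v2 tm ec.
    by rewrite !ler_norml; lra.
  rewrite -(subrKA (hoelder_quotient a ((s m)^`(3))%classic p)).
  by rewrite (le_trans (ler_normD _ _))// addrC lerD.
have hv : v 0%N \in hoelder_fun 3 a.
  apply/hoelder_funP; split => //.
    move=> j j3 x; rewrite E ?(ltnW j3)//.
    exact: (@ex_derive _ _ _ _ _ _ _ (vd j j3 x)).
  rewrite E//; exists (t 0%N + `|s 0%N|) => p pD.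
  rewrite -[hoelder_quotient _ _ _](subrK (hoelder_quotient a ((s 0%N)^`(3))%classic p)).
  by rewrite (le_trans (ler_normD _ _))// lerD ?qv ?C30e_quotient_le.
(* Integrals over a period are compared through primitives: that of [v 0 - s n] grows at most at the
   rate [t n], and that of [s n] returns to 0. *)
have mv : mean (v 0%N) == 0.
  have cv : continuous (v 0%N) by exact: (has_deriv_continuous (vd 0%N isT)).
  have [F F0 dF] := antiderivative cv.
  rewrite (meanE cv dF) F0 subr0 mulf_eq0; apply/orP; right; apply/eqP.
  have T0 := @T_gt0 R.
  have bF n : `|F T| <= t n * T.
    have cs := hoelder_continuous (C30e_hoelder (s n)).
    have [G G0 dG] := antiderivative cs.
    have GT : G T = 0.
      have : mean (s n) = 0 by case: (s n) => ? /= /and3P[_ _ /eqP].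
      rewrite (meanE cs dG) G0 subr0 => /eqP; rewrite mulf_eq0 invr_eq0.
      by rewrite gt_eqF//= => /eqP.
    have dFG : has_deriv (fun x => F x - G x) (fun x => v 0%N x - s n x).
      by move=> x; exact: (derivB (dF x) (dG x)).
    have := has_deriv_lip dFG (fun x => vP 0%N isT x n) T 0.
    by rewrite F0 G0 GT !subr0 (gtr0_norm T0).
  apply: (@mulIf _ T^-1); first by rewrite invr_eq0 gt_eqF.
  rewrite mul0r; apply: eqv => n; rewrite subr0 normrM normfV (gtr0_norm T0).
  by rewrite ler_pdivrMr//; have := bF n; have := mulr_ge0 (tge0 n) (ltW T0); lra.
have vC : v 0%N \in C30e_fun a.
  by apply/and3P; split => //; apply/asboolP.
exists (MkC30e vC) => n; apply: C30e_norm_le => [j x j3|p pD].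
  have le : `|((v 0%N)^`(j))%classic x - ((s n)^`(j))%classic x| <= t n.
    by rewrite E//; exact: vP.
  exact: (eq_ind _ (fun z => `|z| <= t n) le _ (esym (C30e_deriveB (MkC30e vC) (s n) x j3))).
have le : `|hoelder_quotient a ((v 0%N)^`(3))%classic p -
    hoelder_quotient a ((s n)^`(3))%classic p| <= t n by rewrite E//; exact: qv.
exact: (eq_ind _ (fun z => `|z| <= t n) le _
  (esym (C30e_quotientB (MkC30e vC) (s n) p))).
Qed.

End hoelder_tools.

(** * Power series in normed spaces *)

Section power_series.
Variables (R : realType) (V : normedModType R).
Implicit Types (s c : nat -> V) (t q e : R).

(** Completeness restricted to the rate at which power series converge. *)
Definition geometrically_complete := forall s (M q : R), 0 <= q < 1 ->
  (forall n m, (n <= m)%N -> `|s m - s n| <= M * q ^+ n) ->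
  exists v : V, s @ \oo --> v.

Lemma geometric_tail q (n m : nat) : 0 <= q < 1 ->
  \sum_(n <= k < m) q ^+ k <= q ^+ n / (1 - q).
Proof.
move=> /andP[q0 q1]; have d0 : 0 < 1 - q by rewrite subr_gt0.
have [mn|nm] := leqP m n; first by rewrite big_geq// divr_ge0 ?exprn_ge0// ltW.
rewrite ler_pdivlMr//.
suff -> : (\sum_(n <= k < m) q ^+ k) * (1 - q) = q ^+ n - q ^+ m.
  by rewrite lerBlDr lerDl exprn_ge0.
elim: m nm => // m IH; rewrite ltnS leq_eqVlt => /predU1P[<-|nm].
  by rewrite big_nat1 exprS; ring.
by rewrite big_nat_recr ?(ltnW nm)//= mulrDl IH// exprS; ring.
Qed.

Lemma sum_norm_geometric c M q (n m : nat) : 0 <= M -> 0 <= q < 1 ->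
  (forall k, `|c k| <= M * q ^+ k) ->
  `|\sum_(n <= k < m) c k| <= M / (1 - q) * q ^+ n.
Proof.
move=> M0 q01 cM; rewrite (le_trans (ler_norm_sum _ _ _))//.
apply: (@le_trans _ _ (\sum_(n <= k < m) M * q ^+ k)); first exact: ler_sum.
by rewrite -mulr_sumr -mulrA ler_wpM2l// mulrC geometric_tail.
Qed.

Lemma cvg_norm_le c (v w : V) (M : R) : c @ \oo --> v ->
  (\forall n \near \oo, `|c n - w| <= M) -> `|v - w| <= M.
Proof.
move=> cv cM; have c' : (fun n => `|c n - w|) @ \oo --> `|v - w|.
  by apply: cvg_norm; apply: cvgB => //; exact: cvg_cst.
exact: (cvgr_to_le c').
Qed.

Lemma cvg_sum_nat (u : nat -> nat -> V) (v : nat -> V) (n : nat) :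
  (forall k, u k @ \oo --> v k) ->
  (fun N => \sum_(0 <= k < n) u k N) @ \oo --> \sum_(0 <= k < n) v k.
Proof.
move=> uv; elim: n => [|n IH].
  by under eq_fun do rewrite big_geq//; rewrite big_geq//; exact: cvg_cst.
under eq_fun do rewrite big_nat_recr//=.
by rewrite big_nat_recr//=; exact: cvgD IH (uv n).
Qed.

Hypothesis Vc : geometrically_complete.

Lemma cvg_dominated_geometric c M q : 0 <= q < 1 ->
  (forall k, `|c k| <= M * q ^+ k) ->
  exists2 v : V, series c @ \oo --> v &
    forall n, `|v - series c n| <= M / (1 - q) * q ^+ n.
Proof.
move=> q01 cM.
have M0 : 0 <= M by have := le_trans (normr_ge0 _) (cM 0%N); rewrite expr0 mulr1.
have tail n m : (n <= m)%N -> `|series c m - series c n| <= M / (1 - q) * q ^+ n.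
  by move=> nm; rewrite sub_series_geq//; exact: sum_norm_geometric.
have [v cv] := Vc q01 tail; exists v => // n.
by apply: (cvg_norm_le cv); exists n => // m; exact: tail.
Qed.

Variables (c : nat -> V) (M B : R).
Hypotheses (M0 : 0 <= M) (B0 : 0 < B) (cM : forall n, `|c n| <= M * B ^+ n).

Let term t n := t ^+ n *: c n.

Let termM t n : `|term t n| <= M * (B * `|t|) ^+ n.
Proof.
by rewrite /term normrZ normrX exprMn mulrA mulrC ler_wpM2r.
Qed.

(** A chosen limit, hence meaningful only where the series converges. *)
Definition power_sum t : V := get [set v | series (term t) @ \oo --> v].

Lemma power_sum_cvg t : B * `|t| < 1 -> series (term t) @ \oo --> power_sum t.
Proof.
move=> t1; rewrite /power_sum; case: xgetP => // nv.
have q01 : 0 <= B * `|t| < 1 by rewrite t1 mulr_ge0// ltW.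
by have [v cv _] := cvg_dominated_geometric q01 (termM t); case: (nv v cv).
Qed.

Lemma power_sum_tail t n : B * `|t| < 1 ->
  `|power_sum t - \sum_(0 <= k < n) t ^+ k *: c k|
    <= M / (1 - B * `|t|) * (B * `|t|) ^+ n.
Proof.
move=> t1; have q01 : 0 <= B * `|t| < 1 by rewrite t1 mulr_ge0// ltW.
have [v cv vP] := cvg_dominated_geometric q01 (termM t).
by rewrite (cvg_unique _ (power_sum_cvg t1) cv)//; exact: vP.
Qed.

(** Contribution of the n-th term to the k-th coefficient at the new centre e, by the binomial
    formula for (e + (t - e))^n. *)
Let re e k n := ('C(n, k)%:R * e ^+ (n - k)) *: c n.

Let re_le e k r n : 0 < r -> `|re e k n| <= M / r ^+ k * (B * (`|e| + r)) ^+ n.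
Proof.
move=> r0; have [kn|nk] := leqP k n; last first.
  rewrite /re bin_small// mul0r scale0r normr0 mulr_ge0//.
    by rewrite divr_ge0// exprn_ge0// ltW.
  by rewrite exprn_ge0// mulr_ge0 ?addr_ge0// ltW.
have bin : 'C(n, k)%:R * `|e| ^+ (n - k) <= (`|e| + r) ^+ n / r ^+ k.
  rewrite ler_pdivlMr ?exprn_gt0// exprDn (bigD1 (Ordinal (kn : (k < n.+1)%N)))//=.
  rewrite -[X in _ <= X + _]mulr_natl mulrA lerDl sumr_ge0// => i _.
  by rewrite mulrn_wge0// mulr_ge0// exprn_ge0// ltW.
rewrite /re normrZ normrM normrX ger0_norm// exprMn.
rewrite (_ : M / r ^+ k * _ = (`|e| + r) ^+ n / r ^+ k * (M * B ^+ n)); last by ring.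
by rewrite ler_pM// mulr_ge0// exprn_ge0.
Qed.

Lemma power_sum_reexpansion e : B * `|e| < 1 ->
  exists (r K : R) (c' : nat -> V), [/\ 0 < r, 0 <= K &
    forall t n, `|t - e| < r -> `|power_sum t -
      \sum_(0 <= k < n) (t - e) ^+ k *: c' k| <=
      K / (1 - `|t - e| / r) * (`|t - e| / r) ^+ n].
Proof.
move=> e1.
(* Half the distance from |e| to 1 / B, so that B (|e| + r) < 1 and the rearranged double series
   still converges geometrically. *)
pose r := (B^-1 - `|e|) / 2.
have r0 : 0 < r by rewrite divr_gt0// subr_gt0 -[ltRHS]mul1r ltr_pdivlMr// mulrC.
pose q := B * (`|e| + r).
have q01 : 0 <= q < 1.
  rewrite mulr_ge0 ?addr_ge0 ?(ltW r0) ?(ltW B0)//=.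
  rewrite /q /r mulrC -ltr_pdivlMr// mul1r.
  have : `|e| < B^-1 by rewrite -[ltRHS]mul1r ltr_pdivlMr// mulrC.
  lra.
have q1 : 0 < 1 - q by rewrite subr_gt0; case/andP: q01.
pose K := M / (1 - q).
have K0 : 0 <= K by rewrite divr_ge0// ltW.
have /choice[c' cP] : forall k, exists v : V, series (re e k) @ \oo --> v.
  by move=> k; have [v cv _] := cvg_dominated_geometric q01 (fun n => re_le e k n r0); exists v.
exists r, K, c'; split => // t n tr; set tau := t - e.
have sN k N : `|series (re e k) N| <= K / r ^+ k.
  have /(_ 0%N N) := sum_norm_geometric _ _ _ q01 (fun n => re_le e k n r0).
  rewrite expr0 mulr1 /series/= /K => h.
  by rewrite mulrAC h// divr_ge0// exprn_ge0// ltW.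
have tr01 : 0 <= `|tau| / r < 1.
  by rewrite divr_ge0 ?(ltW r0)//= ltr_pdivrMr// mul1r.
have t1 : B * `|t| < 1.
  case/andP: q01 => _; apply: le_lt_trans; rewrite /q ler_wpM2l ?(ltW B0)//.
  rewrite -(subrK e t) addrC (le_trans (ler_normD _ _))// lerD2l.
  exact: ltW.
have fin N : `|series (term t) N - \sum_(0 <= k < n) tau ^+ k *: series (re e k) N| <=
    K / (1 - `|tau| / r) * (`|tau| / r) ^+ n.
  (* Only partial sums are rearranged, where the double sum is finite; extending k up to n + N costs
     nothing, since the binomials vanish beyond the degree. The limit in N is taken afterwards. *)
  have -> : series (term t) N = \sum_(0 <= k < n + N) tau ^+ k *: series (re e k) N.
    under [RHS]eq_bigr do rewrite /series/= scaler_sumr.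
    rewrite exchange_big_nat/=; apply: eq_big_nat => i /andP[_ iN].
    rewrite /term -(subrK e t) -/tau addrC exprDn scaler_suml.
    rewrite (@big_cat_nat _ _ _ i.+1)//=; last first.
      by rewrite (leq_trans iN)// leq_addl.
    rewrite [X in _ + X]big_nat_cond [X in _ + X]big1 ?addr0; last first.
      move=> k /andP[/andP[ik _] _].
      by rewrite /re bin_small// mul0r scale0r scaler0.
    rewrite big_mkord; apply: eq_bigr => k _.
    by rewrite /re scalerA; congr (_ *: _); rewrite -mulr_natl; ring.
  rewrite (@big_cat_nat _ _ _ n)//= ?leq_addr// addrAC subrr add0r.
  apply: sum_norm_geometric => // k.
  rewrite normrZ normrX expr_div_n mulrC mulrA mulrAC ler_wpM2r ?exprn_ge0//.
rewrite -[`|_|](_ : `|power_sum t - \sum_(0 <= k < n) tau ^+ k *: c' k - 0| = _);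
  last by rewrite subr0.
have cvd : (fun N => series (term t) N - \sum_(0 <= k < n) tau ^+ k *: series (re e k) N)
    @ \oo --> power_sum t - \sum_(0 <= k < n) tau ^+ k *: c' k.
  apply: cvgB; first exact: power_sum_cvg.
  apply: cvg_sum_nat => k; apply: cvgZ; [exact: cvg_cst|exact: cP].
apply: (cvg_norm_le cvd); exists 0%N => // N _.
by rewrite subr0; exact: fin.
Qed.

Lemma power_sum_analytic e : B * `|e| < 1 -> analytic_at power_sum e.
Proof.
move=> /power_sum_reexpansion[r [K [c' [r0 K0 cP]]]].
exists c'; near=> t.
have tr : `|t - e| < r.
  rewrite distrC; near: t; apply/nbhs_ballP; exists r => //.
apply/cvgrPdist_le => d d0.
have tr01 : 0 <= `|t - e| / r < 1.
  by rewrite divr_ge0 ?(ltW r0)//= ltr_pdivrMr// mul1r.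
have : (fun n => K / (1 - `|t - e| / r) * (`|t - e| / r) ^+ n) @ \oo --> 0.
  rewrite -[0](mulr0 (K / (1 - `|t - e| / r))); apply: cvgM; first exact: cvg_cst.
  by apply: cvg_expr; rewrite ger0_norm; case/andP: tr01.
move=> /cvgrPdist_le/(_ _ d0); apply: filterS => n; rewrite sub0r normrN => h.
by apply: le_trans (cP _ _ tr) _; apply: le_trans h; exact: ler_norm.
Unshelve. all: by end_near. Qed.

(** The expansion at e, cut after its constant term, leaves an error of order |t - e|. *)
Lemma power_sum_continuous e : B * `|e| < 1 -> {for e, continuous power_sum}.
Proof.
move=> /power_sum_reexpansion[r [K [c' [r0 K0 cP]]]].
have E : power_sum e = c' 0%N.
  apply/eqP; rewrite -subr_eq0 -normr_le0.
  have := cP e 1%N; rewrite subrr normr0 mul0r expr1 mulr0 => /(_ r0).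
  by rewrite big_nat1 expr0 scale1r.
apply/cvgrPdist_le => d d0; near=> t.
have tr : `|t - e| <= r / 2.
  rewrite distrC; near: t; apply: cvgr_dist_le; first exact: cvg_id.
  by rewrite divr_gt0.
have td : `|t - e| <= d * r / (2 * (K + 1)).
  rewrite distrC; near: t; apply: cvgr_dist_le; first exact: cvg_id.
  by rewrite divr_gt0 ?mulr_gt0// ltr_wpDl.
have tr' : `|t - e| < r by lra.
have := cP t 1%N tr'; rewrite big_nat1 expr0 scale1r -E expr1 distrC => le1; apply: (le_trans le1).
have K1 : 0 < K + 1 by lra.
have z : `|t - e| / r <= 1 / 2 by rewrite ler_pdivrMr//; lra.
have y : 0 <= `|t - e| / r by rewrite divr_ge0// ltW.
have : K / (1 - `|t - e| / r) <= 2 * (K + 1).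
  by rewrite ler_pdivrMr; nra.
move=> k; apply: (@le_trans _ _ (2 * (K + 1) * (`|t - e| / r))).
  by rewrite ler_wpM2r.
rewrite mulrA ler_pdivrMr//; move: td; rewrite ler_pdivlMr ?mulr_gt0//.
by rewrite mulrC.
Unshelve. all: by end_near. Qed.

End power_series.

Section pair_complete.
Variables (R : realType) (a : R).

Lemma real_complete : geometrically_complete R.
Proof.
move=> s M q q01 sM; apply/cvg_ex; apply: cauchy_cvg; apply/cauchy_exP => e e0.
have /cvgrPdist_lt/(_ _ e0)[n _ /(_ n (leqnn n))] :
    (fun n => M * q ^+ n) @ \oo --> 0.
  rewrite -[0](mulr0 M); apply: cvgM; first exact: cvg_cst.
  by apply: cvg_expr; rewrite ger0_norm; case/andP: q01.
rewrite sub0r normrN => tn; exists (s n); exists n => // m /= nm.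
rewrite /ball/= distrC (le_lt_trans _ tn)//.
by rewrite (le_trans _ (ler_norm _))// sM.
Qed.

Lemma pair_complete : geometrically_complete (R * C30e a)%type.
Proof.
move=> s M q q01 sM.
have t0 : (fun n => M * q ^+ n) @ \oo --> 0.
  rewrite -[0](mulr0 M); apply: cvgM; first exact: cvg_cst.
  by apply: cvg_expr; rewrite ger0_norm; case/andP: q01.
have s1 n m : (n <= m)%N -> `|(s m).1 - (s n).1| <= M * q ^+ n.
  by move=> nm; rewrite (le_trans _ (sM _ _ nm))// prod_normE le_max lexx.
have [v1 v1P] := real_complete (s := fun n => (s n).1) q01 s1.
have [v2 v2P] := C30e_complete t0 (s := fun n => (s n).2)
  ltac:(by move=> n m nm; rewrite (le_trans _ (sM _ _ nm))//
    prod_normE le_max lexx orbT).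
exists (v1, v2); apply/cvgrPdist_le => e e0.
have /cvgrPdist_le/(_ (e / 5)) := t0.
case; first by rewrite divr_gt0.
move=> n _ nP; have /cvgrPdist_le/(_ _ e0)[n' _ nP'] := v1P.
exists (maxn n n') => // m; rewrite /= geq_max => /andP[nm nm'].
rewrite prod_normE ge_max; apply/andP; split; first exact: nP'.
rewrite (le_trans (v2P m))//.
have := nP _ nm; rewrite sub0r normrN => h.
by have := le_trans (ler_norm _) h; lra.
Qed.

End pair_complete.

(** * The oscillator equation: uniqueness and dependence on parameters *)

Section oscillator.
Variable R : realType.
Implicit Types (k lam x y s t : R) (h : R -> R).

(* The graph f = m * h has f'' = - lam f (1 + f'^2)^(3/2) when k = lam m^2 / 4,
   since then 1 / sqrt (1 + f'^2) = 1 - 2 k (1 - h^2) is the first integral. *)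
Definition osc lam k h h1 := [/\ has_deriv h h1,
  has_deriv h1 (fun x => - lam * h x / (1 - 2 * k * (1 - h x ^+ 2)) ^+ 3),
  h 0 = 1, h1 0 = 0 & forall x, `|h x| <= 1].

Lemma sqr_le1 x : `|x| <= 1 -> x ^+ 2 <= 1.
Proof. by move=> x1; rewrite -real_normK ?num_real// expr_le1. Qed.

Lemma osc_denom_ge k z : 0 <= k -> `|z| <= 1 -> 1 - 2 * k <= 1 - 2 * k * (1 - z ^+ 2).
Proof.
by move=> k0 /sqr_le1 z1; have := sqr_ge0 z; have := mulr_ge0 k0 (sqr_ge0 z); lra.
Qed.

Lemma osc_scale lam k h h1 c : osc lam k h h1 ->
  osc (c ^+ 2 * lam) k (fun x => h (c * x)) (fun x => c * h1 (c * x)).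
Proof.
move=> [d1 d2 h0 h10 hle]; split.
- move=> x; apply: (is_derive1_eq (deriv_comp (d1 (c * x)) (derivZ c (deriv_id x)))).
  by ring.
- move=> x; apply: (is_derive1_eq (derivZ c
    (deriv_comp (d2 (c * x)) (derivZ c (deriv_id x))))).
  by ring.
- by rewrite mulr0.
- by rewrite mulr0 h10 mulr0.
- by move=> x; exact: hle.
Qed.

(** P bounds the inverse denominators v and v'. The 7 splits into 1 from (z - z') v^3 and 6 from z'
    (v^3 - v'^3), where |v - v'| <= 2 P^2 d and the quadratic cofactor is at most 3 P^2. *)
Lemma osc_force_lip k k' K z z' (P := (1 - 2 * K)^-1) :
  0 <= k <= K -> 0 <= k' <= K -> K < 1 / 2 -> `|z| <= 1 -> `|z'| <= 1 ->
  `|z / (1 - 2 * k * (1 - z ^+ 2)) ^+ 3 - z' / (1 - 2 * k' * (1 - z' ^+ 2)) ^+ 3|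
  <= 7 * P ^+ 4 * (`|z - z'| + `|k - k'|).
Proof.
move=> /andP[k0 kK] /andP[k0' kK'] K1 z1 z1'.
have q0 : 0 < 1 - 2 * K by lra.
set q := 1 - 2 * k * _; set q' := 1 - 2 * k' * _.
have qK : 1 - 2 * K <= q by have := osc_denom_ge k0 z1; rewrite -/q; lra.
have qK' : 1 - 2 * K <= q' by have := osc_denom_ge k0' z1'; rewrite -/q'; lra.
have qp : 0 < q by lra.
have qp' : 0 < q' by lra.
pose v := q^-1; pose v' := q'^-1.
have v0 : 0 <= v by rewrite invr_ge0 ltW.
have v0' : 0 <= v' by rewrite invr_ge0 ltW.
have vP : v <= P by rewrite lef_pV2 ?posrE.
have vP' : v' <= P by rewrite lef_pV2 ?posrE.
have P1 : 1 <= P by rewrite /P invf_ge1//; lra.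
have P0 : 0 <= P by lra.
have qq : `|q - q'| <= 2 * (`|z - z'| + `|k - k'|).
  have -> : q - q' = 2 * k * ((z - z') * (z + z')) + 2 * (k' - k) * (1 - z' ^+ 2).
    by rewrite /q /q'; ring.
  have b1 : `|2 * k * ((z - z') * (z + z'))| <= 2 * `|z - z'|.
    rewrite !normrM (ger0_norm k0) ger0_norm//.
    have : `|z + z'| <= 2 by rewrite (le_trans (ler_normD _ _))//; lra.
    have : 2 * k <= 1 by lra.
    have := normr_ge0 (z - z'); have := normr_ge0 (z + z').
    move: (`|z - z'|) (`|z + z'|) => u1 u2 u20 u10 k2 u22.
    rewrite -[leRHS]mul1r ler_pM ?mulr_ge0// mulrC.
    by rewrite ler_wpM2r.
  have b2 : `|2 * (k' - k) * (1 - z' ^+ 2)| <= 2 * `|k - k'|.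
    rewrite !normrM (distrC k') ger0_norm// -[leRHS]mulr1 ler_wpM2l ?mulr_ge0//.
    have := sqr_le1 z1'; have := sqr_ge0 z' => u0 u1.
    by rewrite ger0_norm ?subr_ge0//; lra.
  by rewrite (le_trans (ler_normD _ _))//; lra.
have vv : `|v - v'| <= P ^+ 2 * (2 * (`|z - z'| + `|k - k'|)).
  have -> : v - v' = v * v' * (q' - q).
    by rewrite /v /v'; field; rewrite !gt_eqF.
  rewrite normrM (ger0_norm (mulr_ge0 v0 v0')) (distrC q') ler_pM ?mulr_ge0//.
  by rewrite expr2 ler_pM.
have -> : z / q ^+ 3 - z' / q' ^+ 3 = (z - z') * v ^+ 3 +
    z' * ((v - v') * (v ^+ 2 + v * v' + v' ^+ 2)).
  by rewrite -!exprVn -/v -/v'; ring.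
set d := `|z - z'| + _ in vv qq *.
have d0 : 0 <= d by rewrite addr_ge0.
have h1 : `|(z - z') * v ^+ 3| <= d * P ^+ 4.
  rewrite normrM ler_pM//; first by rewrite lerDl.
  rewrite ger0_norm ?exprn_ge0// (@le_trans _ _ (P ^+ 3))//.
    by rewrite lerXn2r ?nnegrE.
  by rewrite ler_weXn2l.
have h2 : `|z' * ((v - v') * (v ^+ 2 + v * v' + v' ^+ 2))| <=
    1 * ((P ^+ 2 * (2 * d)) * (3 * P ^+ 2)).
  rewrite normrM ler_pM// normrM ler_pM//.
  rewrite ger0_norm ?addr_ge0 ?mulr_ge0 ?exprn_ge0//.
  have e1 : v ^+ 2 <= P ^+ 2 by rewrite lerXn2r ?nnegrE.
  have e2 : v' ^+ 2 <= P ^+ 2 by rewrite lerXn2r ?nnegrE.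
  have e3 : v * v' <= P * P by rewrite ler_pM.
  by move: e3; rewrite -expr2; lra.
rewrite (le_trans (ler_normD _ _))// (le_trans (lerD h1 h2))//.
by rewrite le_eqVlt; apply/orP; left; apply/eqP; ring.
Qed.

(** Gronwall for the difference of two solutions with the same data at 0, where eta measures the
    change of the parameters. Equal parameters give eta = 0 and thus uniqueness; otherwise the bound
    yields continuity in k. *)
Lemma osc_dependence lam lam' k k' K L A h h1 h' h1' (P := (1 - 2 * K)^-1)
    (eta := 7 * L * P ^+ 4 * `|k - k'| + P ^+ 3 * `|lam - lam'|) :
  0 <= lam <= L -> 0 <= lam' -> 0 <= k <= K -> 0 <= k' <= K -> K < 1 / 2 ->
  osc lam k h h1 -> osc lam' k' h' h1' -> forall x, 0 <= x <= A ->
  (h x - h' x) ^+ 2 + (h1 x - h1' x) ^+ 2 <=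
    eta ^+ 2 * expR ((2 + 7 * L * P ^+ 4) * A).
Proof.
move=> /andP[l0 lL] l0' kK kK' K1 [d1 d2 h0 h10 hle] [d1' d2' h0' h10' hle'] x xA.
have q0 : 0 < 1 - 2 * K by lra.
have P0 : 0 <= P by rewrite invr_ge0 ltW.
have L0 : 0 <= L by exact: le_trans lL.
have [k0 _] := andP kK; have [k0' kK2'] := andP kK'.
apply: (@gronwall2 _ (fun x => h x - h' x) (fun x => h1 x - h1' x) _
  (7 * L * P ^+ 4) eta A _ _ (fun x => derivB (d1 x) (d1' x))
  (fun x => derivB (d2 x) (d2' x))) => //.
- by rewrite !mulr_ge0// exprn_ge0.
- by rewrite addr_ge0// !mulr_ge0// exprn_ge0.
- by rewrite h0 h0' subrr.
- by rewrite h10 h10' subrr.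
- move=> {xA}x _ /=.
  have F := osc_force_lip kK kK' K1 (hle x) (hle' x).
  set q := (1 - 2 * k * _) in F *; set q' := (1 - 2 * k' * _) in F *.
  have -> : - lam * h x / q ^+ 3 - - lam' * h' x / q' ^+ 3 =
     - (lam * (h x / q ^+ 3 - h' x / q' ^+ 3) + (lam - lam') * (h' x / q' ^+ 3)).
    by ring.
  rewrite normrN (le_trans (ler_normD _ _))// 2!normrM (ger0_norm l0).
  have q1' : P ^-1 <= q'.
    by rewrite invrK; have := osc_denom_ge k0' (hle' x); rewrite -/q'; lra.
  have qp : 0 < q' by apply: lt_le_trans q1'; rewrite invr_gt0 invr_gt0.
  have b2 : `|h' x / q' ^+ 3| <= P ^+ 3.
    rewrite normrM -[leRHS]mul1r ler_pM// normfV normrX (gtr0_norm qp) -exprVn.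
    rewrite lerXn2r ?nnegrE ?invr_ge0 ?(ltW qp) ?(ltW q0)//.
    by rewrite /P lef_pV2 ?posrE//; move: q1'; rewrite /P invrK.
  have b1 : lam * `|h x / q ^+ 3 - h' x / q' ^+ 3| <=
      L * (7 * P ^+ 4 * (`|h x - h' x| + `|k - k'|)).
    by rewrite ler_pM.
  have b3 : `|lam - lam'| * `|h' x / q' ^+ 3| <= `|lam - lam'| * P ^+ 3.
    by rewrite ler_wpM2l.
  by rewrite (le_trans (lerD b1 b3))// /eta le_eqVlt; apply/orP; left; apply/eqP; ring.
Qed.

Lemma osc_unique_ge0 lam k h h1 h' h1' x : 0 <= lam -> 0 <= k < 1 / 2 ->
  osc lam k h h1 -> osc lam k h' h1' -> 0 <= x -> h x = h' x.
Proof.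
move=> l0 /andP[k0 k1] oh oh' x0.
have kk : 0 <= k <= k by rewrite k0 lexx.
have ll : 0 <= lam <= lam by rewrite l0 lexx.
have xx : 0 <= x <= x by rewrite x0 lexx.
have := osc_dependence ll l0 kk kk k1 oh oh' xx.
rewrite !subrr normr0 !mulr0 addr0 expr0n/= mul0r => le0.
apply/eqP; rewrite -subr_eq0 -sqrf_eq0 eq_le sqr_ge0 andbT.
by have := sqr_ge0 (h1 x - h1' x); lra.
Qed.

(** The Gronwall bound looks only to the right of 0; the left half-line is reached by reflection,
    that is by [osc_scale] with the factor -1. *)
Lemma osc_unique lam k h h1 h' h1' : 0 <= lam -> 0 <= k < 1 / 2 ->
  osc lam k h h1 -> osc lam k h' h1' -> h = h'.
Proof.
move=> l0 k01 oh oh'; apply/funext => x; have [x0|x0] := leP 0 x.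
  exact: (osc_unique_ge0 l0 k01 oh oh').
have l1 : 0 <= (-1) ^+ 2 * lam by rewrite sqrrN expr1n mul1r.
have x0' : 0 <= - x by rewrite oppr_ge0 ltW.
have := @osc_unique_ge0 _ _ _ _ _ _ _ l1 k01 (osc_scale (-1) oh)
  (osc_scale (-1) oh') x0'.
by rewrite /= mulN1r opprK.
Qed.

Lemma osc_even lam k h h1 : 0 <= lam -> 0 <= k < 1 / 2 -> osc lam k h h1 ->
  forall x, h (- x) = h x.
Proof.
move=> l0 k01 oh x; have := osc_scale (-1) oh; rewrite sqrrN expr1n mul1r => oh'.
by have /(congr1 (fun g => g x)) := osc_unique l0 k01 oh' oh; rewrite /= mulN1r.
Qed.

End oscillator.

(** * The oscillator solved by quadrature *)

Section quadrature.
Variable R : realType.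
Implicit Types (k x y s t u : R).

(* [arc_speed k s] is dt/ds along h = cos s when the frequency is normalised, by
   the first integral h'^2 = (1 - h^2) (1 - k (1 - h^2)) / (1 - 2k (1 - h^2))^2. *)
Definition speed u : R := (1 - 2 * u) / Num.sqrt (1 - u).

Lemma speed_bounds u : 0 <= u < 1 / 2 -> 1 - 2 * u <= speed u <= 1.
Proof.
move=> /andP[u0 u1]; have p : 0 < 1 - u by lra.
have q : 0 < Num.sqrt (1 - u) by rewrite sqrtr_gt0.
have q1 : Num.sqrt (1 - u) <= 1.
  by rewrite -[leRHS]sqrtr1 ler_wsqrtr//; lra.
have qq : 1 - u <= Num.sqrt (1 - u).
  rewrite -[leLHS](sqr_sqrtr (ltW p)) expr2 ler_piMl// ltW//.
apply/andP; split; last by rewrite ler_pdivrMr//; lra.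
by rewrite ler_pdivlMr// ler_piMr//; lra.
Qed.

(** In terms of p = sqrt (1 - u) the speed is 2 p - 1 / p, which increases with p and so decreases
    with u. The 4 is 2 + 1 / (p q) with p q >= 1/2, and p + q >= 1 bounds p - q by t - u. *)
Lemma speed_diff u t : 0 <= u <= t -> t <= 1 / 2 ->
  0 <= speed u - speed t <= 4 * (t - u).
Proof.
move=> /andP[u0 ut] t1.
pose p := Num.sqrt (1 - u); pose q := Num.sqrt (1 - t).
have q0 : 0 < q by rewrite sqrtr_gt0; lra.
have p0 : 0 < p by rewrite sqrtr_gt0; lra.
have pE : p ^+ 2 = 1 - u by rewrite sqr_sqrtr//; lra.
have qE : q ^+ 2 = 1 - t by rewrite sqr_sqrtr//; lra.
have qp : q <= p by rewrite ler_wsqrtr//; lra.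
have -> : speed u - speed t = (p - q) * (2 + (p * q)^-1).
  rewrite /speed -/p -/q.
  have -> : 1 - 2 * u = 2 * p ^+ 2 - 1 by rewrite pE; ring.
  have -> : 1 - 2 * t = 2 * q ^+ 2 - 1 by rewrite qE; ring.
  by field; rewrite !gt_eqF.
have -> : t - u = (p - q) * (p + q).
  by have -> : t - u = p ^+ 2 - q ^+ 2 by [rewrite pE qE; ring]; ring.
have pq : 1 / 2 <= p * q.
  apply: (@le_trans _ _ (q ^+ 2)); first by rewrite qE; lra.
  by rewrite expr2 ler_wpM2r// ltW.
have pq0 : 0 < p * q by rewrite mulr_gt0.
have ipq : (p * q)^-1 <= 2.
  by rewrite invf_ple ?posrE//; lra.
have ipq0 : 0 <= (p * q)^-1 by rewrite invr_ge0 ltW.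
have d : 0 <= p - q by rewrite subr_ge0.
have pq1 : 1 <= p + q.
  have : q ^+ 2 <= q * 1.
    rewrite expr2 ler_wpM2l ?(ltW q0)// -[leRHS]sqrtr1 ler_wsqrtr//; lra.
  by rewrite qE; lra.
apply/andP; split; first by rewrite mulr_ge0// addr_ge0.
by rewrite [leRHS]mulrCA ler_wpM2l//; lra.
Qed.

Definition arc_speed k s := speed (k * sin s ^+ 2).

Lemma sin2_itv s : 0 <= (sin s : R) ^+ 2 <= 1.
Proof. by have := cos2Dsin2 s; have := sqr_ge0 (cos s); have := sqr_ge0 (sin s); lra. Qed.

Lemma k_sin2_itv k s : 0 <= k < 1 / 2 -> 0 <= k * sin s ^+ 2 <= k.
Proof.
move=> /andP[k0 _]; have /andP[s0 s1] := sin2_itv s.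
by rewrite mulr_ge0//= ler_piMr.
Qed.

Lemma arc_speed_bounds k s : 0 <= k < 1 / 2 -> 1 - 2 * k <= arc_speed k s <= 1.
Proof.
move=> k01; have /andP[h1 h2] := k_sin2_itv s k01.
have [k0 k1] := andP k01.
have /speed_bounds/andP[h3 h4] : 0 <= k * sin s ^+ 2 < 1 / 2 by lra.
by apply/andP; split => //; rewrite /arc_speed; lra.
Qed.

Lemma continuous_arc_speed k : 0 <= k < 1 / 2 -> continuous (arc_speed k).
Proof.
move=> k01 s; have /andP[h1 h2] := k_sin2_itv s k01; have /andP[k0 k1] := k01.
have p : 0 < 1 - k * sin s ^+ 2 by lra.
have dn := derivB (deriv_cst (1 : R) s) (derivZ k (derivX 1 (is_derive_sin s))).
have dm := derivB (deriv_cst (1 : R) s) (derivZ 2 (derivZ k (derivX 1 (is_derive_sin s)))).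
have r0 : Num.sqrt (1 - k * sin s ^+ 2) != 0 by rewrite gt_eqF// sqrtr_gt0.
have da := derivM dm (derivV (deriv_sqrt dn p) r0).
by apply: differentiable_continuous; apply/derivable1_diffP;
  exact: (@ex_derive _ _ _ _ _ _ _ da).
Qed.

Definition arc k : R -> R := get [set F | F 0 = 0 /\ has_deriv F (arc_speed k)].

Lemma arcP k : 0 <= k < 1 / 2 -> arc k 0 = 0 /\ has_deriv (arc k) (arc_speed k).
Proof.
move=> k01; rewrite /arc; case: xgetP => // nF.
have [F F0 dF] := antiderivative (continuous_arc_speed k01).
by case: (nF F).
Qed.

Definition Omega k : R := arc k pi / pi.

Section fixed_modulus.
Variable k : R.
Hypothesis k01 : 0 <= k < 1 / 2.

Let dX := (arcP k01).2.
Let X0 := (arcP k01).1.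
Let c0 : 0 < 1 - 2 * k. Proof. by case/andP: k01; lra. Qed.

Lemma arc_incr x y : x <= y -> (1 - 2 * k) * (y - x) <= arc k y - arc k x <= y - x.
Proof.
move=> xy; have [c _ ->] := has_deriv_MVT dX xy.
have /andP[h1 h2] := arc_speed_bounds c k01.
have d : 0 <= y - x by rewrite subr_ge0.
by rewrite ler_wpM2r// ler_piMl.
Qed.

Lemma arc_lt x y : x < y -> arc k x < arc k y.
Proof.
move=> xy; have /andP[h _] := arc_incr (ltW xy); rewrite -subr_gt0.
by apply: lt_le_trans h; rewrite mulr_gt0// subr_gt0.
Qed.

Lemma Omega_bounds : 1 - 2 * k <= Omega k <= 1.
Proof.
have p0 := pi_gt0 R; have := arc_incr (ltW p0); rewrite X0 !subr0 => /andP[h1 h2].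
by rewrite /Omega ler_pdivlMr// ler_pdivrMr// mul1r h1.
Qed.

Lemma Omega_gt0 : 0 < Omega k.
Proof. by have /andP[h _] := Omega_bounds; exact: lt_le_trans h. Qed.

(** The speed depends on s only through sin^2 and so repeats after pi, where cos changes sign; this
    becomes the antiperiodicity of [cos_amp]. *)
Lemma arcDpi x : arc k (x + pi) = arc k x + pi * Omega k.
Proof.
have pn : pi != 0 :> R by rewrite gt_eqF// pi_gt0.
rewrite /Omega mulrCA mulfV// mulr1.
have d : has_deriv (fun y => arc k (y + pi) - arc k y) (fun=> 0).
  move=> y; apply: (is_derive1_eq (derivB (deriv_comp (g := fun z => z + pi)
    (dX (y + pi)) (derivD (deriv_id y) (deriv_cst pi y))) (dX y))).
  by rewrite addr0 mulr1 /arc_speed sinDpi sqrrN subrr.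
by have := has_deriv_const x 0 d; rewrite /= add0r X0; lra.
Qed.

Lemma arcM2pi n : arc k (pi *+ 2 *+ n) = pi *+ 2 *+ n * Omega k.
Proof.
elim: n => [|n IH]; first by rewrite mulr0n X0 mul0r.
by rewrite mulrSr mulr2n addrA !arcDpi -mulr2n IH; ring.
Qed.

Lemma arc_surj t : exists s, arc k s = t.
Proof.
have cX := has_deriv_continuous dX.
pose N := `|t| / (1 - 2 * k).
have N0 : 0 <= N by rewrite divr_ge0// ltW.
have NE : (1 - 2 * k) * N = `|t| by rewrite mulrC divfK// gt_eqF.
have /andP[u1 _] := arc_incr N0.
have nN : - N <= 0 by rewrite oppr_le0.
have /andP[u2 _] := arc_incr nN.
move: u1 u2; rewrite X0 !sub0r !subr0 opprK NE => u1 u2.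
have tN := ler_norm t; have tN' := ler_norm (- t); rewrite normrN in tN'.
have nNN : - N <= N by lra.
have [|s _ sE] := IVT nNN (continuous_subspaceT cX) (v := t); last by exists s.
have le1 : arc k (- N) <= t by lra.
have le2 : t <= arc k N by lra.
by rewrite ge_min le1/= le_max le2 orbT.
Qed.

(** The counterpart of the Jacobi amplitude, as [cos_amp] is that of the elliptic cosine. *)
Definition amp t := get [set s | arc k s = t].

Lemma ampK : cancel amp (arc k).
Proof.
move=> t; rewrite /amp; case: xgetP => // n0.
by have [s /n0] := arc_surj t.
Qed.

Lemma arc_inj : injective (arc k).
Proof.
move=> x y xy; have [/arc_lt|/arc_lt|//] := ltgtP x y; by rewrite xy ltxx.
Qed.

Lemma arcK : cancel (arc k) amp.
Proof. by move=> s; apply: arc_inj; rewrite ampK. Qed.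

Lemma amp_deriv : has_deriv amp (fun t => (arc_speed k (amp t))^-1).
Proof.
move=> t; rewrite -[X in is_derive X]ampK.
apply: (@is_derive_inverse _ (arc k)).
- by near=> x; exact: arcK.
- by near=> x; exact: (has_deriv_continuous dX).
- exact: dX.
- have /andP[h _] := arc_speed_bounds (amp t) k01.
  by rewrite gt_eqF//; exact: lt_le_trans h.
Unshelve. all: by end_near. Qed.

Definition cos_amp t := cos (amp t).

Definition cos_amp1 t := - (sin (amp t) * Num.sqrt (1 - k * sin (amp t) ^+ 2)
  / (1 - 2 * (k * sin (amp t) ^+ 2))).

Lemma amp0 : amp 0 = 0.
Proof. by apply: arc_inj; rewrite ampK X0. Qed.

Lemma cos_amp_osc : osc 1 k cos_amp cos_amp1.
Proof.
have pos s : 0 < Num.sqrt (1 - k * sin s ^+ 2).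
  by rewrite sqrtr_gt0; have /andP[_ h] := k_sin2_itv s k01; case/andP: k01; lra.
have pos' s : 0 < 1 - k * sin s ^+ 2.
  by have /andP[_ h] := k_sin2_itv s k01; case/andP: k01; lra.
have posq s : 0 < 1 - 2 * (k * sin s ^+ 2).
  by have /andP[_ h] := k_sin2_itv s k01; case/andP: k01; lra.
split.
- move=> t; apply: (is_derive1_eq (deriv_comp (is_derive_cos (amp t)) (amp_deriv t))).
  by rewrite /cos_amp1 /arc_speed /speed invf_div; ring.
- move=> t; set s := amp t.
  pose Q (z : R) := k * sin z ^+ 2.
  have dQ := derivZ k (derivX 1 (is_derive_sin s)).
  have dr := deriv_sqrt (derivB (deriv_cst (1 : R) s) dQ) (pos' s).
  have dq := derivV (derivB (deriv_cst (1 : R) s) (derivZ 2 dQ))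
    (lt0r_neq0 (posq s)).
  have D := derivN (derivM (derivM (is_derive_sin s) dr) dq).
  apply: (is_derive1_eq (deriv_comp D (amp_deriv t))).
  rewrite /arc_speed /speed invf_div -/s /cos_amp -/s.
  set S := sin s; set C := cos s; set r := Num.sqrt _.
  have rE : r ^+ 2 = 1 - k * S ^+ 2 by rewrite sqr_sqrtr// ltW// pos'.
  have CE : C ^+ 2 = 1 - S ^+ 2 by have := cos2Dsin2 s; rewrite -/S -/C; lra.
  have r0 : r != 0 by rewrite gt_eqF// pos.
  have q0 : 1 - 2 * (k * S ^+ 2) != 0 by rewrite gt_eqF// posq.
  have -> : 1 - 2 * k * (1 - C ^+ 2) = 1 - 2 * (k * S ^+ 2) by rewrite CE; ring.
  (* With u = k S^2 this is (1 - u)(1 + 2 u) - u (1 - 2 u) = 1; it collapses the second derivative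
     to - C / q^3, the force of the oscillator. *)
  have E : r ^+ 2 * (1 + 2 * (k * S ^+ 2)) - k * S ^+ 2 * (1 - 2 * (k * S ^+ 2)) = 1.
    by rewrite rE; ring.
  rewrite !expr1; move: E q0; set q := 1 - 2 * _ => E q0.
  transitivity (- C * (r ^+ 2 * (q + 4 * (k * S ^+ 2)) - k * S ^+ 2 * q) / q ^+ 3).
    by field; rewrite r0 q0.
  have -> : q + 4 * (k * S ^+ 2) = 1 + 2 * (k * S ^+ 2) by rewrite /q; ring.
  by rewrite E mulr1 mulN1r.
- by rewrite /cos_amp amp0 cos0.
- by rewrite /cos_amp1 amp0 sin0 !mul0r oppr0.
- by move=> t; rewrite ler_norml cos_geN1 cos_le1.
Qed.

Lemma cos_ampDpi t : cos_amp (t + pi * Omega k) = - cos_amp t.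
Proof.
rewrite /cos_amp -cosDpi; congr cos; apply: arc_inj.
by rewrite ampK arcDpi ampK.
Qed.

Lemma cos_eq1 (y : R) : 0 < y -> cos y = 1 -> exists2 n, (1 <= n)%N & y = pi *+ 2 *+ n.
Proof.
move=> y0 cy; pose T : R := pi *+ 2; have T0 : 0 < T := T_gt0 R.
pose n := Num.truncn (y / T).
have yT0 : 0 <= y / T by rewrite divr_ge0// ltW.
have /andP[n1 n2] := truncn_itv yT0.
pose z := y - T *+ n.
have z0 : 0 <= z.
  by rewrite subr_ge0 -mulr_natl -ler_pdivlMr.
have zT : z < T.
  by rewrite ltrBlDr -mulrS -mulr_natl -ltr_pdivrMr.
have cz : cos z = 1.
  by rewrite -cy -[in RHS](subrK (T *+ n) y) -/z (periodicn (@cosD2pi R)).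
have z00 : z = 0.
  (* For 0 < z < 2 pi the half angle has sin (z / 2) > 0, which contradicts 1 = cos z = 1 - 2 sin^2
     (z / 2). *)
  apply/eqP; rewrite eq_le z0 andbT leNgt; apply/negP => zp.
  have : 0 < sin (z / 2).
    by apply: sin_gt0_pi; move: zT; rewrite /T mulr2n; lra.
  have zz : z / 2 *+ 2 = z by rewrite -mulr_natr divfK.
  have := cos_mulr2n (z / 2); rewrite zz cz.
  have := cos2Dsin2 (z / 2) => h1 h2 h3.
  have : 0 < sin (z / 2) ^+ 2 by rewrite exprn_gt0.
  move: h1 h2; rewrite -mulr_natr; lra.
have yE : y = T *+ n by apply/eqP; rewrite -subr_eq0 -/z z00.
exists n => //; rewrite lt0n; apply/eqP => n0.
by move: y0; rewrite yE n0 mulr0n ltxx.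
Qed.

Lemma cos_amp_eq1 t : 0 < t -> cos_amp t = 1 ->
  exists2 n, (1 <= n)%N & t = pi *+ 2 *+ n * Omega k.
Proof.
move=> t0 ct; have a0 : 0 < amp t.
  have [//|a1|a1] := ltgtP 0 (amp t).
    by have := arc_lt a1; rewrite X0 ampK ltNge (ltW t0).
  by move: t0; rewrite -(ampK t) -a1 X0 ltxx.
have [n n1 nE] := cos_eq1 a0 ct; exists n => //.
by rewrite -(ampK t) nE arcM2pi.
Qed.

End fixed_modulus.

(** Both bounds serve: monotonicity makes [ampl] injective, and the Lipschitz estimate makes the
    branch continuous in k. *)
Lemma Omega_diff k k' : 0 <= k <= k' -> k' < 1 / 2 ->
  0 <= Omega k - Omega k' <= 4 * (k' - k).
Proof.
move=> /andP[k0 kk'] k1.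
have k01 : 0 <= k < 1 / 2 by lra.
have k01' : 0 <= k' < 1 / 2 by lra.
have [X0 dX] := arcP k01; have [X0' dX'] := arcP k01'.
have p0 := pi_gt0 R.
have [c _] := has_deriv_MVT (fun s => derivB (dX s) (dX' s)) (ltW p0).
rewrite /= X0 X0' !subr0 => E.
have /andP[s0 s1] := sin2_itv c.
have u0 : 0 <= k * sin c ^+ 2 <= k' * sin c ^+ 2 by rewrite mulr_ge0//= ler_wpM2r.
have u1 : k' * sin c ^+ 2 <= 1 / 2 by have /andP[_ h] := k_sin2_itv c k01'; lra.
have /andP[d0 d1] := speed_diff u0 u1.
rewrite /Omega -mulrBl E mulfK ?gt_eqF//.
apply/andP; split => //; apply: (le_trans d1).
rewrite -mulrBl ler_wpM2l// ler_piMr//; lra.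
Qed.

End quadrature.

(** * Steady states and their classification by modes *)

Section steady_states.
Variable R : realType.
Implicit Types (k lam m w gam x : R) (n : nat).

Local Notation T := (pi *+ 2 : R).

Lemma powR_sqr_half (s : R) n : 0 < s -> (s ^+ 2) `^ (n%:R / 2) = s ^+ n.
Proof.
move=> s0; rewrite -(powR_mulrn 2 (ltW s0)) -powRrM mulrC divfK//.
by rewrite powR_mulrn// ltW.
Qed.

(** Derivatives of a solution as polynomials in h, h1 and v, using v' = - 4 k h h1 v^2. Closeness of
    h and h1 alone thus controls all orders up to 4. *)
Definition osc_jet lam k (h h1 : R -> R) (j : nat) : R -> R := fun x =>
  let v := (1 - 2 * k * (1 - h x ^+ 2))^-1 in
  let h2 := - lam * h x * v ^+ 3 in
  match j with
  | 0 => h x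
  | 1 => h1 x
  | 2 => h2
  | 3 => - lam * (h1 x * v ^+ 3 - 12 * k * h x ^+ 2 * h1 x * v ^+ 4)
  | 4 => - lam * (h2 * v ^+ 3 - 36 * k * h x * h1 x ^+ 2 * v ^+ 4
      - 12 * k * h x ^+ 2 * h2 * v ^+ 4 + 192 * k ^+ 2 * h x ^+ 3 * h1 x ^+ 2 * v ^+ 5)
  | _ => 0
  end.

Lemma osc_jets lam k h h1 : 0 <= k < 1 / 2 -> osc lam k h h1 ->
  jets 4 (osc_jet lam k h h1).
Proof.
move=> /andP[k0 k1] [d1 d2 _ _ hle].
have q0 x : 1 - 2 * k * (1 - h x ^+ 2) != 0.
  by rewrite gt_eqF//; have := osc_denom_ge k0 (hle x); lra.
have dh x := d1 x.
have dh1 x : is_derive x (1 : R) h1 (osc_jet lam k h h1 2 x).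
  by apply: (is_derive1_eq (d2 x)); rewrite /= exprVn.
have dv x : is_derive x (1 : R) (fun x => (1 - 2 * k * (1 - h x ^+ 2))^-1)
    (- (4 * k * h x * h1 x) * (1 - 2 * k * (1 - h x ^+ 2))^-1 ^+ 2).
  apply: (is_derive1_eq (derivV (derivB (deriv_cst (1 : R) x) (derivZ (2 * k)
    (derivB (deriv_cst (1 : R) x) (derivX 1 (dh x))))) (q0 x))).
  by rewrite !expr1 -exprVn; ring.
move=> [|[|[|[|//]]]] _ x.
- exact: dh.
- exact: dh1.
- apply: (is_derive1_eq (derivM (derivZ (- lam) (dh x)) (derivX 2 (dv x)))).
  by rewrite /=; ring.
- apply: (is_derive1_eq (derivZ (- lam) (derivB (derivM (dh1 x) (derivX 2 (dv x)))
    (derivM (derivM (derivZ (12 * k) (derivX 1 (dh x))) (dh1 x)) (derivX 3 (dv x)))))).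
  by rewrite /=; ring.
Qed.

(** The derivative of the difference of both sides has the factor 4 k - lam m^2. The hypothesis is a
    nonvanishing denominator and not |h| <= 1, because for the Lindstedt sum the latter is deduced
    from this identity. *)
Lemma first_integral lam k m (h h1 : R -> R) : lam * m ^+ 2 = 4 * k ->
  (forall x, 1 - 2 * k * (1 - h x ^+ 2) != 0) -> has_deriv h h1 ->
  has_deriv h1 (fun x => - lam * h x / (1 - 2 * k * (1 - h x ^+ 2)) ^+ 3) ->
  h 0 = 1 -> h1 0 = 0 -> forall x,
  1 + (m * h1 x) ^+ 2 = (1 - 2 * k * (1 - h x ^+ 2)) ^- 2.
Proof.
move=> lmk q0 d1 d2 h0 h10 x.
have dE : has_deriv (fun y => 1 + (m * h1 y) ^+ 2 -
    (1 - 2 * k * (1 - h y ^+ 2))^-1 ^+ 2) (fun=> 0).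
  move=> y; have dv := derivV (derivB (deriv_cst (1 : R) y) (derivZ (2 * k)
    (derivB (deriv_cst (1 : R) y) (derivX 1 (d1 y))))) (q0 y).
  apply: (is_derive1_eq (derivB (derivD (deriv_cst (1 : R) y)
    (derivX 1 (derivZ m (d2 y)))) (derivX 1 dv))).
  rewrite !expr1; have q0y := q0 y; set q := 1 - _ in q0y *.
  transitivity (2 * h1 y * h y * (4 * k - lam * m ^+ 2) / q ^+ 3); first by field.
  by rewrite lmk subrr mulr0 mul0r.
have := has_deriv_const x 0 dE.
rewrite h0 h10 mulr0 expr0n expr1n subrr mulr0 subr0 invr1 expr1n addr0 subrr.
by move=> /eqP; rewrite subr_eq0 => /eqP ->; rewrite exprVn.
Qed.

Lemma osc_first_integral lam k m h h1 : 0 <= k < 1 / 2 -> lam * m ^+ 2 = 4 * k ->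
  osc lam k h h1 -> forall x,
  1 + (m * h1 x) ^+ 2 = (1 - 2 * k * (1 - h x ^+ 2)) ^- 2.
Proof.
move=> /andP[k0 k1] lmk [d1 d2 h0 h10 hle]; apply: (first_integral lmk) => // x.
by rewrite gt_eqF//; have := osc_denom_ge k0 (hle x); lra.
Qed.

(** By the first integral sqrt (1 + f'^2) = 1 / q, so the fractional powers become powers of q, and
    what remains is m h1 times terms that vanish by the two relations between the parameters. *)
Lemma osc_Upsilon w gam lam k m h h1 : 0 <= k < 1 / 2 -> lam * m ^+ 2 = 4 * k ->
  gam * lam = w -> osc lam k h h1 -> Upsilon w gam (fun x => m * h x) = cst 0.
Proof.
move=> k01 lmk glw oh; apply/funext => x.
have J := osc_jets k01 oh; have [k0 k1] := andP k01; have [_ _ _ _ hle] := oh.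
have Jm : jets 4 (fun j y => m * osc_jet lam k h h1 j y).
  by move=> j j4 y; exact: (derivZ m (J j j4 y)).
have D j : (j <= 4)%N -> ((fun y => m * h y)^`(j))%classic =
  (fun y => m * osc_jet lam k h h1 j y) by exact: (jets_derive1n Jm).
rewrite /Upsilon -[_^`()]/((fun y => m * h y)^`(1))%classic !D//.
have qp : 0 < 1 - 2 * k * (1 - h x ^+ 2).
  by have := osc_denom_ge k0 (hle x); lra.
have FI := osc_first_integral k01 lmk oh x.
rewrite /= FI -exprVn !powR_sqr_half ?invr_gt0//.
set q := 1 - 2 * k * _ in qp *.
have q0 : q != 0 by rewrite gt_eqF.
transitivity (m * h1 x * (w - gam * lam + 3 * gam * lam / q * h x ^+ 2
  * (4 * k - lam * m ^+ 2))); first by field.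
by rewrite lmk glw !subrr !mulr0 addr0 mulr0.
Qed.

Section classification.
Variables (a w gam : R) (f : C30e a).
Hypotheses (w0 : 0 < w) (gam0 : 0 < gam).
Hypothesis Uf : Upsilon w gam f = cst 0.

Let f1 := f^`()%classic.
Let f2 := (f^`(2))%classic.
Let f3 := (f^`(3))%classic.
Let lam := w / gam.
Let s x := Num.sqrt (1 + f1 x ^+ 2).

Let d0 : has_deriv f f1. Proof. exact: (C30e_has_deriv f (isT : (0 < 3)%N)). Qed.
Let d1 : has_deriv f1 f2. Proof. exact: (C30e_has_deriv f (isT : (1 < 3)%N)). Qed.
Let d2 : has_deriv f2 f3. Proof. exact: (C30e_has_deriv f (isT : (2 < 3)%N)). Qed.

Let p0 x : 0 < 1 + f1 x ^+ 2.
Proof. by rewrite ltr_pwDl// sqr_ge0. Qed.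

Let s0 x : 0 < s x. Proof. by rewrite sqrtr_gt0. Qed.

Let sE x : s x ^+ 2 = 1 + f1 x ^+ 2. Proof. by rewrite sqr_sqrtr// ltW. Qed.

Let sn0 x : s x != 0. Proof. by rewrite gt_eqF. Qed.

Let ds : has_deriv s (fun x => f1 x * f2 x / s x).
Proof.
move=> x; apply: (is_derive1_eq (deriv_sqrt (derivD (deriv_cst (1 : R) x)
  (derivX 1 (d1 x))) (p0 x))).
by rewrite expr1 -/(s x); field; exact: sn0.
Qed.

Let ff : even_fun f. Proof. by case: f => g /= /and3P[_ /asboolP]. Qed.

Let pf : periodic f T.
Proof. by case: f => g /= /and3P[/hoelder_funP[]]. Qed.

Let f10 : f1 0 = 0.
Proof.
have := derive1_parity (c := 1) (f := f) _ _ 0; rewrite oppr0.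
have h1 : forall x : R, derivable f x 1.
  by move=> x; exact: (@ex_derive _ _ _ _ _ _ _ (d0 x)).
have h2 : forall x, f (- x) = 1 * f x by move=> x; rewrite mul1r ff.
by move=> /(_ h1 h2); rewrite -/f1 mulN1r; lra.
Qed.

(** [Upsilon] is gam times the derivative of the quantity on the left. *)
Let curvature_const : exists c, forall x, f2 x / s x ^+ 3 + lam * f x = c.
Proof.
exists (f2 0 / s 0 ^+ 3 + lam * f 0) => x.
apply: (has_deriv_const x 0 (f := fun x => f2 x / s x ^+ 3 + lam * f x)) => y.
have sn3 : s y ^+ 3 != 0 by rewrite expf_neq0.
apply: (is_derive1_eq (derivD (derivM (d2 y) (derivV (derivX 2 (ds y)) sn3))
  (derivZ lam (d0 y)))).
have := congr1 (fun g => g y) Uf; rewrite /Upsilon -/f1 -/f2 -/f3.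
rewrite -[1 + _]sE !powR_sqr_half//= => U.
have sy := sn0 y; have gn : gam != 0 by rewrite gt_eqF.
transitivity ((gam * (f3 y / s y ^+ 3) - 3 * gam * (f1 y * f2 y ^+ 2 / s y ^+ 5)
  + w * f1 y) / gam); first by rewrite /lam; field; rewrite sy gn.
by rewrite U mul0r.
Qed.

Let lam0 : 0 < lam. Proof. by rewrite divr_gt0. Qed.

Let df1s : has_deriv (fun x => f1 x / s x) (fun x => f2 x / s x ^+ 3).
Proof.
move=> x; apply: (is_derive1_eq (derivM (d1 x) (derivV (ds x) (sn0 x)))).
have sx := sn0 x; transitivity (f2 x * (s x ^+ 2 - f1 x ^+ 2) / s x ^+ 3).
  by field.
by rewrite sE addrK mulr1.
Qed.

Let pf1 : periodic f1 T. Proof. exact: periodic_derive1. Qed.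

(** Over one period f' / sqrt (1 + f'^2) returns to its value and f integrates to 0, so the constant
    of [curvature_const] times the period vanishes. *)
Lemma steady_curvature x : f2 x = - lam * f x * s x ^+ 3.
Proof.
have [c cP] := curvature_const.
suff c0 : c = 0.
  have := cP x; rewrite c0 => /eqP; rewrite addr_eq0 => /eqP h.
  by rewrite mulNr -h divfK// expf_neq0.
have cf : continuous f := has_deriv_continuous d0.
have T0 := T_gt0 R.
have [F F0 dF] := antiderivative cf.
have FT : F T = 0.
  have : mean f = 0 by case: (f) => ? /= /and3P[_ _ /eqP].
  rewrite (meanE cf dF) F0 subr0 => /eqP; rewrite mulf_eq0 invr_eq0.
  by rewrite gt_eqF//= => /eqP.
have dG : has_deriv (fun x => f1 x / s x + lam * F x - c * x) (fun=> 0).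
  move=> y; apply: (is_derive1_eq (derivB (derivD (df1s y) (derivZ lam (dF y)))
    (derivZ c (deriv_id y)))).
  by rewrite mulr1 cP subrr.
have := has_deriv_const T 0 dG.
have f1T : f1 T = 0 by rewrite -[T]add0r pf1.
rewrite FT F0 f1T f10 !mul0r !mulr0 subr0 !addr0 sub0r => /eqP.
by rewrite oppr_eq0 mulf_eq0 (gt_eqF T0) orbF => /eqP.
Qed.

Let m := f 0.
Let k := lam * m ^+ 2 / 4.

(** The curvature equation multiplied by f' is an exact derivative; its constant is known because
    evenness makes the slope at 0 vanish. *)
Lemma steady_energy x : (s x)^-1 = 1 - lam / 2 * (m ^+ 2 - f x ^+ 2).
Proof.
have dE : has_deriv (fun x => lam / 2 * f x ^+ 2 - (s x)^-1) (fun=> 0).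
  move=> y; apply: (is_derive1_eq (derivB (derivZ (lam / 2) (derivX 1 (d0 y)))
    (derivV (ds y) (sn0 y)))).
  rewrite steady_curvature expr1; have sy := sn0 y; by field.
have := has_deriv_const x 0 dE; rewrite /=.
have -> : s 0 = 1 by rewrite /s f10 expr0n addr0 sqrtr1.
by rewrite invr1 -/m; lra.
Qed.

Hypothesis fn0 : f != 0.

(** If f(0) = 0, the energy reads 1 / s = 1 + lam f^2 / 2, while 1 / s <= 1 always. *)
Lemma steady_amplitude : m != 0.
Proof.
apply: contra_neq fn0 => m0; apply/val_inj/funext => x /=.
apply/eqP; rewrite -sqrf_eq0 eq_le sqr_ge0 andbT.
have := steady_energy x; rewrite m0 expr0n/= sub0r => sx.
have : (s x)^-1 <= 1.
  by rewrite invf_le1// -[leLHS]sqrtr1 ler_wsqrtr// lerDl sqr_ge0.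
by rewrite sx => h; rewrite -(pmulr_rle0 _ lam0); lra.
Qed.

(** The mean value theorem for f' / s over a period produces a zero of f; there the energy gives 1 /
    s = 1 - 2 k, which must be positive. *)
Lemma steady_modulus : 0 < k < 1 / 2.
Proof.
have mn := steady_amplitude.
have m2 : 0 < m ^+ 2 by rewrite exprn_even_gt0//= mn.
apply/andP; split; first by rewrite divr_gt0// mulr_gt0.
have T0 := T_gt0 R.
have [c _ fc] : exists2 c, 0 <= c <= T & f c = 0.
  have [c cT E] := has_deriv_MVT df1s (ltW T0).
  exists c => //; move: E.
  have -> : f1 T = 0 by rewrite -[T]add0r pf1.
  rewrite f10 !mul0r subr0 subr0 => /esym/eqP; rewrite mulf_eq0 (gt_eqF T0) orbF.
  rewrite steady_curvature mulfK ?expf_neq0// mulf_eq0 oppr_eq0 gt_eqF//=.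
  by move=> /eqP.
have := steady_energy c; rewrite fc expr0n/= subr0 => E.
have : 0 < (s c)^-1 by rewrite invr_gt0.
by rewrite E /k; lra.
Qed.

Lemma steady_osc : osc lam k (fun x => m^-1 * f x) (fun x => m^-1 * f1 x).
Proof.
have mn := steady_amplitude.
split.
- by move=> x; exact: (derivZ m^-1 (d0 x)).
- move=> x; apply: (is_derive1_eq (derivZ m^-1 (d1 x))).
  rewrite steady_curvature.
  have -> : 1 - 2 * k * (1 - (m^-1 * f x) ^+ 2) = (s x)^-1.
    by rewrite steady_energy /k; field.
  by rewrite exprVn invrK; ring.
- by rewrite -/m mulVf.
- by rewrite f10 mulr0.
- move=> x; rewrite normrM normfV ler_pdivrMl ?normr_gt0// mulr1.
  rewrite -(ler_pXn2r (_ : (0 < 2)%N)) ?nnegrE// !real_normK ?num_real//.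
  have : (s x)^-1 <= 1.
    by rewrite invf_le1// -[leLHS]sqrtr1 ler_wsqrtr// lerDl sqr_ge0.
  rewrite steady_energy => h.
  by rewrite -subr_ge0 -(pmulr_rge0 _ lam0); lra.
Qed.

(** Uniqueness identifies f / m with the explicit oscillator run at speed sqrt lam. Since f(2 pi) =
    f(0), this oscillator has the value 1 at time 2 pi sqrt lam, and [cos_amp_eq1] lists the times
    where that happens. *)
Lemma steady_mode : exists2 n, (1 <= n)%N & Num.sqrt lam = n%:R * Omega k /\
  forall x, f x = m * cos_amp k (Num.sqrt lam * x).
Proof.
have /andP[k0 k1] := steady_modulus; have k01 : 0 <= k < 1 / 2 by rewrite ltW.
have mn := steady_amplitude.
have oc := osc_scale (Num.sqrt lam) (cos_amp_osc k01).
rewrite sqr_sqrtr ?(ltW lam0)// mulr1 in oc.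
have E := osc_unique (ltW lam0) k01 steady_osc oc.
have fE x : f x = m * cos_amp k (Num.sqrt lam * x).
  by have /(congr1 (fun g => g x)) /= <- := E; rewrite mulVKf.
have T0 := T_gt0 R.
have sl : 0 < Num.sqrt lam by rewrite sqrtr_gt0.
have c1 : cos_amp k (Num.sqrt lam * T) = 1.
  apply: (mulfI mn); rewrite -fE mulr1 /m -[in LHS](add0r T).
  exact: pf.
have [n n1 nE] := cos_amp_eq1 k01 (mulr_gt0 sl T0) c1.
exists n => //; split => //; apply: (mulIf (lt0r_neq0 T0)); rewrite nE.
by rewrite -mulr_natl; ring.
Qed.

End classification.

End steady_states.

(** * Profiles of a common period and their continuity in the modulus *)

Section profiles.
Variable R : realType.
Implicit Types (k x y : R).

Local Notation T := (pi *+ 2 : R).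

(** Time is rescaled by Omega so that all moduli share the half period pi; otherwise no comparison
    uniform in x would be possible. *)
Definition profile k y : R := cos_amp k (Omega k * y).

Definition profile1 k y : R := Omega k * cos_amp1 k (Omega k * y).

Lemma profile_osc k : 0 <= k < 1 / 2 ->
  osc (Omega k ^+ 2) k (profile k) (profile1 k).
Proof. by move=> k01; have := osc_scale (Omega k) (cos_amp_osc k01); rewrite mulr1. Qed.

Lemma profile_half_wave k : 0 <= k < 1 / 2 -> half_wave (profile k).
Proof.
move=> k01; split; last first.
  by move=> x; rewrite /profile mulrDr (mulrC _ pi) cos_ampDpi.
exact: (osc_even (sqr_ge0 _) k01 (profile_osc k01)).
Qed.

Lemma profile1_periodic k : 0 <= k < 1 / 2 -> periodic (profile1 k) T.
Proof.
move=> k01; have [d _ _ _ _] := profile_osc k01.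
rewrite -(has_derivE d); apply: periodic_derive1.
exact: half_wave_periodic (profile_half_wave k01).
Qed.

Lemma profile_half_pi k : 0 <= k < 1 / 2 -> profile k (pi / 2) = 0.
Proof.
move=> k01; have [he hp] := profile_half_wave k01.
have e : - (pi / 2) + pi = pi / 2 :> R by lra.
by have := hp (- (pi / 2)); rewrite e he; lra.
Qed.

Lemma translate_itv (t x : R) : 0 < t -> exists n : int, 0 <= x + t *~ n <= t.
Proof.
move=> t0; exists (- Num.floor (x / t)); have /andP[h1 h2] := floor_itv (x / t).
rewrite mulrNz -mulrzl; apply/andP; split.
  by rewrite subr_ge0 -ler_pdivlMr.
by rewrite lerBlDr -[X in X + _]mul1r -mulrDl -ler_pdivrMr// addrC -intrD1 ltW.
Qed.

Section continuity.
Variable k0 : R.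
Hypothesis k01 : 0 <= k0 < 1 / 2.

Let F := within [set k : R | 0 <= k < 1 / 2] (nbhs k0).

Let FF : Filter F. Proof. exact: within_filter. Qed.

(** The bound at k0 is part of the notion because stability under products needs it. *)
Definition unif_cont (G : R -> R -> R) := (exists M, forall x, `|G k0 x| <= M) /\
  forall e, 0 < e -> \forall k \near F, forall x, `|G k x - G k0 x| <= e.

Lemma unif_contD G H : unif_cont G -> unif_cont H ->
  unif_cont (fun k x => G k x + H k x).
Proof.
move=> [[M GM] Gc] [[N HN] Hc]; split.
  by exists (M + N) => x; rewrite (le_trans (ler_normD _ _))// lerD.
move=> e e0; have e2 : 0 < e / 2 by rewrite divr_gt0.
apply: filterS2 (Gc _ e2) (Hc _ e2) => k h1 h2 x.
have -> : G k x + H k x - (G k0 x + H k0 x) = (G k x - G k0 x) + (H k x - H k0 x) by ring.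
by rewrite (le_trans (ler_normD _ _))//; have := h1 x; have := h2 x; lra.
Qed.

Lemma unif_contM G H : unif_cont G -> unif_cont H ->
  unif_cont (fun k x => G k x * H k x).
Proof.
move=> [[M GM] Gc] [[N HN] Hc]; split.
  by exists (M * N) => x; rewrite normrM ler_pM.
have M0 : 0 <= M by apply: le_trans (GM 0).
have N0 : 0 <= N by apply: le_trans (HN 0).
move=> e e0; pose d := Num.min 1 (e / (M + N + 1)).
have s0 : 0 < M + N + 1 by lra.
have d0 : 0 < d by rewrite lt_min ltr01 divr_gt0.
have d1 : d <= 1 by rewrite ge_min lexx.
have de : d * (M + N + 1) <= e.
  by rewrite -ler_pdivlMr// ge_min lexx orbT.
apply: filterS2 (Gc _ d0) (Hc _ d0) => k h1 h2 x.
have -> : G k x * H k x - G k0 x * H k0 x = (G k x - G k0 x) * (H k x - H k0 x)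
   + G k0 x * (H k x - H k0 x) + (G k x - G k0 x) * H k0 x by ring.
rewrite (le_trans (ler_normD _ _))// (le_trans (lerD (ler_normD _ _) (lexx _)))//.
rewrite !normrM.
have t1 : `|G k x - G k0 x| * `|H k x - H k0 x| <= d * 1.
  by rewrite ler_pM// (le_trans (h2 x)).
have t2 : `|G k0 x| * `|H k x - H k0 x| <= M * d by rewrite ler_pM.
have t3 : `|G k x - G k0 x| * `|H k0 x| <= d * N by rewrite ler_pM.
lra.
Qed.

Lemma unif_cont_cst (c : R -> R) : (forall e, 0 < e ->
  \forall k \near F, `|c k - c k0| <= e) -> unif_cont (fun k _ => c k).
Proof.
move=> cc; split; first by exists `|c k0|.
by move=> e /cc; apply: filterS.
Qed.

Lemma unif_contC (c : R) : unif_cont (fun _ _ => c).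
Proof. by apply: unif_cont_cst => e e0; near=> k; rewrite subrr normr0 ltW.
Unshelve. all: by end_near. Qed.

Lemma unif_contZ c G : unif_cont G -> unif_cont (fun k x => c * G k x).
Proof. exact/unif_contM/unif_contC. Qed.

Lemma unif_contN G : unif_cont G -> unif_cont (fun k x => - G k x).
Proof.
move=> /(unif_contZ (-1)); congr unif_cont.
by apply/funext => k; apply/funext => x; rewrite mulN1r.
Qed.

Lemma unif_contB G H : unif_cont G -> unif_cont H ->
  unif_cont (fun k x => G k x - H k x).
Proof. by move=> ? /unif_contN; exact: unif_contD. Qed.

Lemma unif_contX n G : unif_cont G -> unif_cont (fun k x => G k x ^+ n).
Proof.
move=> Gc; elim: n => [|n IH]; first exact: unif_contC.
under eq_fun do under eq_fun do rewrite exprS.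
exact: unif_contM.
Qed.

Lemma unif_contV G (c : R) : 0 < c -> (\forall k \near F, forall x, c <= G k x) ->
  (forall x, c <= G k0 x) -> unif_cont G -> unif_cont (fun k x => (G k x)^-1).
Proof.
move=> c0 Gn G0 [_ Gc]; split.
  exists c^-1 => x; have p : 0 < G k0 x by exact: lt_le_trans (G0 x).
  by rewrite ger0_norm ?invr_ge0 ?(ltW p)// lef_pV2 ?posrE.
move=> e e0; have d0 : 0 < e * c ^+ 2 by rewrite mulr_gt0// exprn_gt0.
apply: filterS2 Gn (Gc _ d0) => k h1 h2 x.
have p : 0 < G k x by exact: lt_le_trans (h1 x).
have p0 : 0 < G k0 x by exact: lt_le_trans (G0 x).
have -> : (G k x)^-1 - (G k0 x)^-1 = - (G k x - G k0 x) / (G k x * G k0 x).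
  by field; rewrite !gt_eqF.
rewrite normrM normrN normfV (ger0_norm (mulr_ge0 (ltW p) (ltW p0))).
rewrite ler_pdivrMr ?mulr_gt0// (le_trans (h2 x))// ler_wpM2l ?(ltW e0)// expr2.
by rewrite ler_pM// ltW.
Qed.

Let K := (k0 + 1 / 2) / 2.

Let near_K : \forall k \near F, 0 <= k <= K /\ `|k - k0| <= 1.
Proof.
have r0 : 0 < Num.min 1 (K - k0).
  by rewrite lt_min ltr01 /K; case/andP: k01; lra.
rewrite /F near_withinE; apply/nbhs_ballP; exists (Num.min 1 (K - k0)) => //= k.
rewrite /ball/= distrC lt_min => /andP[kd kd'] /andP[kge0 klt].
split; last exact: ltW.
by rewrite kge0 /=; have := le_lt_trans (ler_norm _) kd'; lra.
Qed.

Let near_dist e : 0 < e -> \forall k \near F, `|k - k0| <= e.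
Proof.
move=> e0; rewrite /F near_withinE; apply/nbhs_ballP; exists e => //= k.
by rewrite /ball/= distrC => kd _; exact: ltW.
Qed.

Let k0K : 0 <= k0 <= K. Proof. by rewrite /K; case/andP: k01; lra. Qed.

Let K1 : K < 1 / 2. Proof. by rewrite /K; case/andP: k01; lra. Qed.

Lemma unif_cont_id : unif_cont (fun k _ => k).
Proof. by apply: unif_cont_cst => e; exact: near_dist. Qed.

Lemma Omega_lip k k' : 0 <= k < 1 / 2 -> 0 <= k' < 1 / 2 ->
  `|Omega k - Omega k'| <= 4 * `|k - k'|.
Proof.
have main x y : 0 <= x < 1 / 2 -> 0 <= y < 1 / 2 -> x <= y ->
    `|Omega x - Omega y| <= 4 * `|x - y|.
  move=> /andP[x0 _] /andP[_ y1] xy; have xy' : 0 <= x <= y by rewrite x0.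
  have /andP[h1 h2] := Omega_diff xy' y1.
  by rewrite ger0_norm// distrC ger0_norm// subr_ge0.
move=> hk hk'; have [kk|/ltW kk] := leP k k'; first exact: main.
by rewrite distrC (distrC k); exact: main.
Qed.

Lemma unif_cont_Omega : unif_cont (fun k _ => Omega k).
Proof.
apply: unif_cont_cst => e e0; have e4 : 0 < e / 4 by rewrite divr_gt0.
apply: filterS2 near_K (near_dist e4) => k [/andP[kge0 kK] _] kd.
have k1 : 0 <= k < 1 / 2 by rewrite kge0 (le_lt_trans kK).
by rewrite (le_trans (Omega_lip k1 k01))//; lra.
Qed.

Lemma unif_cont_OmegaV : unif_cont (fun k _ => (Omega k)^-1).
Proof.
apply: (unif_contV (c := 1 - 2 * K)) unif_cont_Omega.
- by have := K1; lra.
- apply: filterS near_K => k [/andP[kge0 kK] _] _.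
  have k1 : 0 <= k < 1 / 2 by rewrite kge0 (le_lt_trans kK).
  by have /andP[h _] := Omega_bounds k1; lra.
- by move=> _; have /andP[h _] := Omega_bounds k01; have /andP[_ h'] := k0K; lra.
Qed.

Lemma unif_cont_sqrt : unif_cont (fun k _ => Num.sqrt k).
Proof.
apply: unif_cont_cst => e e0.
have := @sqrt_continuous R k0 => /cvgrPdist_le/(_ _ e0) h.
by rewrite /F near_withinE; apply: filterS h => k hk _; rewrite distrC.
Qed.

(** The common period reduces x to [0, 2 pi], where the exponential factor of [osc_dependence] is a
    constant. *)
Lemma profile_near e : 0 < e -> \forall k \near F, forall x,
  `|profile k x - profile k0 x| <= e /\ `|profile1 k x - profile1 k0 x| <= e.
Proof.
move=> e0; pose P := (1 - 2 * K)^-1; pose E := expR ((2 + 7 * 1 * P ^+ 4) * T).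
(* 7 P^4 is the effect of k on the force, 8 P^3 that of lam = Omega^2: the Lipschitz constant 4 of
   Omega times Omega(k) + Omega(k0) <= 2. *)
pose C := 7 * P ^+ 4 + 8 * P ^+ 3.
have T0 := T_gt0 R.
have P0 : 0 <= P by rewrite invr_ge0; have := K1; lra.
have C0 : 0 <= C by rewrite addr_ge0// mulr_ge0// exprn_ge0.
have E1 : 1 <= E.
  by rewrite -expR0 ler_expR mulr_ge0 ?(ltW T0)// addr_ge0// !mulr_ge0// exprn_ge0.
have E0 : 0 < E by exact: lt_le_trans E1.
have d0 : 0 < e / (E * (C + 1)) by rewrite divr_gt0// mulr_gt0//; lra.
apply: filterS2 near_K (near_dist d0) => k [kK _] kd x.
have [kge0 kleK] := andP kK.
have kI : 0 <= k < 1 / 2 by rewrite kge0 (le_lt_trans kleK).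
suff main y : 0 <= y <= T -> `|profile k y - profile k0 y| <= e /\
    `|profile1 k y - profile1 k0 y| <= e.
  have [n yT] := translate_itv x T0; rewrite -(periodic_int (half_wave_periodic
    (profile_half_wave kI)) n) -(periodic_int (half_wave_periodic
    (profile_half_wave k01)) n) -(periodic_int (profile1_periodic kI) n).
  by rewrite -(periodic_int (profile1_periodic k01) n); exact: main.
have Ok := Omega_bounds kI; have Ok0 := Omega_bounds k01.
have [Og Ol] := andP Ok; have [Og0 Ol0] := andP Ok0.
have O0 := ltW (Omega_gt0 kI); have O00 := ltW (Omega_gt0 k01).
have lam1 : 0 <= Omega k ^+ 2 <= 1 by rewrite sqr_ge0/= expr_le1.
have dist := osc_dependence (A := T) lam1 (sqr_ge0 (Omega k0)) kK k0K K1
  (profile_osc kI) (profile_osc k01).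
move=> yT; have := dist _ yT; rewrite -/P -/E !mulr1.
set eta := (X in X ^+ 2 * E) => le1.
have eta0 : 0 <= eta by rewrite addr_ge0// !mulr_ge0// ?exprn_ge0.
have etaC : eta <= C * `|k - k0|.
  have : `|Omega k ^+ 2 - Omega k0 ^+ 2| <= 8 * `|k - k0|.
    rewrite subr_sqr normrM (le_trans (ler_pM _ _ (Omega_lip kI k01)
      (_ : _ <= 2)))//; last by lra.
    by rewrite ger0_norm ?addr_ge0//; lra.
  move=> h; have : P ^+ 3 * `|Omega k ^+ 2 - Omega k0 ^+ 2| <= P ^+ 3 * (8 * `|k - k0|).
    by rewrite ler_wpM2l// exprn_ge0.
  by rewrite /eta /C; lra.
have etaE : eta * E <= e.
  have : C * `|k - k0| <= (C + 1) * (e / (E * (C + 1))).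
    by rewrite ler_pM//; lra.
  have -> : (C + 1) * (e / (E * (C + 1))) = e / E.
    by field; rewrite !gt_eqF//; lra.
  by move=> h; rewrite -ler_pdivlMr//; exact: le_trans h.
have le2 : eta ^+ 2 * E <= e ^+ 2.
  have -> : eta ^+ 2 * E = eta * (eta * E) by ring.
  rewrite expr2 ler_pM// ?mulr_ge0// ?(ltW E0)//.
  by apply: le_trans etaE; rewrite ler_peMr.
have sq z : z ^+ 2 <= e ^+ 2 -> `|z| <= e.
  by rewrite -[z ^+ 2]real_normK ?num_real// ler_pXn2r ?nnegrE// ltW.
by split; apply: sq; apply: le_trans le2; apply: le_trans le1;
  rewrite ?lerDl ?lerDr sqr_ge0.
Qed.

Lemma unif_cont_profile : unif_cont profile.
Proof.
split; first by exists 1 => x; case: (profile_osc k01).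
by move=> e /profile_near; apply: filterS => k h x; case: (h x).
Qed.

Lemma unif_cont_profile1 : unif_cont profile1.
Proof.
split.
  have [_ d _ _ _] := profile_osc k01.
  have [M MP] := periodic_continuous_bdd (@T_gt0 R) (profile1_periodic k01)
    (has_deriv_continuous d).
  by exists M => x; exact: MP.
by move=> e /profile_near; apply: filterS => k h x; case: (h x).
Qed.

Lemma unif_cont_osc_jet j : unif_cont (fun k =>
  osc_jet (Omega k ^+ 2) k (profile k) (profile1 k) j).
Proof.
have uh := unif_cont_profile; have uh1 := unif_cont_profile1.
have ul := unif_contN (unif_contX 2 unif_cont_Omega); have uk := unif_cont_id.
have uv : unif_cont (fun k x => (1 - 2 * k * (1 - profile k x ^+ 2))^-1).
  have u2k := unif_contZ 2 uk.
  apply: (unif_contV (c := 1 - 2 * K)) (unif_contB (unif_contC 1) (unif_contM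
    u2k (unif_contB (unif_contC 1) (unif_contX 2 uh)))).
  - by have := K1; lra.
  - apply: filterS near_K => k [/andP[kge0 kK] _] x.
    have k1 : 0 <= k < 1 / 2 by rewrite kge0 (le_lt_trans kK).
    have [_ _ _ _ /(_ x) h] := profile_osc k1.
    by have := osc_denom_ge kge0 h; lra.
  - move=> x; have [_ _ _ _ /(_ x) h] := profile_osc k01.
    have [k00 k00K] := andP k0K; by have := osc_denom_ge k00 h; lra.
have uh2 := unif_contM (unif_contM ul uh) (unif_contX 3 uv).
case: j => [|[|[|[|[|j]]]]] /=.
- exact: uh.
- exact: uh1.
- exact: uh2.
- apply: unif_contM ul (unif_contB (unif_contM uh1 (unif_contX 3 uv)) _).
  exact: unif_contM (unif_contM (unif_contM (unif_contZ 12 uk) (unif_contX 2 uh)) uh1)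
    (unif_contX 4 uv).
- apply: unif_contM ul (unif_contD (unif_contB (unif_contB
    (unif_contM uh2 (unif_contX 3 uv)) _) _) _).
  + exact: unif_contM (unif_contM (unif_contM (unif_contZ 36 uk) uh)
      (unif_contX 2 uh1)) (unif_contX 4 uv).
  + exact: unif_contM (unif_contM (unif_contM (unif_contZ 12 uk) (unif_contX 2 uh))
      uh2) (unif_contX 4 uv).
  + exact: unif_contM (unif_contM (unif_contM (unif_contZ 192 (unif_contX 2 uk))
      (unif_contX 3 uh)) (unif_contX 2 uh1)) (unif_contX 5 uv).
- exact: unif_contC.
Qed.

End continuity.

End profiles.

(** * The global branch *)

Section branches.
Variables (R : realType) (a w : R).
Hypotheses (a01 : 0 < a < 1) (w0 : 0 < w).
Variable l : nat.
Hypothesis l0 : (0 < l)%N.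
Implicit Types (k x y : R).

Local Notation V := (R * C30e a)%type.

(* Junk value [0] outside of [C30e_fun a]. *)
Definition toC30e (g : R -> R) : C30e a := insubd 0 g.

Lemma toC30eK g : g \in C30e_fun a -> C30e_val (toC30e g) = g.
Proof. by move=> ga; rewrite /toC30e; exact: insubdK. Qed.

Lemma C30e_valB (f g : C30e a) u v : C30e_val f = u -> C30e_val g = v ->
  C30e_val (f - g) = (fun x => u x - v x).
Proof. by move=> <- <-. Qed.

(** The nonnegative solution m of k = lam m^2 / 4 when sqrt lam = l Omega(k). *)
Definition ampl k : R := 2 * Num.sqrt k / (l%:R * Omega k).

Definition branch_fun k : R -> R := fun x => ampl k * profile k (l%:R * x).

Definition branch k : V := (w / (l%:R * Omega k) ^+ 2, toC30e (branch_fun k)).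

Let lR : 0 < l%:R :> R. Proof. by rewrite ltr0n. Qed.

Let lO k : 0 <= k < 1 / 2 -> 0 < l%:R * Omega k.
Proof. by move=> k01; rewrite mulr_gt0// Omega_gt0. Qed.

Lemma ampl0 : ampl 0 = 0.
Proof. by rewrite /ampl sqrtr0 mulr0 mul0r. Qed.

Lemma ampl_ge0 k : 0 <= k < 1 / 2 -> 0 <= ampl k.
Proof. by move=> k01; rewrite divr_ge0 ?(ltW (lO k01))// mulr_ge0 ?sqrtr_ge0. Qed.

(** The numerator contains sqrt k, which increases, and the denominator Omega(k), which does not. *)
Lemma ampl_lt k k' : 0 <= k -> k < k' -> k' < 1 / 2 -> ampl k < ampl k'.
Proof.
move=> k0 kk' k1.
have k01 : 0 <= k < 1 / 2 by rewrite k0 (lt_trans kk').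
have k01' : 0 <= k' < 1 / 2 by rewrite k1 (le_trans k0)// ltW.
have kkI : 0 <= k <= k' by rewrite k0 ltW.
have /andP[h _] := Omega_diff kkI k1.
rewrite /ampl ltr_pdivrMr ?lO// mulrAC ltr_pdivlMr ?lO//.
rewrite -2!mulrA ltr_pM2l//.
rewrite (@lt_le_trans _ _ (Num.sqrt k' * (l%:R * Omega k')))//.
  by rewrite ltr_pM2r ?lO// ltr_sqrt// (le_lt_trans k0).
rewrite ler_wpM2l ?sqrtr_ge0// ler_wpM2l ?ler0n//; lra.
Qed.

Lemma ampl_inj k k' : 0 <= k < 1 / 2 -> 0 <= k' < 1 / 2 -> ampl k = ampl k' -> k = k'.
Proof.
move=> /andP[k0 k1] /andP[k0' k1'] E; have [kk|kk|//] := ltgtP k k'.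
  by have := ampl_lt k0 kk k1'; rewrite E ltxx.
by have := ampl_lt k0' kk k1; rewrite E ltxx.
Qed.

Lemma branch_osc k : 0 <= k < 1 / 2 -> osc ((l%:R * Omega k) ^+ 2) k
  (fun x => profile k (l%:R * x)) (fun x => l%:R * profile1 k (l%:R * x)).
Proof. by move=> k01; rewrite exprMn; exact: (osc_scale l%:R (profile_osc k01)). Qed.

Lemma branch_ampl k : 0 <= k < 1 / 2 -> (l%:R * Omega k) ^+ 2 * ampl k ^+ 2 = 4 * k.
Proof.
move=> k01; have h := lO k01; have k0 : 0 <= k by case/andP: k01.
rewrite -exprMn /ampl mulrCA mulfV ?gt_eqF// mulr1 exprMn sqr_sqrtr//.
by ring.
Qed.

Let profile_jets k : 0 <= k < 1 / 2 ->
  jets 4 (osc_jet (Omega k ^+ 2) k (profile k) (profile1 k)).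
Proof. by move=> k01; exact: (osc_jets k01 (profile_osc k01)). Qed.

(* Uniform continuity at [k] itself supplies the bounds. *)
Lemma osc_jet_bounded k : 0 <= k < 1 / 2 -> exists M, forall j x, (j <= 4)%N ->
  `|osc_jet (Omega k ^+ 2) k (profile k) (profile1 k) j x| <= M.
Proof.
move=> k01; have b j := (unif_cont_osc_jet k01 j).1.
have /choice[M MP] := b.
exists (\sum_(j < 5) `|M j|) => j x j4.
rewrite (le_trans (MP j x))// (le_trans (ler_norm _))//.
by rewrite (bigD1 (Ordinal (j4 : (j < 5)%N)))//= lerDl sumr_ge0.
Qed.

Lemma branch_fun_C30e k : 0 <= k < 1 / 2 -> branch_fun k \in C30e_fun a.
Proof.
move=> k01; have [M MP] := osc_jet_bounded k01.
pose d j x := ampl k * osc_jet (Omega k ^+ 2) k (profile k) (profile1 k) j x.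
have dj : jets 4 d.
  by move=> j j4 x; exact: (derivZ (ampl k) (profile_jets k01 j4 x)).
have dM j x : (j <= 4)%N -> `|d j x| <= ampl k * M.
  by move=> j4; rewrite normrM ger0_norm ?ampl_ge0// ler_wpM2l ?ampl_ge0// MP.
have hw : half_wave (d 0%N).
  have [he hp] := profile_half_wave k01.
  by split => x; rewrite /d /= ?he ?hp ?mulrN.
by have [] := half_wave_C30e a01 dj dM hw l0.
Qed.

Lemma branch_val k : 0 <= k < 1 / 2 -> C30e_val (branch k).2 = branch_fun k.
Proof. by move=> k01; exact: toC30eK (branch_fun_C30e k01). Qed.

Lemma branch_C_norm k : 0 <= k < 1 / 2 -> C_norm (branch k).2 = ampl k.
Proof.
move=> k01; rewrite branch_val//; have [_ _ h0 _ hle] := profile_osc k01.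
have b x : setT x -> `|branch_fun k x| <= ampl k.
  by move=> _; rewrite normrM ger0_norm ?ampl_ge0// ler_piMr ?ampl_ge0.
apply/eqP; rewrite eq_le; apply/andP; split.
  by apply: sup_on_le; [exists 0|exact: b].
have bb : bdd_on setT (branch_fun k) by exists (ampl k).
have := sup_on_ub bb (I : setT (0 : R)).
by rewrite /branch_fun mulr0 h0 mulr1 ger0_norm ?ampl_ge0.
Qed.

Lemma branch_admissible k : 0 <= k < 1 / 2 -> ampl k < 1 -> @admissible R a (branch k).
Proof.
move=> k01 k1; split => /=; last by rewrite /Uset/= branch_C_norm.
by rewrite in_itv/= andbT divr_gt0// exprn_gt0// lO.
Qed.

Lemma branch_nontrivial k : 0 < k < 1 / 2 -> ampl k < 1 ->
  @nontrivial_solution R a w (branch k).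
Proof.
move=> /andP[k0 k1] Ak; have k01 : 0 <= k < 1 / 2 by rewrite ltW.
split; first exact: branch_admissible.
- apply/eqP => E; have := branch_C_norm k01; rewrite E => A0.
  have := ampl_lt (lexx 0) k0 k1; rewrite ampl0 -A0.
  rewrite (_ : C_norm _ = 0) ?ltxx//.
  apply/eqP; rewrite eq_le; apply/andP; split.
    by apply: sup_on_le; [exists 0|move=> x _; rewrite normr0].
  by apply: C_norm_ge0; exists 0 => x _; rewrite normr0.
- rewrite branch_val//; apply: (osc_Upsilon (w := w) k01 (branch_ampl k01) _
    (branch_osc k01)).
  by rewrite /= divfK// expf_neq0// gt_eqF// lO.
Qed.

Lemma unif_cont_ampl k0 : 0 <= k0 < 1 / 2 -> unif_cont k0 (fun k _ => ampl k).
Proof.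
move=> k01; have := unif_contM (unif_contZ 2 (unif_cont_sqrt k0))
  (unif_contZ l%:R^-1 (unif_cont_OmegaV k01)).
congr unif_cont; apply/funext => k; apply/funext => x.
by rewrite /ampl /= [X in _ = _ * X]invfM.
Qed.

(** The difference of two members is again a half wave in l x, so C^4 closeness suffices; the
    tolerance e / (6 l^4) undoes the constant of [half_wave_C30e]. *)
Lemma branch_cvg k0 : 0 <= k0 < 1 / 2 ->
  branch k @[k --> within [set k : R | 0 <= k < 1 / 2] (nbhs k0)] --> branch k0.
Proof.
move=> k01; apply/cvgrPdist_le => e e0.
have u1 : unif_cont k0 (fun k _ => w / (l%:R * Omega k) ^+ 2).
  have := unif_contZ (w / l%:R ^+ 2) (unif_contX 2 (unif_cont_OmegaV k01)).
  congr unif_cont; apply/funext => k; apply/funext => x.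
  rewrite /= exprMn [X in _ = _ * X]invfM.
  by rewrite exprVn mulrA.
have e1 : 0 < e / (6 * l%:R ^+ 4) by rewrite divr_gt0// mulr_gt0// exprn_gt0.
have u2 j := (unif_contM (unif_cont_ampl k01) (unif_cont_osc_jet k01 j)).2 _ e1.
have u2' : \forall k \near within [set k : R | 0 <= k < 1 / 2] (nbhs k0),
  forall j x, (j <= 4)%N -> `|ampl k * osc_jet (Omega k ^+ 2) k (profile k) (profile1 k) j x
     - ampl k0 * osc_jet (Omega k0 ^+ 2) k0 (profile k0) (profile1 k0) j x| <=
    e / (6 * l%:R ^+ 4).
  apply: filterS2 (filterI (filterI (u2 0%N) (u2 1%N)) (filterI (u2 2%N) (u2 3%N)))
    (u2 4%N) => k [[h0 h1] [h2 h3]] h4 [|[|[|[|[|//]]]]] x _;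
    [exact: h0|exact: h1|exact: h2|exact: h3|exact: h4].
have u3 : \forall k \near within [set k : R | 0 <= k < 1 / 2] (nbhs k0),
   0 <= k < 1 / 2 by exact: withinT.
apply: filterS3 (u1.2 _ e0) u2' u3 => k h1 h2 kI.
rewrite prod_normE ge_max; apply/andP; split; first by rewrite distrC /= (h1 0).
rewrite distrC.
pose d j x := ampl k * osc_jet (Omega k ^+ 2) k (profile k) (profile1 k) j x +
  -1 * (ampl k0 * osc_jet (Omega k0 ^+ 2) k0 (profile k0) (profile1 k0) j x).
have dj : jets 4 d.
  move=> j j4 x; exact: (derivD (derivZ (ampl k) (profile_jets kI j4 x))
    (derivZ (-1) (derivZ (ampl k0) (profile_jets k01 j4 x)))).
have dM j x : (j <= 4)%N -> `|d j x| <= e / (6 * l%:R ^+ 4).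
  by move=> j4; rewrite /d mulN1r; exact: h2.
have hw : half_wave (d 0%N).
  have [he hp] := profile_half_wave k01; have [he' hp'] := profile_half_wave kI.
  by split => x; rewrite /d /= ?he ?hp ?he' ?hp'//; ring.
have [_ N] := half_wave_C30e a01 dj dM hw l0.
rewrite C30e_normE.
have -> : C30e_val ((branch k).2 - (branch k0).2) = (fun x => d 0%N (l%:R * x)).
  rewrite (C30e_valB (branch_val kI) (branch_val k01)).
  by apply/funext => x; rewrite /d /branch_fun mulN1r.
apply: (le_trans N); rewrite mulrC divfK//.
by rewrite gt_eqF// mulr_gt0// exprn_gt0.
Qed.

Lemma Omega0 : Omega (0 : R) = 1.
Proof.
have k01 : 0 <= (0 : R) < 1 / 2 by lra.
have := Omega_bounds k01; rewrite mulr0 subr0 => h.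
by apply/eqP; rewrite eq_le andbC.
Qed.

Lemma branch0 : branch 0 = (w * l%:R ^- 2, 0).
Proof.
rewrite /branch Omega0 mulr1; congr (_, _).
apply/val_inj/funext => x /=.
have k01 : 0 <= (0 : R) < 1 / 2 by lra.
by rewrite -/(C30e_val (branch 0).2) branch_val// /branch_fun ampl0 mul0r.
Qed.

Lemma closure_lt_image (B : set V) k0 : 0 < k0 < 1 / 2 ->
  (forall k, 0 < k < k0 -> B (branch k)) -> closure B (branch k0).
Proof.
move=> /andP[k00 k01] BP N /nbhs_ballP[e /= e0 eN].
have kI : 0 <= k0 < 1 / 2 by rewrite ltW.
have /cvgrPdist_lt/(_ _ e0) := branch_cvg kI.
rewrite near_withinE => /nbhs_ballP[d /= d0 dP].
pose k := k0 - Num.min d k0 / 2.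
have m0 : 0 < Num.min d k0 by rewrite lt_min d0.
have m1 : Num.min d k0 <= d by rewrite ge_min lexx.
have m2 : Num.min d k0 <= k0 by rewrite ge_min lexx orbT.
exists (branch k); split; first by apply: BP; rewrite /k; lra.
apply: eN; rewrite -ball_normE/=; apply: dP; last by rewrite /k/=; lra.
by rewrite /ball/= /k opprB addrC subrK ger0_norm; lra.
Qed.

Lemma branch0_closure (B : set V) e : 0 < e ->
  (forall k, 0 < k < e -> B (branch k)) -> closure B (branch 0).
Proof.
move=> e0 BP N /nbhs_ballP[e' /= e0' eN].
have kI : 0 <= (0 : R) < 1 / 2 by lra.
have /cvgrPdist_lt/(_ _ e0') := branch_cvg kI.
rewrite near_withinE => /nbhs_ballP[d /= d0 dP].
pose m := Num.min d (Num.min e (1 / 2)).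
have m0 : 0 < m by rewrite !lt_min d0 e0/=; lra.
have m1 : m <= d by rewrite ge_min lexx.
have m2 : m <= e by rewrite !ge_min lexx !orbT.
have m3 : m <= 1 / 2 by rewrite !ge_min lexx !orbT.
exists (branch (m / 2)); split; first by apply: BP; lra.
apply: eN; rewrite -ball_normE/=; apply: dP; last by rewrite /=; lra.
by rewrite /ball/= sub0r normrN ger0_norm; lra.
Qed.

Lemma ampl_small : exists2 e : R, 0 < e & forall k, 0 < k < e -> k < 1 / 2 /\ ampl k < 1.
Proof.
have kI : 0 <= (0 : R) < 1 / 2 by lra.
have := (unif_cont_ampl kI).2 (1 / 2) ltac:(lra).
rewrite near_withinE => /nbhs_ballP[d /= d0 dP].
exists (Num.min d (1 / 2)); first by rewrite lt_min d0/=; lra.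
move=> k; rewrite lt_min => /andP[k0 /andP[kd k1]]; split => //.
have kI' : 0 <= k < 1 / 2 by rewrite ltW.
have := dP k; rewrite /ball/= sub0r normrN (gtr0_norm k0) => /(_ kd kI' 0).
by rewrite ampl0 subr0 => h; have := le_trans (ler_norm _) h; lra.
Qed.

Lemma branch0_sol : @solution_closure R a w (branch 0).
Proof.
have kI : 0 <= (0 : R) < 1 / 2 by lra.
split; last by apply: branch_admissible => //; rewrite ampl0.
have [e e0 eP] := ampl_small; apply: (branch0_closure e0) => k kk.
have [k1 k2] := eP _ kk; apply: branch_nontrivial => //.
by case/andP: kk => -> _.
Qed.

Lemma branch_sol k : 0 <= k < 1 / 2 -> ampl k < 1 -> @solution_closure R a w (branch k).
Proof.
move=> k01 Ak; have [k0|k0|<-] := ltgtP 0 k; last exact: branch0_sol.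
- split; last exact: branch_admissible.
  by apply: subset_closure; apply: branch_nontrivial => //; case/andP: k01 => _ ->; rewrite k0.
- by case/andP: k01; lra.
Qed.

Let D := [set k : R | 0 <= k < 1 / 2 /\ ampl k < 1].

(** Monotonicity of [ampl] makes [D] an interval, so its image is a connected set of solutions
    through the bifurcation point. *)
Lemma branch_component k : D k ->
  connected_component (@solution_closure R a w) (branch 0) (branch k).
Proof.
move=> Dk; have D0 : D 0 by split; [lra|rewrite ampl0].
apply: (@connected_component_max _ _ (branch @` D)); last by exists k.
- by exists 0.
- by move=> _ [x [x1 x2] <-]; exact: branch_sol.
- apply: connected_continuous_connected.
    apply/connected_intervalP => x y [x1 x2] [y1 y2] z /andP[xz zy].
    have zI : 0 <= z < 1 / 2 by case/andP: x1; case/andP: y1; lra.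
    split => //; move: zy; rewrite le_eqVlt => /predU1P[->//|zy].
    rewrite (lt_trans (ampl_lt _ zy _))//; first by case/andP: zI.
    by case/andP: y1.
  apply/subspace_continuousP => x Dx; have [x1 _] := Dx.
  by apply: cvg_trans (branch_cvg x1); apply: cvg_app; apply: within_subset => y [].
Qed.

(** At the quarter period x = pi / (2 l) the profile vanishes, and there the first integral gives 1
    + f'^2 = (1 - 2 k)^-2. *)
Lemma branch_derive_norm k : 0 <= k < 1 / 2 ->
  (1 - 2 * k) ^- 2 <= 1 + `|branch k| ^+ 2.
Proof.
move=> k01; have xl : l%:R * (pi / 2 / l%:R) = pi / 2 :> R.
  by rewrite mulrC divfK// gt_eqF.
have := osc_first_integral k01 (branch_ampl k01) (branch_osc k01) (pi / 2 / l%:R).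
rewrite xl profile_half_pi// expr0n/= subr0 mulr1 => <-.
rewrite lerD2l -real_normK ?num_real//.
rewrite ler_pXn2r ?nnegrE// prod_normE le_max; apply/orP; right.
have h := @C30e_derive_le _ _ (branch k).2 1 (pi / 2 / l%:R) isT.
apply: le_trans h; rewrite -[(_^`(1))%classic]/((C30e_val (branch k).2)^`()%classic).
rewrite branch_val//.
have [d _ _ _ _] := branch_osc k01.
have dd : has_deriv (branch_fun k) (fun x => ampl k * (l%:R * profile1 k (l%:R * x))).
  by move=> x; exact: (derivZ (ampl k) (d x)).
by rewrite (has_derivE dd) xl.
Qed.

Lemma branch_unbounded : unbounded_in (@admissible R a)
  (connected_component (@solution_closure R a w) (branch 0)).
Proof.
have [Dall|] := pselect (forall k, 0 <= k < 1 / 2 -> ampl k < 1).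
  left => /ex_strict_bound_gt0[M M0 MP].
  (* Chosen so that 1 - 2 k = 1 / (M + 1): a bound M on the component would give (M + 1)^2 <= 1 +
     M^2. *)
  pose k := (1 - (M + 1)^-1) / 2.
  have M1 : 0 < (M + 1)^-1 by rewrite invr_gt0; lra.
  have M2 : (M + 1)^-1 <= 1 by rewrite invf_le1; lra.
  have k01 : 0 <= k < 1 / 2 by rewrite /k; lra.
  have Ck := branch_component (conj k01 (Dall _ k01)).
  have := branch_derive_norm k01.
  have -> : 1 - 2 * k = (M + 1)^-1 by rewrite /k; field; lra.
  have /= := MP _ Ck; rewrite exprVn invrK => h.
  have : `|branch k| ^+ 2 <= M ^+ 2.
    by rewrite ler_pXn2r ?nnegrE ?normr_ge0 ?(ltW M0) ?(ltW h).
  lra.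
move=> /existsNP[k1 /not_implyP[k1I /negP]]; rewrite -leNgt => A1; right.
have [k10 k11] := andP k1I.
(* At this modulus the sup norm is exactly 1; approached from smaller k, the point lies in the
   closures of the component and of [admissible], but not in [admissible]. *)
have [ks ksI Aks] : exists2 ks, 0 <= ks <= k1 & ampl ks = 1.
  have c : {within `[0, k1], continuous ampl}.
    apply/subspace_continuousP => x; rewrite /= in_itv/= => /andP[x0 xk].
    have xI : 0 <= x < 1 / 2 by rewrite x0 (le_lt_trans xk).
    apply/cvgrPdist_le => e e0; have := (unif_cont_ampl xI).2 _ e0.
    rewrite !near_withinE; apply: filterS => y yP; rewrite /= in_itv/= => /andP[y0 yk].
    by rewrite distrC; apply: yP => //; rewrite /= y0 (le_lt_trans yk).
  have [|x xI xE] := IVT k10 c (v := 1); last first.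
    by exists x => //; move: xI; rewrite in_itv/=.
  by rewrite ampl0 ge_min ler01/= le_max A1 orbT.
have [ks0 ks1] := andP ksI.
have ksI' : 0 <= ks < 1 / 2 by rewrite ks0 (le_lt_trans ks1).
have ksp : 0 < ks.
  rewrite lt_neqAle ks0 andbT; apply/eqP => E.
  by move: Aks; rewrite -E ampl0 => /esym/eqP; rewrite oner_eq0.
have ksI2 : 0 < ks < 1 / 2 by rewrite ksp; case/andP: ksI'.
have sm k : 0 < k < ks -> D k.
  move=> /andP[k0 kks]; have ksh : ks < 1 / 2 by case/andP: ksI'.
  by split; [rewrite ltW// (lt_trans kks)|rewrite -Aks; apply: ampl_lt => //; rewrite ltW].
exists (branch ks); split.
  by apply: closure_lt_image => // k /sm; exact: branch_component.
split.
  by apply: closure_lt_image => // k /sm[h1 h2]; exact: branch_admissible.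
move=> /interior_subset[_]; rewrite /Uset/= branch_C_norm// Aks.
by rewrite ltxx.
Qed.

End branches.

(** * Modes and bifurcation points *)

Section modes.
Variables (R : realType) (a w : R).
Hypothesis w0 : 0 < w.
Local Notation V := (R * C30e a)%type.
Implicit Types (p : V) (n : nat).

Definition modulus p : R := w / p.1 * C30e_val p.2 0 ^+ 2 / 4.

Definition has_mode p n := [/\ (1 <= n)%N, 0 < p.1, 0 < modulus p < 1 / 2,
  Num.sqrt (w / p.1) = n%:R * Omega (modulus p) &
  C30e_val p.2 = (fun x => C30e_val p.2 0 * profile (modulus p) (n%:R * x))].

Lemma nontrivial_mode p : @nontrivial_solution R a w p -> exists n, has_mode p n.
Proof.
case: p => gam f [[/= g0 _] f0 Uf]; rewrite in_itv/= andbT in g0.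
have [n n1 [sE fE]] := steady_mode w0 g0 Uf f0.
exists n; split => //=; first exact: steady_modulus w0 g0 Uf f0.
by apply/funext => x; rewrite fE sE /profile; congr (_ * cos_amp _ _); ring.
Qed.

Lemma has_mode_ampl p n : has_mode p n -> `|C30e_val p.2 0| = ampl n (modulus p).
Proof.
move=> [n1 g0 /andP[k0 k1] sE _]; have lam0 : 0 < w / p.1 by rewrite divr_gt0.
rewrite /ampl -sE; have s0 : 0 < Num.sqrt (w / p.1) by rewrite sqrtr_gt0.
apply: (mulIf (lt0r_neq0 s0)); rewrite divfK ?gt_eqF//.
rewrite -sqrtr_sqr -sqrtrM ?sqr_ge0//.
have -> : 2 = Num.sqrt (2 ^+ 2) :> R by rewrite sqrtr_sqr ger0_norm.
by rewrite -sqrtrM ?sqr_ge0//; congr Num.sqrt; rewrite /modulus; field; rewrite gt_eqF.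
Qed.

(** |f(0)| determines the modulus by [ampl_inj], the modulus determines gamma through sqrt (w /
    gamma) = n Omega, and f(0) with its sign then determines f. *)
Lemma has_mode_inj p q n : has_mode p n -> has_mode q n ->
  C30e_val p.2 0 = C30e_val q.2 0 -> p = q.
Proof.
move=> pn qn E; have := has_mode_ampl pn; rewrite E (has_mode_ampl qn).
move: pn qn; case: p q E => [g f] [g' f'] /= E [n1 g0 k1 sE fE] [_ g0' k1' sE' fE'].
have n0 : 0 < n%:R :> R by rewrite ltr0n.
have I (k : R) : 0 < k < 1 / 2 -> 0 <= k < 1 / 2 by move=> /andP[/ltW -> ->].
move=> /(ampl_inj n1 (I _ k1') (I _ k1)) kE.
have gE : g = g'.
  have : Num.sqrt (w / g) = Num.sqrt (w / g') by rewrite sE sE' kE.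
  move=> /eqP; rewrite eqr_sqrt ?divr_ge0 ?ltW// => /eqP/(mulfI (lt0r_neq0 w0)).
  exact: invr_inj.
congr (_, _) => //; apply: val_inj => /=.
by rewrite [LHS]fE [RHS]fE' E kE.
Qed.

Lemma eval_deriv_cvg p j x : (j <= 3)%N ->
  ((C30e_val q.2)^`(j))%classic x @[q --> p] --> ((C30e_val p.2)^`(j))%classic x.
Proof.
move=> j3; apply/cvgrPdist_lt => e e0.
have H : nbhs (p : V) [set q : V | `|((C30e_val p.2)^`(j))%classic x -
    ((C30e_val q.2)^`(j))%classic x| < e].
  apply/nbhs_ballP; exists e => // q.
  rewrite -ball_normE /ball_/= prod_normE gt_max => /andP[_ h].
  exact: le_lt_trans (C30e_deriveB_le p.2 q.2 x j3) h.
exact: H.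
Qed.

Lemma fst_cvg p : q.1 @[q --> p] --> p.1.
Proof. exact: cvg_fst. Qed.

Lemma curvature_expr_cvg T (F : set_system T) (FF : Filter F)
    (g f1 f2 f3 : T -> R) (g' f1' f2' f3' : R) :
  g @ F --> g' -> f1 @ F --> f1' -> f2 @ F --> f2' -> f3 @ F --> f3' ->
  g x * (f3 x / Num.sqrt (1 + f1 x ^+ 2) ^+ 3) - 3 * g x *
    (f1 x * f2 x ^+ 2 / Num.sqrt (1 + f1 x ^+ 2) ^+ 5) + w * f1 x @[x --> F] -->
  g' * (f3' / Num.sqrt (1 + f1' ^+ 2) ^+ 3) - 3 * g' *
    (f1' * f2' ^+ 2 / Num.sqrt (1 + f1' ^+ 2) ^+ 5) + w * f1'.
Proof.
move=> cg c1 c2 c3.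
have s : Num.sqrt (1 + f1 x ^+ 2) @[x --> F] --> Num.sqrt (1 + f1' ^+ 2).
  have c : 1 + f1 x ^+ 2 @[x --> F] --> 1 + f1' ^+ 2.
    apply: cvgD; first exact: cvg_cst.
    exact: (cvg_comp _ _ c1 (@exprn_continuous R 2 _)).
  exact: (cvg_comp _ _ c (@sqrt_continuous R _)).
have s0 : 0 < Num.sqrt (1 + f1' ^+ 2) by rewrite sqrtr_gt0 ltr_pwDl// sqr_ge0.
have sV j : (Num.sqrt (1 + f1 x ^+ 2) ^+ j)^-1 @[x --> F] -->
    (Num.sqrt (1 + f1' ^+ 2) ^+ j)^-1.
  apply: cvgV; first by rewrite expf_neq0// gt_eqF.
  exact: (cvg_comp _ _ s (@exprn_continuous R j _)).
apply: cvgD; last by apply: cvgM => //; exact: cvg_cst.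
apply: cvgB; first by apply: cvgM => //; apply: cvgM => //; exact: sV.
apply: cvgM; first by apply: cvgM => //; exact: cvg_cst.
apply: cvgM; last exact: sV.
apply: cvgM => //.
exact: (cvg_comp _ _ c2 (@exprn_continuous R 2 _)).
Qed.

Lemma Upsilon_cvg p x : 
  Upsilon w q.1 (C30e_val q.2) x @[q --> p] --> Upsilon w p.1 (C30e_val p.2) x.
Proof.
have u j (j3 : (j <= 3)%N) := @eval_deriv_cvg p j x j3.
have sE q : 1 + ((C30e_val q.2)^`(1))%classic x ^+ 2 =
    Num.sqrt (1 + ((C30e_val q.2)^`(1))%classic x ^+ 2) ^+ 2 :> R.
  by rewrite sqr_sqrtr// addr_ge0// sqr_ge0.
have s0 q : 0 < Num.sqrt (1 + ((C30e_val q.2)^`(1))%classic x ^+ 2) :> R.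
  by rewrite sqrtr_gt0 ltr_pwDl// sqr_ge0.
have E q : Upsilon w q.1 (C30e_val q.2) x =
   q.1 * (((C30e_val q.2)^`(3))%classic x /
     Num.sqrt (1 + ((C30e_val q.2)^`(1))%classic x ^+ 2) ^+ 3)
   - 3 * q.1 * (((C30e_val q.2)^`(1))%classic x * ((C30e_val q.2)^`(2))%classic x ^+ 2
     / Num.sqrt (1 + ((C30e_val q.2)^`(1))%classic x ^+ 2) ^+ 5)
   + w * ((C30e_val q.2)^`(1))%classic x.
  rewrite /Upsilon -[_^`()]/((C30e_val q.2)^`(1))%classic.
  by rewrite [X in X `^ (3 / 2)]sE [X in X `^ (5 / 2)]sE !powR_sqr_half.
under eq_fun do rewrite E.
rewrite E; exact: curvature_expr_cvg (fst_cvg (p := p)) (u 1%N isT) (u 2%N isT) (u 3%N isT).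
Qed.

(** Convergence in norm controls three derivatives at every point, so the equation passes to limits
    pointwise. *)
Lemma closure_Upsilon p : closure (@nontrivial_solution R a w) p ->
  Upsilon w p.1 (C30e_val p.2) = cst 0.
Proof.
move=> cp; apply/funext => x; apply/eqP/negPn/negP => U0.
have n0 : 0 < `|Upsilon w p.1 (C30e_val p.2) x| by rewrite normr_gt0.
have /cvgrPdist_lt/(_ _ n0) := @Upsilon_cvg p x.
move=> /cp[q [[_ _ Uq]]] /=; rewrite Uq subr0.
by rewrite ltxx.
Qed.

(** Near (gam, 0) the modulus is near 0 and Omega near 1, so n = sqrt (w / p.1) / Omega is near sqrt
    (w / gam). *)
Lemma mode_near (gam d : R) : 0 < gam -> 0 < d ->
  \forall p \near (gam, 0 : C30e a), forall n, has_mode p n ->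
    `|n%:R - Num.sqrt (w / gam)| < d.
Proof.
move=> g0 d0; set s := Num.sqrt (w / gam).
have s0 : 0 <= s by exact: sqrtr_ge0.
have c1 : w / p.1 @[p --> (gam, 0 : C30e a)] --> w / gam.
  apply: cvgM; first exact: cvg_cst.
  by apply: cvgV; [rewrite gt_eqF|exact: (@fst_cvg (gam, 0))].
have c2 : Num.sqrt (w / p.1) @[p --> (gam, 0 : C30e a)] --> s.
  exact: (cvg_comp _ _ c1 (@sqrt_continuous R _)).
have c3 : modulus p @[p --> (gam, 0 : C30e a)] --> (0 : R).
  have -> : 0 = w / gam * (C30e_val (0 : C30e a) 0) ^+ 2 / 4 :> R.
    by rewrite /= expr0n/= mulr0 mul0r.
  apply: cvgM; last exact: cvg_cst.
  apply: cvgM => //.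
  exact: (cvg_comp _ _ (@eval_deriv_cvg (gam, 0) 0%N 0 isT) (@exprn_continuous R 2 _)).
have d2 : 0 < Num.min 1 (d / 2) by rewrite lt_min ltr01 divr_gt0.
(* The entry 1/4 gives Omega >= 1/2 and hence n <= 2 (s + 1); the second entry then gives n (1 -
   Omega) <= 2 n k < d / 2 for the modulus k. *)
pose e := Num.min (1 / 4) (d / (8 * (s + 1))).
have s8 : 0 < 8 * (s + 1) by lra.
have e0 : 0 < e by rewrite lt_min; apply/andP; split; [lra|exact: divr_gt0].
have /cvgrPdist_lt/(_ _ d2) H1 := c2.
have /cvgrPdist_lt/(_ _ e0) H2 := c3.
near=> p => n [n1 gp /andP[k0 k1] sE _].
have h1 : `|s - Num.sqrt (w / p.1)| < Num.min 1 (d / 2).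
  by near: p; exact: H1.
have h2 : `|0 - modulus p| < e by near: p; exact: H2.
move: h1 h2; rewrite sub0r normrN (gtr0_norm k0) !lt_min => /andP[h1 h1'] /andP[h2 h2'].
have kI : 0 <= modulus p < 1 / 2 by rewrite ltW.
have /andP[Om1 Om2] := Omega_bounds kI.
rewrite ltr_pdivlMr// in h2'.
move: h1 h1'; rewrite sE => h1 h1'.
have n0 : 0 <= n%:R :> R by [].
have nO : n%:R * (1 / 2) <= n%:R * Omega (modulus p) by rewrite ler_wpM2l//; lra.
have nO2 : n%:R * (1 - 2 * modulus p) <= n%:R * Omega (modulus p) by rewrite ler_wpM2l.
have nO3 : n%:R * Omega (modulus p) <= n%:R by rewrite ler_piMr.
have nk : n%:R * modulus p <= 2 * (s + 1) * modulus p.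
  rewrite ler_wpM2r ?(ltW k0)//.
  by move: h1; rewrite ltr_norml; lra.
by move: h1'; rewrite !ltr_norml; lra.
Unshelve. all: by end_near. Qed.

(** With d arbitrarily small, [mode_near] exhibits sqrt (w / gam) as a limit of integers; two
    integers within 1/4 of it coincide, so it is itself that integer. *)
Lemma closure_trivial (gam : R) : 0 < gam ->
  closure (@nontrivial_solution R a w) (gam, 0) ->
  exists2 n, (1 <= n)%N & gam = w * n%:R ^- 2.
Proof.
move=> g0 cl.
have ex d : 0 < d -> exists2 n, (1 <= n)%N & `|n%:R - Num.sqrt (w / gam)| < d.
  move=> d0; have [p [/nontrivial_mode[n pn] h]] := cl _ (mode_near g0 d0).
  by exists n; [case: pn|exact: h].
have [|n n1 nP] := ex (1 / 4); first by lra.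
exists n => //.
suff sE : n%:R = Num.sqrt (w / gam).
  have : n%:R ^+ 2 = w / gam by rewrite sE sqr_sqrtr// divr_ge0// ltW.
  move=> ->; rewrite invf_div mulrC divfK// gt_eqF//.
apply/eqP; rewrite -subr_eq0 -normr_le0; apply/ler_addgt0Pr => e e0.
have m0 : 0 < Num.min (1 / 4) e by rewrite lt_min e0 andbT; lra.
have [m m1 mP] := ex _ m0.
move: mP; rewrite lt_min => /andP[m4 me].
suff mn : m = n by rewrite add0r -mn ltW.
apply/eqP; rewrite eq_sym; have : `|n%:R - m%:R| < 1 :> R.
  by move: nP m4; rewrite !ltr_norml; lra.
have := ltr_nat R; rewrite ltr_norml => lt; have [nm|nm|//] := ltngtP n m.
  have : n.+1%:R <= m%:R :> R by rewrite ler_nat.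
  by rewrite -natr1; lra.
have : m.+1%:R <= n%:R :> R by rewrite ler_nat.
by rewrite -natr1; lra.
Qed.

Lemma bifurcation_closure gam : bifurcation_point a w gam ->
  closure (@nontrivial_solution R a w) (gam, 0).
Proof.
move=> [u [uS ucv]] N /ucv[n _ nN]; exists (u n); split; first exact: uS.
exact: (nN n (leqnn n)).
Qed.

Lemma sol_closure_cases p : @solution_closure R a w p ->
  @nontrivial_solution R a w p \/
  exists2 n, (1 <= n)%N & p = (w * n%:R ^- 2, 0).
Proof.
case: p => gam f [cl ad]; have [f0|f0] := eqVneq f 0.
  have g0 : 0 < gam by case: ad => /=; rewrite in_itv/= andbT.
  by right; move: cl; rewrite f0 => /(closure_trivial g0)[n n1 ->]; exists n.
by left; split => //; exact: (closure_Upsilon cl).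
Qed.

End modes.

(** * Symmetric C^2 functions and the resonant linear problem *)

Section smooth_symmetric.
Variable R : realType.
Implicit Types (f g phi : R -> R) (B e x : R).

(* [e = 1] or [e = -1] distinguishes pi-periodic from pi-antiperiodic functions. *)
Definition c2 e B f := exists f1 f2, [/\ has_deriv f f1, has_deriv f1 f2,
  forall x, [/\ `|f x| <= B, `|f1 x| <= B & `|f2 x| <= B],
  forall x, f (- x) = f x & forall x, f (x + pi) = e * f x].

Lemma c2_bound e B f x : c2 e B f -> `|f x| <= B.
Proof. by move=> [f1 [f2 [_ _ /(_ x)[]]]]. Qed.

Lemma c2_ge0 e B f : c2 e B f -> 0 <= B.
Proof. by move=> /(c2_bound 0); exact: le_trans. Qed.

Lemma c2_continuous e B f : c2 e B f -> continuous f.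
Proof. by move=> [f1 [f2 [d _ _ _ _]]]; exact: has_deriv_continuous d. Qed.

Lemma c2_le e B B' f : B <= B' -> c2 e B f -> c2 e B' f.
Proof.
move=> BB [f1 [f2 [d1 d2 b s1 s2]]]; exists f1, f2; split => // x.
by have [b0 b1 b2] := b x; split; apply: le_trans BB.
Qed.

Lemma c2_cst c e B : `|c| <= B -> c = e * c -> c2 e B (fun=> c).
Proof.
move=> cB ce; have B0 : 0 <= B by exact: le_trans cB.
exists (fun=> 0), (fun=> 0); split => //.
- by move=> x; exact: deriv_cst.
- by move=> x; exact: deriv_cst.
- by move=> x; rewrite normr0.
Qed.

Lemma c2_cos : c2 (-1) 1 cos.
Proof.
exists (fun x => - sin x), (fun x => - cos x); split.
- by move=> x; exact: is_derive_cos.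
- by move=> x; exact: (derivN (is_derive_sin x)).
- by move=> x; rewrite !normrN !ler_norml cos_geN1 cos_le1 sin_geN1 sin_le1.
- by move=> x; rewrite cosN.
- by move=> x; rewrite cosDpi mulN1r.
Qed.

Lemma c2D e B B' f g : c2 e B f -> c2 e B' g -> c2 e (B + B') (fun x => f x + g x).
Proof.
move=> [f1 [f2 [d1 d2 b s1 s2]]] [g1 [g2 [d1' d2' b' s1' s2']]].
exists (fun x => f1 x + g1 x), (fun x => f2 x + g2 x); split.
- by move=> x; exact: (derivD (d1 x) (d1' x)).
- by move=> x; exact: (derivD (d2 x) (d2' x)).
- move=> x; have [b0 b1 b2] := b x; have [b0' b1' b2'] := b' x.
  by split; rewrite (le_trans (ler_normD _ _))// lerD.
- by move=> x; rewrite s1 s1'.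
- by move=> x; rewrite s2 s2' mulrDr.
Qed.

Lemma c2Z c e B f : c2 e B f -> c2 e (`|c| * B) (fun x => c * f x).
Proof.
move=> [f1 [f2 [d1 d2 b s1 s2]]].
exists (fun x => c * f1 x), (fun x => c * f2 x); split.
- by move=> x; exact: (derivZ c (d1 x)).
- by move=> x; exact: (derivZ c (d2 x)).
- by move=> x; have [b0 b1 b2] := b x; split; rewrite normrM ler_wpM2l.
- by move=> x; rewrite s1.
- by move=> x; rewrite s2 mulrCA.
Qed.

Lemma c2M e e' B B' f g : c2 e B f -> c2 e' B' g ->
  c2 (e * e') (4 * (B * B')) (fun x => f x * g x).
Proof.
move=> cf cg; have B0 := c2_ge0 cf; have B0' := c2_ge0 cg; move: cf cg.
move=> [f1 [f2 [d1 d2 b s1 s2]]] [g1 [g2 [d1' d2' b' s1' s2']]].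
have BB : 0 <= B * B' by rewrite mulr_ge0.
exists (fun x => f1 x * g x + f x * g1 x),
  (fun x => f2 x * g x + f1 x * g1 x + (f1 x * g1 x + f x * g2 x)); split.
- by move=> x; exact: (derivM (d1 x) (d1' x)).
- by move=> x; exact: (derivD (derivM (d2 x) (d1' x)) (derivM (d1 x) (d2' x))).
- move=> x; have [b0 b1 b2] := b x; have [b0' b1' b2'] := b' x.
  have M u v : `|u| <= B -> `|v| <= B' -> `|u * v| <= B * B'.
    by move=> uB vB; rewrite normrM ler_pM.
  split.
  + by have := M _ _ b0 b0'; lra.
  + rewrite (le_trans (ler_normD _ _))//.
    by have := M _ _ b0 b1'; have := M _ _ b1 b0'; lra.
  + rewrite (le_trans (ler_normD _ _))//.
    have := ler_normD (f2 x * g x) (f1 x * g1 x).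
    have := ler_normD (f1 x * g1 x) (f x * g2 x).
    by have := M _ _ b2 b0'; have := M _ _ b1 b1'; have := M _ _ b0 b2'; lra.
- by move=> x; rewrite s1 s1'.
- by move=> x; rewrite s2 s2'; ring.
Qed.

Lemma c2_sum e n (B : nat -> R) (f : nat -> R -> R) :
  (forall i, (i < n)%N -> c2 e (B i) (f i)) ->
  c2 e (\sum_(i < n) B i) (fun x => \sum_(i < n) f i x).
Proof.
elim: n => [|n IH] H.
  rewrite (_ : (fun x => _) = fun=> 0); last by apply/funext => x; rewrite big_ord0.
  by rewrite big_ord0; apply: c2_cst; rewrite ?normr0// mulr0.
rewrite (_ : (fun x => _) = fun x => \sum_(i < n) f i x + f n x); last first.
  by apply/funext => x; rewrite big_ord_recr.
rewrite big_ord_recr/=; by apply: c2D; [apply: IH => i ni; apply: H; exact: ltnW|exact: H].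
Qed.

Definition prim f : R -> R := get [set F | F 0 = 0 /\ has_deriv F f].

Lemma primP f : continuous f -> prim f 0 = 0 /\ has_deriv (prim f) f.
Proof.
move=> cf; rewrite /prim; case: xgetP => // nF.
by have [F F0 dF] := antiderivative cf; case: (nF F).
Qed.

Lemma prim_unique f F : F 0 = 0 -> has_deriv F f -> prim f = F.
Proof.
move=> F0 dF; rewrite /prim; case: xgetP => [G _ [G0 dG]|/(_ F)[]//].
apply/funext => x; have d : has_deriv (fun y => G y - F y) (fun=> 0).
  by move=> y; apply: (is_derive1_eq (derivB (dG y) (dF y))); rewrite subrr.
by have := has_deriv_const x 0 d; rewrite G0 F0 subrr => /eqP; rewrite subr_eq0 => /eqP.
Qed.

(* [Kop phi] solves u'' + u = phi, u(0) = u'(0) = 0; for even pi-antiperiodic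
   [phi] it is pi-antiperiodic when [avg phi], the coefficient on [cos], vanishes. *)
Definition avg phi : R := 2 / pi * prim (fun x => phi x * cos x) pi.

Definition Kop phi x : R := sin x * prim (fun x => phi x * cos x) x
  - cos x * prim (fun x => phi x * sin x) x.

Lemma continuousM2 f g : continuous f -> continuous g -> continuous (fun x => f x * g x).
Proof. by move=> cf cg x; apply: cvgM; [exact: cf|exact: cg]. Qed.

(** The factor 2 / pi normalises the integral of cos^2 over [0, pi] to 1, so subtracting [avg phi]
    times cos removes the resonance exactly. *)
Lemma avgD_cos phi c : continuous phi ->
  avg (fun x => phi x + c * cos x) = avg phi + c.
Proof.
move=> cp; have [P0 dP] := primP (continuousM2 cp (@continuous_cos R)).
have pn : pi != 0 :> R by rewrite gt_eqF// pi_gt0.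
rewrite /avg (@prim_unique _ (fun x => prim (fun x => phi x * cos x) x +
  c * ((x + sin x * cos x) / 2))).
- by rewrite sinpi mul0r addr0; move: (pi : R) pn => p pn; field.
- by rewrite P0 sin0 mul0r addr0 mul0r mulr0 addr0.
- move=> x; have dsc := derivM (is_derive_sin x) (is_derive_cos x).
  apply: (is_derive1_eq (derivD (dP x) (derivZ c
    (derivM (derivD (deriv_id x) dsc) (deriv_cst 2^-1 x))))).
  have e : sin x * sin x = 1 - cos x * cos x :> R.
    by rewrite -!expr2 -(cos2Dsin2 x); ring.
  by rewrite mulrN e; field.
Qed.

Lemma prim_periodic f M : continuous f -> (forall x, f (x + pi) = f x) ->
  prim f pi = 0 -> (forall x, `|f x| <= M) ->
  (forall x, prim f (x + pi) = prim f x) /\ forall x, `|prim f x| <= M * pi.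
Proof.
move=> cf pf f0 fM; have [P0 dP] := primP cf.
have M0 : 0 <= M by exact: le_trans (fM 0).
have per x : prim f (x + pi) = prim f x.
  have d : has_deriv (fun y => prim f (y + pi) - prim f y) (fun=> 0).
    move=> y; apply: (is_derive1_eq (derivB (deriv_comp (g := fun z => z + pi)
      (dP (y + pi)) (derivD (deriv_id y) (deriv_cst pi y))) (dP y))).
    by rewrite addr0 mulr1 pf subrr.
  by have := has_deriv_const x 0 d; rewrite /= add0r f0 P0; lra.
split => // x; have [n /andP[y0 ypi]] := translate_itv x (pi_gt0 R).
rewrite -(periodic_int per n); have := has_deriv_lip dP fM (x + pi *~ n) 0.
rewrite P0 !subr0 (ger0_norm y0) => h; apply: (le_trans h).
by rewrite ler_wpM2l.
Qed.

Lemma avg_le phi M : continuous phi -> (forall x, `|phi x| <= M) -> `|avg phi| <= 2 * M.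
Proof.
move=> cp pM; have [P0 dP] := primP (continuousM2 cp (@continuous_cos R)).
have b x : `|phi x * cos x| <= M.
  rewrite normrM -[leRHS]mulr1 ler_pM// ler_norml.
  by rewrite cos_geN1 cos_le1.
have p0 := pi_gt0 R.
have := has_deriv_lip dP b pi 0; rewrite P0 !subr0 (gtr0_norm p0) => h.
rewrite /avg normrM ger0_norm ?divr_ge0 ?(ltW p0)//.
by rewrite mulrAC ler_pdivrMr//; have := ler_wpM2l (ler0n R 2) h; lra.
Qed.

(** Each primitive is at most pi B, so u = [Kop phi] and u' stay below 2 pi B; by u'' = phi - u the
    derivatives of order 2 to 4 add at most 2 B. Two derivatives of phi become four of u. *)
Lemma Kop_props phi B (K0 := 2 * pi + 2 : R) : c2 (-1) B phi -> avg phi = 0 ->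
  c2 (-1) (K0 * B) (Kop phi) /\ exists d : nat -> R -> R,
    [/\ d 0%N = Kop phi, jets 4 d, forall j x, (j <= 4)%N -> `|d j x| <= K0 * B
      & d 2 = (fun x => phi x - Kop phi x)].
Proof.
move=> cphi a0; have B0 := c2_ge0 cphi; have cc := c2_continuous cphi.
have [phi1 [phi2 [d1 d2 b s1 s2]]] := cphi.
have p0 := pi_gt0 R.
set A := prim (fun x => phi x * cos x); set S := prim (fun x => phi x * sin x).
have cA := continuousM2 cc (@continuous_cos R).
have cS := continuousM2 cc (@continuous_sin R).
have [A0 dA] := primP cA; have [S0 dS] := primP cS.
rewrite -/A in A0 dA; rewrite -/S in S0 dS.
have bA x : `|phi x * cos x| <= B.
  by have [b0 _ _] := b x; rewrite normrM -[leRHS]mulr1 ler_pM// ler_norml cos_geN1 cos_le1.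
have bS x : `|phi x * sin x| <= B.
  by have [b0 _ _] := b x; rewrite normrM -[leRHS]mulr1 ler_pM// ler_norml sin_geN1 sin_le1.
have Api : A pi = 0.
  have pn : 2 / pi != 0 :> R by rewrite mulf_neq0// invr_eq0 gt_eqF.
  by apply: (mulfI pn); rewrite mulr0.
have Aodd x : A (- x) = - A x.
  have d : has_deriv (fun y => A (- y) + A y) (fun=> 0).
    move=> y; apply: (is_derive1_eq (derivD (deriv_comp (g := fun z => - z)
      (dA (- y)) (derivN (deriv_id y))) (dA y))).
    by rewrite s1 cosN; ring.
  have := has_deriv_const x 0 d; rewrite /= oppr0 -/A A0 addr0 => /eqP.
  by rewrite addr_eq0 => /eqP.
have Seven x : S (- x) = S x.
  have d : has_deriv (fun y => S (- y) - S y) (fun=> 0).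
    move=> y; apply: (is_derive1_eq (derivB (deriv_comp (g := fun z => - z)
      (dS (- y)) (derivN (deriv_id y))) (dS y))).
    by rewrite s1 sinN; ring.
  have := has_deriv_const x 0 d; rewrite /= oppr0 -/S S0 subr0 => /eqP.
  by rewrite subr_eq0 => /eqP.
have pA x : phi (x + pi) * cos (x + pi) = phi x * cos x.
  by rewrite s2 cosDpi; ring.
have pS x : phi (x + pi) * sin (x + pi) = phi x * sin x.
  by rewrite s2 sinDpi; ring.
(* No condition against sin arises: the integrand is odd with period pi, so S is even and its
   constant increment over pi equals its own negative. *)
have Spi : S pi = 0.
  have d : has_deriv (fun y => S (y + pi) - S y) (fun=> 0).
    move=> y; apply: (is_derive1_eq (derivB (deriv_comp (g := fun z => z + pi)
      (dS (y + pi)) (derivD (deriv_id y) (deriv_cst pi y))) (dS y))).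
    by rewrite addr0 mulr1 pS subrr.
  by have := has_deriv_const (- pi) 0 d; rewrite /= addNr add0r Seven -/S S0; lra.
have [Aper Ab] := prim_periodic cA pA Api bA.
have [Sper Sb] := prim_periodic cS pS Spi bS.
rewrite -/A in Aper Ab; rewrite -/S in Sper Sb.
pose k1 x := cos x * A x + sin x * S x.
have dK : has_deriv (Kop phi) k1.
  move=> x; apply: (is_derive1_eq (derivB (derivM (is_derive_sin x) (dA x))
    (derivM (is_derive_cos x) (dS x)))).
  by rewrite /k1 -/A -/S; ring.
have dk1 : has_deriv k1 (fun x => phi x - Kop phi x).
  move=> x; apply: (is_derive1_eq (derivD (derivM (is_derive_cos x) (dA x))
    (derivM (is_derive_sin x) (dS x)))).
  rewrite /Kop -/A -/S.
  have e : sin x * (phi x * sin x) = phi x - cos x * (phi x * cos x).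
    rewrite [LHS]mulrCA [X in _ - X]mulrCA -!expr2 -{2}[phi x]mulr1.
    by rewrite -(cos2Dsin2 x); ring.
  by rewrite e; ring.
have bt (u v p q : R) : `|u| <= 1 -> `|v| <= 1 -> `|p| <= B * pi -> `|q| <= B * pi ->
    `|u * p| + `|v * q| <= 2 * pi * B.
  move=> u1 v1 pB qB; have := ler_pM (normr_ge0 u) (normr_ge0 p) u1 pB.
  by have := ler_pM (normr_ge0 v) (normr_ge0 q) v1 qB; rewrite !normrM; lra.
have c1 x : `|cos x : R| <= 1 by rewrite ler_norml cos_geN1 cos_le1.
have sn1 x : `|sin x : R| <= 1 by rewrite ler_norml sin_geN1 sin_le1.
have bK x : `|Kop phi x| <= 2 * pi * B.
  by rewrite (le_trans (ler_normB _ _))//; exact: bt.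
have bk1 x : `|k1 x| <= 2 * pi * B.
  by rewrite (le_trans (ler_normD _ _))//; exact: bt.
have b2 x : `|phi x - Kop phi x| <= K0 * B.
  by rewrite (le_trans (ler_normB _ _))// /K0; have [b0 _ _] := b x; have := bK x; lra.
have l2 : 2 * pi * B <= K0 * B by rewrite /K0; lra.
split.
  exists k1, (fun x => phi x - Kop phi x); split => //.
  - by move=> x; split => //; apply: le_trans l2.
  - by move=> x; rewrite /Kop sinN cosN -/A -/S Aodd Seven; ring.
  - by move=> x; rewrite /Kop sinDpi cosDpi -/A -/S Aper Sper; ring.
exists (fun j => match j with 0%N => Kop phi | 1%N => k1
  | 2 => fun x => phi x - Kop phi x | 3 => fun x => phi1 x - k1 x
  | 4 => fun x => phi2 x - (phi x - Kop phi x) | _ => fun=> 0 end); split => //.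
- move=> [|[|[|[|//]]]] _ //.
  + by move=> x; exact: (derivB (d1 x) (dK x)).
  + by move=> x; exact: (derivB (d2 x) (dk1 x)).
- have le3 x := ler_normB (phi1 x) (k1 x).
  have le4 x := ler_normB (phi2 x) (phi x - Kop phi x).
  have le5 x := ler_normB (phi x) (Kop phi x).
  move=> [|[|[|[|[|//]]]]] x _ //.
  + exact: le_trans (bK x) l2.
  + exact: le_trans (bk1 x) l2.
  + rewrite (le_trans (le3 x))//; have [b0 b1 b2'] := b x; have := bk1 x.
    by rewrite /K0; lra.
  + rewrite (le_trans (le4 x))//; have [b0 b1 b2'] := b x; have := bK x.
    by have := le5 x; rewrite /K0; lra.
Qed.

End smooth_symmetric.

(** * Lindstedt series *)

Section formal_series.
Variable R : realType.
Implicit Types (c d : nat -> R -> R) (f : R -> R) (n m N : nat) (e B : R).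

Definition conv c d n : R -> R := fun x => \sum_(i < n.+1) c i x * d (n - i)%N x.

Definition shift c n : R -> R := if n is m.+1 then c m else fun=> 0.

(* Multiplication by eps^2 / 2. *)
Definition half_sqr c n : R -> R := fun x => 2^-1 * shift (shift c) n x.

Definition const_ser f n : R -> R := if n is 0%N then f else fun=> 0.

Definition add_ser c d n : R -> R := fun x => c n x + d n x.

Definition scale_ser (k : R) c n : R -> R := fun x => k * c n x.

Definition mul_cos c n : R -> R := fun x => c n x * cos x.

Definition agree N c d := forall n, (n < N)%N -> c n = d n.

Lemma agree_conv N c c' d d' : agree N c c' -> agree N d d' ->
  agree N (conv c d) (conv c' d').
Proof.
move=> cc dd n nN; apply/funext => x; apply: eq_bigr => -[i /= iN] _.
by rewrite cc ?dd// (leq_ltn_trans _ nN)// leq_subr.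
Qed.

Lemma agree_half_sqr N c c' : agree N c c' -> agree N.+1 (half_sqr c) (half_sqr c').
Proof.
move=> cc [|[|n]] nN; rewrite /half_sqr//=.
by rewrite cc//; apply: ltnW.
Qed.

Lemma agree_add N c c' d d' : agree N c c' -> agree N d d' ->
  agree N (add_ser c d) (add_ser c' d').
Proof. by move=> cc dd n nN; rewrite /add_ser cc ?dd. Qed.

Lemma agree_scale N k c c' : agree N c c' -> agree N (scale_ser k c) (scale_ser k c').
Proof. by move=> cc n nN; rewrite /scale_ser cc. Qed.

Lemma agreeW N c d : agree N.+1 c d -> agree N c d.
Proof. by move=> cd n nN; apply: cd; exact: ltnW. Qed.

Section causal_fixpoint.
Variables (X : Type) (F : (nat -> X) -> nat -> X) (s0 : nat -> X).
Hypothesis causal : forall n s t, (forall m, (m < n)%N -> s m = t m) -> F s n = F t n.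

(** Entry n depends on earlier entries only, so it no longer changes after n + 1 iterations,
    whatever the start. *)
Definition causal_fix n := iter n.+1 F s0 n.

Lemma causal_fixE n : causal_fix n = F causal_fix n.
Proof.
have stable : forall n k k', (n < k)%N -> (n < k')%N ->
    iter k F s0 n = iter k' F s0 n.
  elim/ltn_ind => {}n IH [//|k] [//|k'] nk nk' /=; apply: causal => m mn.
  exact: (IH m mn k k' (leq_trans mn nk) (leq_trans mn nk')).
by rewrite {1}/causal_fix /=; apply: causal => m mn; exact: stable.
Qed.

End causal_fixpoint.

Section majorants.
Variable C : R.
Hypothesis C0 : 0 < C.

Definition weight n : R := C ^+ n / n.+1%:R ^+ 2.

Lemma weight_gt0 n : 0 < weight n.
Proof. by rewrite divr_gt0// exprn_gt0. Qed.

Lemma weight_le n : weight n <= C ^+ n.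
Proof.
rewrite ler_pdivrMr ?exprn_gt0// ler_peMr ?exprn_ge0 ?(ltW C0)//.
by rewrite expr_ge1// ler1n.
Qed.

Lemma sum_inv_sqr n : \sum_(i < n.+1) (i.+1%:R ^+ 2 : R)^-1 <= 2 - n.+1%:R^-1.
Proof.
elim: n => [|n IH]; first by rewrite big_ord1 expr1n invr1; lra.
rewrite big_ord_recr/= (le_trans (lerD IH (lexx _)))//.
rewrite -(natr1 n.+1) -(natr1 n); have n0 : 0 <= n%:R :> R by [].
move: (n%:R : R) n0 => u u0; rewrite -subr_ge0.
have -> : 2 - (u + 1 + 1)^-1 - (2 - (u + 1)^-1 + ((u + 1 + 1) ^+ 2)^-1) =
   ((u + 1) * (u + 1 + 1) ^+ 2)^-1 by field; lra.
by rewrite invr_ge0 mulr_ge0 ?exprn_ge0//; lra.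
Qed.

(** For p + q = n, 1 / ((p+1)^2 (q+1)^2) is at most 2 / (n+1)^2 times 1 / (p+1)^2 + 1 / (q+1)^2;
    both sums of inverse squares are at most 2, which makes 8. *)
Lemma weight_conv n : \sum_(i < n.+1) weight i * weight (n - i)%N <= 8 * weight n.
Proof.
pose w i : R := (i.+1%:R ^+ 2)^-1.
have ws : \sum_(i < n.+1) w i <= 2.
  by rewrite (le_trans (sum_inv_sqr n))// gerBl invr_ge0.
have t (i : 'I_n.+1) : weight i * weight (n - i)%N <=
    2 * weight n * (w i + w (n - i)%N).
  have iE : (i + (n - i) = n)%N by rewrite subnKC// -ltnS.
  rewrite /weight -[in C ^+ n]iE exprD /w.
  have -> : n.+1%:R = i%:R + (n - i)%:R + 1 :> R by rewrite -natrD iE natr1.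
  rewrite -(natr1 i) -(natr1 (n - i)); have p0 : 0 <= i%:R :> R by [].
  have q0 : 0 <= (n - i)%:R :> R by [].
  have Cp : 0 <= C ^+ i * C ^+ (n - i) by rewrite mulr_ge0// exprn_ge0// ltW.
  move: (i%:R) ((n - i)%:R) p0 q0 => p q p0 q0.
  rewrite -subr_ge0.
  have -> : 2 * (C ^+ i * C ^+ (n - i) / (p + q + 1) ^+ 2) *
      (((p + 1) ^+ 2)^-1 + ((q + 1) ^+ 2)^-1) -
      C ^+ i / (p + 1) ^+ 2 * (C ^+ (n - i) / (q + 1) ^+ 2) =
    C ^+ i * C ^+ (n - i) * ((p - q) ^+ 2 + (p + q + 2) ^+ 2 - (p + q + 1) ^+ 2)
      / ((p + q + 1) * (p + 1) * (q + 1)) ^+ 2 by field; lra.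
  rewrite mulr_ge0 ?invr_ge0 ?sqr_ge0// mulr_ge0//.
  by have := sqr_ge0 (p - q); nra.
rewrite (le_trans (ler_sum _ (fun i _ => t i)))// -mulr_sumr big_split/=.
have E : \sum_(i < n.+1) w (n - i)%N = \sum_(i < n.+1) w i.
  rewrite (reindex_inj rev_ord_inj)/=; apply: eq_bigr => i _.
  by rewrite subSS subKn// -ltnS.
rewrite E; have := weight_gt0 n; nra.
Qed.

Lemma weight_shift n : weight n <= 4 / C * weight n.+1.
Proof.
rewrite /weight (exprS C) -(natr1 n.+1) -(natr1 n); have n0 : 0 <= n%:R :> R by [].
have Cn : 0 <= C ^+ n by rewrite exprn_ge0// ltW.
move: (n%:R) n0 => u u0; rewrite -subr_ge0.
have -> : 4 / C * (C * C ^+ n / (u + 1 + 1) ^+ 2) - C ^+ n / (u + 1) ^+ 2 =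
   C ^+ n * (4 * (u + 1) ^+ 2 - (u + 2) ^+ 2) / ((u + 2) * (u + 1)) ^+ 2.
  by field; apply/and3P; split; rewrite gt_eqF//; lra.
by rewrite mulr_ge0 ?invr_ge0 ?sqr_ge0// mulr_ge0//; nra.
Qed.

(** Only the orders below N are bounded, so that majorants can be established by induction on the
    order. *)
Definition maj e N B c := forall n, (n < N)%N -> c2 e (B * weight n) (c n).

Lemma maj_le e N B B' c : B <= B' -> maj e N B c -> maj e N B' c.
Proof.
move=> BB cm n nN; apply: c2_le (cm n nN).
by rewrite ler_wpM2r// ltW// weight_gt0.
Qed.

Lemma majW e N B c : maj e N.+1 B c -> maj e N B c.
Proof. by move=> cm n nN; apply: cm; exact: ltnW. Qed.

Lemma maj_add e N B B' c d : maj e N B c -> maj e N B' d ->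
  maj e N (B + B') (add_ser c d).
Proof. by move=> cm dm n nN; rewrite mulrDl; apply: c2D; [exact: cm|exact: dm]. Qed.

Lemma maj_scale k e N B c : maj e N B c -> maj e N (`|k| * B) (scale_ser k c).
Proof. by move=> cm n nN; rewrite -mulrA; apply: c2Z; exact: cm. Qed.

Lemma maj_mul_cos N B c : maj 1 N B c -> maj (-1) N (4 * B) (mul_cos c).
Proof.
move=> cm n nN; have := c2M (cm n nN) (c2_cos R); rewrite mul1r mulr1.
by rewrite mulrA.
Qed.

Lemma maj_conv e e' N B B' c d : maj e N B c -> maj e' N B' d ->
  maj (e * e') N (32 * (B * B')) (conv c d).
Proof.
move=> cm dm n nN.
have H i : (i < n.+1)%N -> c2 (e * e') (4 * ((B * weight i) * (B' * weight (n - i)%N)))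
    (fun x => c i x * d (n - i)%N x).
  move=> iN; apply: c2M; first by apply: cm; exact: leq_trans nN.
  by apply: dm; rewrite (leq_ltn_trans _ nN)// leq_subr.
have B0 : 0 <= B by have := c2_ge0 (cm _ nN); rewrite pmulr_lge0// weight_gt0.
have B0' : 0 <= B' by have := c2_ge0 (dm _ nN); rewrite pmulr_lge0// weight_gt0.
apply: c2_le (c2_sum H).
have -> : \sum_(i < n.+1) 4 * (B * weight i * (B' * weight (n - i)%N)) =
    4 * (B * B') * \sum_(i < n.+1) weight i * weight (n - i)%N.
  by rewrite mulr_sumr; apply: eq_bigr => i _; ring.
have BB : 0 <= 4 * (B * B') by rewrite !mulr_ge0.
by have := ler_wpM2l BB (weight_conv n); lra.
Qed.

Let c20 e B : 0 <= B -> c2 e B (fun=> 0 : R).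
Proof. by move=> B0; apply: c2_cst; rewrite ?normr0 ?mulr0. Qed.

Lemma maj_shift e N B c : 0 <= B -> maj e N B c -> maj e N.+1 (4 / C * B) (shift c).
Proof.
move=> B0 cm [|n] nN /=.
  by apply: c20; rewrite mulr_ge0 ?(ltW (weight_gt0 _))// mulr_ge0// divr_ge0// ltW.
apply: c2_le (cm n nN); rewrite mulrAC mulrC ler_wpM2r//.
exact: weight_shift.
Qed.

(** 8 / C^2 is half of (4 / C)^2, one factor per shift. It is small for large C, and the order
    gained drives the induction. *)
Lemma maj_half_sqr e N B c : 0 <= B -> maj e N B c ->
  maj e N.+1 (8 / C ^+ 2 * B) (half_sqr c).
Proof.
move=> B0 cm; apply: majW.
have B1 : 0 <= 4 / C * B by rewrite mulr_ge0// divr_ge0// ltW.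
have := maj_scale 2^-1 (maj_shift B1 (maj_shift B0 cm)).
apply: maj_le; rewrite ger0_norm// le_eqVlt; apply/orP; left; apply/eqP.
by field; rewrite gt_eqF.
Qed.

Lemma maj_const e N f : c2 e 1 f -> maj e N 1 (const_ser f).
Proof.
move=> cf [|n] _ /=; first by rewrite /weight expr0 expr1n divr1 mulr1.
by apply: c20; rewrite mul1r ltW// weight_gt0.
Qed.

End majorants.

Let S := nat -> R -> R.

(* With t = eps^2 / 2, the unknown is sought as lam = 1 + t rho, h = cos + t G,
   1 / (1 - 2k (1 - h^2)) = v = 1 + t z, v^3 = 1 + t y and 1 / lam = 1 + t chi.
   Then z = lam v (1 - h^2) and G'' + G = - (W + rho cos), where
   W = y cos + t (G (rho + y) + h rho y); [rho] removes the resonant part. *)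
Definition lam_ser (rho : S) : S := add_ser (const_ser (fun=> 1)) (half_sqr rho).
Definition prof_ser (G : S) : S := add_ser (const_ser cos) (half_sqr G).
Definition z_ser (G rho z : S) : S :=
  conv (lam_ser rho) (conv (lam_ser z) (add_ser (const_ser (fun=> 1))
    (scale_ser (-1) (conv (prof_ser G) (prof_ser G))))).
Definition y_ser (z : S) : S := add_ser (scale_ser 3 z)
  (add_ser (scale_ser 3 (half_sqr (conv z z))) (half_sqr (half_sqr (conv z (conv z z))))).
Definition Q_ser (G rho y : S) : S :=
  add_ser (conv G (add_ser rho y)) (conv (prof_ser G) (conv rho y)).
Definition W_ser (G rho y : S) : S := add_ser (mul_cos y) (half_sqr (Q_ser G rho y)).
Definition rho_ser (W : S) : S := fun n _ => - avg (W n).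
Definition G_ser (W rho : S) : S := fun n x =>
  - Kop (fun x => W n x + rho n x * cos x) x.
Definition chi_ser (rho' rho chi : S) : S :=
  add_ser (scale_ser (-1) rho') (scale_ser (-1) (half_sqr (conv rho chi))).

Let X := ((R -> R) * (R -> R) * (R -> R) * (R -> R))%type.
Let gG (s : nat -> X) : S := fun n => (s n).1.1.1.
Let gr (s : nat -> X) : S := fun n => (s n).1.1.2.
Let gc (s : nat -> X) : S := fun n => (s n).1.2.
Let gz (s : nat -> X) : S := fun n => (s n).2.

(** Within one order z comes first, then W, then rho, and from these G and chi. [G_ser] receives the
    new rho, since it has to cancel the resonance of the same order. *)
Let step (s : nat -> X) : nat -> X :=
  let z := z_ser (gG s) (gr s) (gz s) in
  let W := W_ser (gG s) (gr s) (y_ser z) in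
  let rho := rho_ser W in
  fun n => (G_ser W rho n, rho n, chi_ser rho (gr s) (gc s) n, z n).

Let pair4_eq (T1 T2 T3 T4 : Type) (x1 y1 : T1) (x2 y2 : T2) (x3 y3 : T3)
  (x4 y4 : T4) : x1 = y1 -> x2 = y2 -> x3 = y3 -> x4 = y4 ->
  (x1, x2, x3, x4) = (y1, y2, y3, y4).
Proof. by move=> -> -> -> ->. Qed.

(** The old unknowns enter only through [half_sqr], which looks back two orders. *)
Let step_causal n s t : (forall m, (m < n)%N -> s m = t m) -> step s n = step t n.
Proof.
move=> st.
have aG : agree n (gG s) (gG t) by move=> m mn; rewrite /gG st.
have ar : agree n (gr s) (gr t) by move=> m mn; rewrite /gr st.
have ac : agree n (gc s) (gc t) by move=> m mn; rewrite /gc st.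
have az : agree n (gz s) (gz t) by move=> m mn; rewrite /gz st.
have ax N c : agree N c c by [].
have aH : agree n.+1 (prof_ser (gG s)) (prof_ser (gG t)).
  by apply: agree_add => //; exact: agree_half_sqr.
have az' : agree n.+1 (z_ser (gG s) (gr s) (gz s)) (z_ser (gG t) (gr t) (gz t)).
  apply: agree_conv; first by apply: agree_add => //; exact: agree_half_sqr.
  apply: agree_conv; first by apply: agree_add => //; exact: agree_half_sqr.
  by apply: agree_add => //; apply: agree_scale; exact: agree_conv.
have ay : agree n.+1 (y_ser (z_ser (gG s) (gr s) (gz s)))
    (y_ser (z_ser (gG t) (gr t) (gz t))).
  have azz := agree_conv az' az'.
  apply: agree_add; first exact: agree_scale.
  apply: agree_add; first by apply: agree_scale; apply: agreeW; exact: agree_half_sqr.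
  do 2 (apply: agreeW; apply: agree_half_sqr); exact: agree_conv.
have aW : agree n.+1 (W_ser (gG s) (gr s) (y_ser (z_ser (gG s) (gr s) (gz s))))
   (W_ser (gG t) (gr t) (y_ser (z_ser (gG t) (gr t) (gz t)))).
  apply: agree_add; first by move=> m mn; rewrite /mul_cos ay.
  apply: agree_half_sqr; have ay' := agreeW ay; apply: agree_add.
    by apply: agree_conv => //; exact: agree_add.
  by apply: agree_conv; [exact: agreeW|exact: agree_conv].
have ach := agree_half_sqr (agree_conv ar ac).
have := az' n (ltnSn n); have := ach n (ltnSn n); have := aW n (ltnSn n).
rewrite /step; move: (z_ser (gG s) _ _) (z_ser (gG t) _ _) => zs zt.
move: (W_ser (gG s) _ _) (W_ser (gG t) _ _) => Ws Wt eW ec ez.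
apply: (@pair4_eq _ _ _ _ _ _ _ _ _ _ _ _ _ _ _ ez).
- by rewrite /G_ser /rho_ser eW.
- by rewrite /rho_ser eW.
- by rewrite /chi_ser /add_ser /scale_ser /rho_ser eW ec.
Qed.

Let K0 : R := 2 * pi + 2.

Section estimate.
Variables (C Z Y B : R).
Hypothesis C0 : 0 < C.
Let t := 8 / C ^+ 2.
Hypothesis ZE : Z = 32 * (2 * (32 * (2 * 129))).
Hypothesis YE : Y = 3 * Z + 2.
Hypothesis BE : B = K0 * (9 * (4 * Y + 1)) + Z + 1.
Hypothesis tB : t * B <= 1.
Hypothesis tZ2 : t * (3 * (32 * Z ^+ 2)) <= 1.
Hypothesis tZ3 : t * (t * (32 * (32 * Z ^+ 3))) <= 1.
Hypothesis tQ : t * (32 * (B * (B + Y)) + 32 * (2 * (32 * (B * Y)))) <= 1.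
Hypothesis tX : t * (32 * (B * B)) <= 1.

(** 129 is 1 plus 32 times 2 times 2, for 1 - h^2; Z adds the bounds 2 of v and of lam, with a 32
    per product. Y = 3 Z + 2 and 4 Y + 1 bound y and W, each correction being at most 1. The 9 is 1
    + 4 times 2, for adding rho cos, and K0 is the cost of [Kop]. None of these depends on C, so the
    smallness conditions on t can be met afterwards. *)
Lemma step_estimate N G rho chi z (z' := z_ser G rho z) (y := y_ser z')
    (W := W_ser G rho y) (rho' := rho_ser W) :
  maj C (-1) N B G -> maj C 1 N B rho -> maj C 1 N B chi -> maj C 1 N B z ->
  [/\ maj C (-1) N.+1 B (G_ser W rho'), maj C 1 N.+1 B rho',
      maj C 1 N.+1 B (chi_ser rho' rho chi), maj C 1 N.+1 B z' &
      maj C 1 N.+1 Y y /\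
      maj C (-1) N.+1 (9 * (4 * Y + 1)) (add_ser W (mul_cos rho'))].
Proof.
have p0 := pi_gt0 R.
have Z0 : 0 <= Z by rewrite ZE; lra.
have Y0 : 0 <= Y by rewrite YE; lra.
have K00 : 0 <= K0 by rewrite /K0; lra.
have KY : 0 <= K0 * (9 * (4 * Y + 1)) by rewrite mulr_ge0//; lra.
have B0 : 0 <= B by rewrite BE; lra.
move=> mG mr mc mz.
have m1 (c : S) : maj C 1 N B c -> maj C 1 N.+1 2 (lam_ser c).
  move=> cm; have := maj_add (@maj_const C C0 1 N.+1 (fun=> 1)
    (c2_cst (e := 1) (c := 1 : R) ltac:(by rewrite normr1) ltac:(by rewrite mul1r)))
    (maj_half_sqr C0 B0 cm).
  by apply: maj_le => //; move: tB; rewrite /t; lra.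
have mH : maj C (-1) N.+1 2 (prof_ser G).
  have := maj_add (maj_const (N := N.+1) C0 (c2_cos R)) (maj_half_sqr C0 B0 mG).
  by apply: maj_le => //; move: tB; rewrite /t; lra.
have mz' : maj C 1 N.+1 Z z'.
  have h1 := maj_add (@maj_const C C0 1 N.+1 (fun=> 1)
    (c2_cst (e := 1) (c := 1 : R) ltac:(by rewrite normr1) ltac:(by rewrite mul1r))).
  have h2 := maj_conv C0 mH mH.
  have h3 : maj C 1 N.+1 129 (add_ser (const_ser (fun=> 1))
      (scale_ser (-1) (conv (prof_ser G) (prof_ser G)))).
    move: h2; rewrite mulrNN mulr1 => /(maj_scale (-1)) /h1.
    by apply: maj_le => //; rewrite normrN normr1; lra.
  have := maj_conv C0 (m1 _ mr) (maj_conv C0 (m1 _ mz) h3).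
  by rewrite !mulr1 -ZE.
have mzz : maj C 1 N.+1 (32 * (Z * Z)) (conv z' z').
  by have := maj_conv C0 mz' mz'; rewrite mulr1.
have mzzz : maj C 1 N.+1 (32 * (Z * (32 * (Z * Z)))) (conv z' (conv z' z')).
  by have := maj_conv C0 mz' mzz; rewrite mulr1.
have my : maj C 1 N.+1 Y y.
  have ZZ0 : 0 <= 32 * (Z * Z) by rewrite !mulr_ge0.
  have ZZZ0 : 0 <= 32 * (Z * (32 * (Z * Z))) by rewrite !mulr_ge0.
  have h1 := maj_half_sqr C0 ZZ0 mzz.
  have h2 := maj_half_sqr C0 ZZZ0 mzzz.
  have t0 : 0 <= 8 / C ^+ 2 by rewrite divr_ge0// exprn_ge0// ltW.
  have h3 := maj_half_sqr C0 (mulr_ge0 t0 ZZZ0) h2.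
  have := maj_add (maj_scale 3 mz') (maj_add (maj_scale 3 (majW h1)) (majW (majW h3))).
  apply: maj_le => //; rewrite !ger0_norm// YE.
  by move: tZ2 tZ3; rewrite /t; lra.
have mQ : maj C (-1) N (32 * (B * (B + Y)) + 32 * (2 * (32 * (B * Y)))) (Q_ser G rho y).
  have my' := majW my.
  have h1 := maj_conv C0 mG (maj_add mr my').
  have h2 := maj_conv C0 (majW mH) (maj_conv C0 mr my').
  by rewrite !mulr1 in h1 h2; exact: maj_add h1 h2.
have Q0 : 0 <= 32 * (B * (B + Y)) + 32 * (2 * (32 * (B * Y))).
  by rewrite addr_ge0// !mulr_ge0// addr_ge0.
have mW : maj C (-1) N.+1 (4 * Y + 1) W.
  have := maj_add (maj_mul_cos my) (maj_half_sqr C0 Q0 mQ).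
  by apply: maj_le => //; move: tQ; rewrite /t; lra.
have mr2 : maj C 1 N.+1 (2 * (4 * Y + 1)) rho'.
  move=> n nN; apply: c2_cst; last by rewrite mul1r.
  rewrite normrN -mulrA; have cW := mW _ nN.
  by apply: avg_le; [exact: c2_continuous cW|move=> x; exact: c2_bound cW].
have mV : maj C (-1) N.+1 (9 * (4 * Y + 1)) (add_ser W (mul_cos rho')).
  by have := maj_add mW (maj_mul_cos mr2); apply: maj_le => //; lra.
split; last by split.
- move=> n nN; have := mV n nN; rewrite /add_ser /mul_cos => cV.
  have a0 : avg (fun x => W n x + rho' n x * cos x) = 0.
    rewrite /rho' /rho_ser avgD_cos ?subrr//.
    exact: c2_continuous (mW n nN).
  have [cK _] := Kop_props cV a0.
  have := c2Z (-1) cK; rewrite normrN normr1 mul1r => h.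
  rewrite (_ : G_ser W rho' n = (fun x => -1 * Kop (fun x => W n x + rho' n x * cos x) x)).
    apply: c2_le h; rewrite mulrA ler_wpM2r ?(ltW (weight_gt0 C0 n))//.
    by rewrite -/K0 BE; lra.
  by apply/funext => x; rewrite mulN1r.
- apply: maj_le mr2 => //; have h : 1 * (9 * (4 * Y + 1)) <= K0 * (9 * (4 * Y + 1)).
    by rewrite ler_wpM2r//; [lra|rewrite /K0; lra].
  by rewrite BE; lra.
- have BB0 : 0 <= 32 * (B * B) by rewrite !mulr_ge0.
  have h1 := maj_conv C0 mr mc; rewrite mulr1 in h1.
  have := maj_add (maj_scale (-1) mr2) (maj_scale (-1) (maj_half_sqr C0 BB0 h1)).
  apply: maj_le => //; rewrite normrN normr1 !mul1r.
  have h : 1 * (9 * (4 * Y + 1)) <= K0 * (9 * (4 * Y + 1)).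
    by rewrite ler_wpM2r//; [lra|rewrite /K0; lra].
  by move: tX; rewrite /t BE; lra.
- by apply: maj_le mz' => //; rewrite BE; lra.
Qed.

End estimate.

Theorem lindstedt : exists (C B : R) (G rho chi z : S),
  [/\ 0 < C, 0 <= B,
    [/\ forall N, maj C (-1) N B G, forall N, maj C 1 N B rho,
      forall N, maj C 1 N B chi & forall N, maj C 1 N B z],
    [/\ z = z_ser G rho z, chi = chi_ser rho rho chi,
      rho = rho_ser (W_ser G rho (y_ser z)) &
      G = G_ser (W_ser G rho (y_ser z)) rho] &
    (forall N, maj C 1 N B (y_ser z)) /\
    forall N, maj C (-1) N B (add_ser (W_ser G rho (y_ser z)) (mul_cos rho))].
Proof.
have p0 := pi_gt0 R.
have [Z ZE] : exists Z : R, Z = 32 * (2 * (32 * (2 * 129))) by eexists.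
have [Y YE] : exists Y : R, Y = 3 * Z + 2 by eexists.
have [B BE] : exists B : R, B = K0 * (9 * (4 * Y + 1)) + Z + 1 by eexists.
have Z0 : 0 <= Z by rewrite ZE; lra.
have Y0 : 0 <= Y by rewrite YE; lra.
have K00 : 2 <= K0 by rewrite /K0; lra.
have KY : 2 * (9 * (4 * Y + 1)) <= K0 * (9 * (4 * Y + 1)).
  by rewrite ler_wpM2r//; lra.
have BY : 9 * (4 * Y + 1) <= B by rewrite BE; lra.
have B0 : 0 <= B by lra.
pose Q : R := 32 * (B * (B + Y)) + 32 * (2 * (32 * (B * Y))).
have Q0 : 0 <= Q by rewrite /Q addr_ge0// !mulr_ge0// addr_ge0.
pose M : R := B + 3 * (32 * Z ^+ 2) + 32 * (32 * Z ^+ 3) + Q + 32 * (B * B) + 1.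
have z2 : 0 <= 3 * (32 * Z ^+ 2) by rewrite !mulr_ge0// sqr_ge0.
have z3 : 0 <= 32 * (32 * Z ^+ 3) by rewrite !mulr_ge0// exprn_ge0.
have bb : 0 <= 32 * (B * B) by rewrite !mulr_ge0.
have M1 : 1 <= M by rewrite /M; lra.
(* This makes t = 8 / C^2 equal to 1 / (8 M^2), and M dominates every quantity that t has to
   compensate. *)
pose C : R := 8 * M; have C0 : 0 < C by rewrite /C; lra.
have tM : 8 / C ^+ 2 * M <= 1.
  rewrite mulrAC ler_pdivrMr ?exprn_gt0// mul1r /C.
  have : M <= M * M by rewrite ler_peMl//; lra.
  by rewrite expr2; lra.
have t0 : 0 <= 8 / C ^+ 2 by rewrite divr_ge0// exprn_ge0// ltW.
have tc (u : R) : 0 <= u <= M -> 8 / C ^+ 2 * u <= 1.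
  by move=> /andP[u0 uM]; rewrite (le_trans _ tM)// ler_wpM2l.
have est := @step_estimate C Z Y B C0 ZE YE BE.
have {}est := est (tc B ltac:(by rewrite B0 /M; lra)).
have {}est := est (tc (3 * (32 * Z ^+ 2)) ltac:(by rewrite z2 /M; lra)).
have tz3 : 8 / C ^+ 2 * (32 * (32 * Z ^+ 3)) <= 1 by apply: tc; rewrite z3 /M; lra.
have t1 : 8 / C ^+ 2 <= 1 by rewrite -[leLHS]mulr1; apply: tc; lra.
have {}est := est ltac:(by rewrite -[leRHS]mulr1 ler_pM// mulr_ge0).
have {}est := est (tc Q ltac:(by rewrite Q0 /M; lra)).
have {}est := est (tc (32 * (B * B)) ltac:(by rewrite bb /M; lra)).
pose s := causal_fix step (fun _ => (fun=> 0, fun=> 0, fun=> 0, fun=> 0)).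
have sE n : s n = step s n by apply: causal_fixE; exact: step_causal.
pose G := gG s; pose rho := gr s; pose chi := gc s; pose z := gz s.
have zE : z = z_ser G rho z by apply/funext => n; rewrite {1}/z /gz sE.
have rE : rho = rho_ser (W_ser G rho (y_ser z)).
  by apply/funext => n; rewrite {1}/rho /gr sE /= -/z -zE.
have GE : G = G_ser (W_ser G rho (y_ser z)) rho.
  apply/funext => n; rewrite {1}/G /gG sE /=.
  by rewrite -/z -/(gG s) -/G -/(gr s) -/rho -zE -rE.
have cE : chi = chi_ser rho rho chi.
  apply/funext => n; rewrite {1}/chi /gc sE /=.
  by rewrite -/z -/(gG s) -/G -/(gr s) -/rho -zE -rE.
clearbody G rho chi z; clear s sE.
(* Induction on the order: the fixed point equations turn the output of [step_estimate] back into
   its input, with the same constant B. *)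
have mj N : [/\ maj C (-1) N B G, maj C 1 N B rho, maj C 1 N B chi & maj C 1 N B z].
  elim: N => // N [m1 m2 m3 m4]; have := est N _ _ _ _ m1 m2 m3 m4.
  by rewrite -zE -rE -GE -cE => -[e1 e2 e3 e4 _].
have mj2 N : maj C 1 N B (y_ser z) /\
    maj C (-1) N B (add_ser (W_ser G rho (y_ser z)) (mul_cos rho)).
  have [m1 m2 m3 m4] := mj N; have := est N _ _ _ _ m1 m2 m3 m4.
  rewrite -zE -rE => -[_ _ _ _ [e5 e6]]; split.
    by apply: majW; apply: maj_le e5 => //; lra.
  by apply: majW; exact: maj_le e6.
exists C, B, G, rho, chi, z; split => //.
  by split => N; case: (mj N).
by split => N; case: (mj2 N).
Qed.

End formal_series.

(** * Values of formal series at a given eps *)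

Section evaluation.
Variable R : realType.
Implicit Types (c d : nat -> R -> R) (x : R).

Section values.
Variables (C eps : R).
Hypotheses (C0 : 0 < C) (Ce : C * `|eps| < 1).

(** Weights instead of C^n, since they are stable under convolution with a constant independent of
    the order. *)
Definition summable c x := exists A : R, forall n, `|c n x| <= A * weight C n.

Definition value c x : R := power_sum (fun n => c n x : R) eps.

Lemma summable_ge0 c x (A : R) : (forall n, `|c n x| <= A * weight C n) -> 0 <= A.
Proof.
move=> /(_ 0%N) h; rewrite -(pmulr_lge0 _ (weight_gt0 C0 0)).
exact: le_trans h.
Qed.

Lemma summable_geometric c x (A : R) : (forall n, `|c n x| <= A * weight C n) ->
  forall n, `|c n x| <= A * C ^+ n.
Proof.
move=> h n; rewrite (le_trans (h n))// ler_wpM2l ?weight_le//.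
exact: summable_ge0 h.
Qed.

Lemma value_cvg c x : summable c x ->
  series (fun n => eps ^+ n * c n x) @ \oo --> value c x.
Proof.
move=> [A cA]; exact: (power_sum_cvg (@real_complete R) C0 (summable_geometric cA) Ce).
Qed.

Lemma value_unique c x v : summable c x ->
  series (fun n => eps ^+ n * c n x) @ \oo --> v -> value c x = v.
Proof. by move=> /value_cvg cv cv'; exact: (cvg_unique _ cv cv'). Qed.

Lemma value_tail c x (A : R) n : (forall k, `|c k x| <= A * C ^+ k) ->
  `|value c x - \sum_(0 <= k < n) eps ^+ k * c k x|
    <= A / (1 - C * `|eps|) * (C * `|eps|) ^+ n.
Proof.
move=> cA; exact: (power_sum_tail (@real_complete R) C0 cA n Ce).
Qed.

Lemma value_le c x (A : R) : (forall k, `|c k x| <= A * C ^+ k) ->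
  `|value c x| <= A / (1 - C * `|eps|).
Proof. by move=> /(value_tail 0); rewrite big_geq// subr0 expr0 mulr1. Qed.

Lemma summable_add c d x : summable c x -> summable d x -> summable (add_ser c d) x.
Proof.
move=> [A cA] [D dD]; exists (A + D) => n.
by rewrite mulrDl (le_trans (ler_normD _ _))// lerD.
Qed.

Lemma value_add c d x : summable c x -> summable d x ->
  value (add_ser c d) x = value c x + value d x.
Proof.
move=> sc sd; apply: value_unique; first exact: summable_add.
have -> : series (fun n => eps ^+ n * add_ser c d n x) =
    series (fun n => eps ^+ n * c n x) \+ series (fun n => eps ^+ n * d n x).
  apply/funext => n; rewrite /series/= -big_split/=; apply: eq_bigr => i _.
  by rewrite /add_ser mulrDr.
by apply: cvgD; exact: value_cvg.
Qed.

Lemma summable_scale k c x : summable c x -> summable (scale_ser k c) x.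
Proof.
by move=> [A cA]; exists (`|k| * A) => n; rewrite normrM -mulrA ler_wpM2l.
Qed.

Lemma value_scale k c x : summable c x -> value (scale_ser k c) x = k * value c x.
Proof.
move=> sc; apply: value_unique; first exact: summable_scale.
have -> : series (fun n => eps ^+ n * scale_ser k c n x) =
    (fun n => k * series (fun n => eps ^+ n * c n x) n).
  apply/funext => n; rewrite /series/= mulr_sumr; apply: eq_bigr => i _.
  by rewrite /scale_ser mulrCA.
by apply: cvgM; [exact: cvg_cst|exact: value_cvg].
Qed.

Lemma value_ext c d x : (forall n, c n x = d n x) -> value c x = value d x.
Proof. by move=> cd; rewrite /value; congr power_sum; apply/funext. Qed.

Lemma summable_mul_cos c x : summable c x -> summable (mul_cos c) x.
Proof.
by move=> /(summable_scale (cos x)) [A cA]; exists A => n; rewrite /mul_cos mulrC; exact: cA.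
Qed.

Lemma value_mul_cos c x : summable c x -> value (mul_cos c) x = value c x * cos x.
Proof.
move=> sc; rewrite mulrC -value_scale//; apply: value_ext => n.
by rewrite /mul_cos mulrC.
Qed.

Lemma summable_const (f : R -> R) x : summable (const_ser f) x.
Proof.
exists `|f x| => -[|n] /=; first by rewrite /weight expr0 expr1n divr1 mulr1.
by rewrite normr0 mulr_ge0// ltW// weight_gt0.
Qed.

Lemma value_const (f : R -> R) x : value (const_ser f) x = f x.
Proof.
apply: value_unique; first exact: summable_const.
apply: (@cvg_trans _ (cst (f x) @ \oo)); last exact: cvg_cst.
apply: near_eq_cvg; exists 1%N => // n /= n1.
rewrite /series/= big_ltn// expr0 mul1r big_nat_cond big1 ?addr0//.
by move=> [|i] /andP[/andP[i1 _] _] //=; rewrite mulr0.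
Qed.

Lemma shift_le c x (A : R) n : (forall n, `|c n x| <= A * weight C n) ->
  `|shift c n x| <= 4 / C * A * weight C n.
Proof.
move=> cA; have A0 := summable_ge0 cA; case: n => [|n] /=.
  by rewrite normr0 !mulr_ge0 ?invr_ge0 ?(ltW C0)// ltW// weight_gt0.
rewrite (le_trans (cA n))// mulrAC mulrC ler_wpM2r//.
exact: weight_shift.
Qed.

Lemma half_sqr_le c x (A : R) n : (forall n, `|c n x| <= A * weight C n) ->
  `|half_sqr c n x| <= 8 / C ^+ 2 * A * weight C n.
Proof.
move=> cA; have h m := shift_le m cA; have := shift_le n h.
rewrite /half_sqr normrM ger0_norm// => h2.
rewrite (_ : 8 / C ^+ 2 * A * weight C n = 2^-1 * (4 / C * (4 / C * A) * weight C n)).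
  by rewrite ler_wpM2l.
by field; rewrite gt_eqF.
Qed.

Lemma summable_shift c x : summable c x -> summable (shift c) x.
Proof.
by move=> [A cA]; exists (4 / C * A) => n; exact: shift_le.
Qed.

Lemma value_shift c x : summable c x -> value (shift c) x = eps * value c x.
Proof.
move=> sc; apply: value_unique; first exact: summable_shift.
rewrite -(cvg_shiftS (series (fun n => eps ^+ n * shift c n x))).
have -> : (fun n => series (fun n => eps ^+ n * shift c n x) n.+1) =
    (fun n => eps * series (fun n => eps ^+ n * c n x) n).
  apply/funext => n; rewrite /series/= big_nat_recl//= mulr0 add0r mulr_sumr.
  by apply: eq_bigr => i _; rewrite exprS mulrA.
by apply: cvgM; [exact: cvg_cst|exact: value_cvg].
Qed.

Lemma summable_half_sqr c x : summable c x -> summable (half_sqr c) x.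
Proof. by move=> sc; apply: summable_scale; do 2 apply: summable_shift. Qed.

Lemma value_half_sqr c x : summable c x ->
  value (half_sqr c) x = eps ^+ 2 / 2 * value c x.
Proof.
move=> sc; have := value_scale 2^-1 (summable_shift (summable_shift sc)).
rewrite value_shift ?value_shift//; last exact: summable_shift.
by move=> e; rewrite [LHS]e; ring.
Qed.

Lemma summable_conv_le (u v : nat -> R) (A D : R) n :
  (forall i, `|u i| <= A * weight C i) -> (forall i, `|v i| <= D * weight C i) ->
  `|\sum_(i < n.+1) u i * v (n - i)%N| <= 8 * (A * D) * weight C n.
Proof.
move=> uA vD.
have A0 : 0 <= A.
  by rewrite -(pmulr_lge0 _ (weight_gt0 C0 0)); exact: le_trans (uA 0%N).
have D0 : 0 <= D.
  by rewrite -(pmulr_lge0 _ (weight_gt0 C0 0)); exact: le_trans (vD 0%N).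
rewrite (le_trans (ler_norm_sum _ _ _))//.
have H (i : 'I_n.+1) : `|u i * v (n - i)%N| <=
    A * D * (weight C i * weight C (n - i)%N).
  by rewrite normrM mulrACA ler_pM.
rewrite (le_trans (ler_sum _ (fun i _ => H i)))// -mulr_sumr.
rewrite [leRHS](_ : _ = A * D * (8 * weight C n)); last by ring.
by rewrite ler_wpM2l ?mulr_ge0//; exact: weight_conv.
Qed.

Lemma summable_conv c d x : summable c x -> summable d x -> summable (conv c d) x.
Proof.
move=> [A cA] [D dD]; exists (8 * (A * D)) => n.
exact: (summable_conv_le (u := fun i => c i x) (v := fun i => d i x) n cA dD).
Qed.

(* The truncations of the two factors are polynomials, and the coefficients of
   their product are those of the convolution up to the truncation order. *)
Lemma value_conv c d x : summable c x -> summable d x ->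
  value (conv c d) x = value c x * value d x.
Proof.
move=> sc sd; apply: value_unique; first exact: summable_conv.
have := sc => -[A cA]; have := sd => -[D dD].
have A0 := summable_ge0 cA; have D0 := summable_ge0 dD.
pose q := C * `|eps|.
have q01 : 0 <= q < 1 by rewrite Ce mulr_ge0// ltW.
pose sC N := series (fun n => eps ^+ n * c n x) N.
pose sD N := series (fun n => eps ^+ n * d n x) N.
have key N : `|series (fun n => eps ^+ n * conv c d n x) N - sC N * sD N| <=
    8 * (A * D) / (1 - q) * q ^+ N.
  pose p1 := \poly_(i < N) c i x; pose p2 := \poly_(i < N) d i x.
  have E1 : sC N = p1.[eps].
    rewrite horner_poly /sC /series/= big_mkord; apply: eq_bigr => i _.
    by rewrite mulrC.
  have E2 : sD N = p2.[eps].
    rewrite horner_poly /sD /series/= big_mkord; apply: eq_bigr => i _.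
    by rewrite mulrC.
  have sz : (size (p1 * p2)%R <= N + N)%N.
    have s1 : (size p1 <= N)%N by exact: size_poly.
    have s2 : (size p2 <= N)%N by exact: size_poly.
    rewrite (leq_trans (size_polyMleq _ _))//.
    by rewrite (leq_trans (leq_pred _))// leq_add.
  rewrite E1 E2 -hornerM (horner_coef_wide _ sz) -(big_mkord predT
    (fun i => (p1 * p2)`_i * eps ^+ i)).
  rewrite (@big_cat_nat _ _ _ N 0 (N + N))//= ?leq_addr//.
  have -> : series (fun n => eps ^+ n * conv c d n x) N =
      \sum_(0 <= i < N) (p1 * p2)`_i * eps ^+ i.
    rewrite /series/=; apply: eq_big_nat => i /andP[_ iN].
    rewrite mulrC coefM; congr (_ * _); apply: eq_bigr => -[j /= ji] _.
    rewrite !coef_poly (leq_trans ji iN).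
    by rewrite (leq_ltn_trans (leq_subr _ _) iN).
  rewrite opprD addrA subrr add0r normrN.
  have p1A i : `|p1`_i| <= A * weight C i.
    rewrite coef_poly; case: ifP => // _; rewrite normr0 mulr_ge0// ltW//.
    exact: weight_gt0.
  have p2D i : `|p2`_i| <= D * weight C i.
    rewrite coef_poly; case: ifP => // _; rewrite normr0 mulr_ge0// ltW//.
    exact: weight_gt0.
  apply: sum_norm_geometric => //; first by rewrite !mulr_ge0.
  move=> k; rewrite normrM normrX coefM /q exprMn [leRHS]mulrA.
  rewrite ler_wpM2r ?exprn_ge0//.
  rewrite (le_trans (summable_conv_le k p1A p2D))//.
  by rewrite ler_wpM2l ?mulr_ge0//; exact: weight_le.
have c0 : (fun N => 8 * (A * D) / (1 - q) * q ^+ N) @ \oo --> 0.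
  rewrite -[0](mulr0 (8 * (A * D) / (1 - q))); apply: cvgM; first exact: cvg_cst.
  by apply: cvg_expr; rewrite ger0_norm; case/andP: q01.
have cP : (fun N => sC N * sD N) @ \oo --> value c x * value d x.
  by apply: cvgM; exact: value_cvg.
have cz : (fun N => series (fun n => eps ^+ n * conv c d n x) N - sC N * sD N)
    @ \oo --> 0.
  apply/cvgrPdist_le => e e0; have /cvgrPdist_le/(_ _ e0) := c0.
  apply: filterS => N; rewrite !sub0r !normrN => h.
  by rewrite (le_trans (key N))// (le_trans (ler_norm _)).
rewrite -[value c x * value d x]add0r.
have -> : series (fun n => eps ^+ n * conv c d n x) = (fun N =>
    (series (fun n => eps ^+ n * conv c d n x) N - sC N * sD N) + sC N * sD N).
  by apply/funext => N; rewrite subrK.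
exact: cvgD cz cP.
Qed.

Lemma value_has_deriv (c d : nat -> R -> R) (A : R) :
  (forall n, has_deriv (c n) (d n)) -> (forall n x, `|c n x| <= A * C ^+ n) ->
  (forall n x, `|d n x| <= A * C ^+ n) -> has_deriv (value c) (value d).
Proof.
move=> cd cA dA; pose q := C * `|eps|.
have q01 : 0 <= q < 1 by rewrite Ce mulr_ge0// ltW.
pose t n := A / (1 - q) * q ^+ n.
have t0 : t @ \oo --> 0.
  rewrite -[0](mulr0 (A / (1 - q))); apply: cvgM; first exact: cvg_cst.
  by apply: cvg_expr; rewrite ger0_norm; case/andP: q01.
apply: (has_deriv_limit (s := fun n x => \sum_(0 <= k < n) eps ^+ k * c k x)
  (s1 := fun n x => \sum_(0 <= k < n) eps ^+ k * d k x) t0).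
- elim=> [|n IH] x.
    rewrite (_ : (fun x => _) = fun=> 0); last by apply/funext => y; rewrite big_geq.
    by rewrite big_geq//; exact: deriv_cst.
  rewrite (_ : (fun x => _) = fun y => (\sum_(0 <= k < n) eps ^+ k * c k y)
    + eps ^+ n * c n y); last by apply/funext => y; rewrite big_nat_recr.
  by rewrite big_nat_recr//=; exact: (derivD (IH x) (derivZ (eps ^+ n) (cd n x))).
- by move=> n x; rewrite distrC; exact: value_tail.
- by move=> n x; rewrite distrC; exact: value_tail.
Qed.

End values.
End evaluation.

(** * From the formal series to an actual solution *)

Section lindstedt_solution.
Variable R : realType.

(** The resonant part of W at order 0. Against cos the integrand is 3 sin^2 cos^2, with the
    primitive 3/8 (x - sin (4 x) / 4). *)
Lemma avg_sin2cos : avg (fun x : R => 3 * sin x ^+ 2 * cos x) = 3 / 4.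
Proof.
have pn : pi != 0 :> R by rewrite gt_eqF// pi_gt0.
rewrite /avg (@prim_unique _ _ (fun x => 3 / 8 * (x - sin x * cos x *
  (cos x ^+ 2 - sin x ^+ 2)))).
- by rewrite sinpi !mul0r subr0; move: (pi : R) pn => p pn; field.
- by rewrite sin0 !mul0r subrr mulr0.
- move=> x; have s := is_derive_sin x; have c := is_derive_cos x.
  apply: (is_derive1_eq (derivZ (3 / 8) (derivB (deriv_id x)
    (derivM (derivM s c) (derivB (derivX 1 c) (derivX 1 s)))))).
  have e : sin x ^+ 2 = 1 - cos x ^+ 2 :> R by rewrite -(cos2Dsin2 x); ring.
  rewrite !expr1.
  transitivity (3 / 8 * (1 - (cos x ^+ 2 - sin x ^+ 2) ^+ 2 +
    4 * sin x ^+ 2 * cos x ^+ 2) : R); first by ring.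
  rewrite -[3 * _ * _ * _]/(3 * sin x ^+ 2 * cos x * cos x).
  rewrite -[RHS]mulrA -expr2 e; by field.
Qed.

Lemma Kop0 (phi : R -> R) : continuous phi -> Kop phi 0 = 0.
Proof.
move=> cp; have [S0 _] := primP (continuousM2 cp (@continuous_sin R)).
by rewrite /Kop S0 sin0 mul0r mulr0 subrr.
Qed.

Definition cos_jet (j : nat) : R -> R :=
  match j with
  | 0%N => cos | 1%N => fun x => - sin x | 2 => fun x => - cos x
  | 3 => sin | 4 => cos | _ => fun=> 0
  end.

Lemma cos_jets : jets 4 cos_jet.
Proof.
move=> [|[|[|[|//]]]] _ x /=.
- exact: is_derive_cos.
- exact: (derivN (is_derive_sin x)).
- by apply: (is_derive1_eq (derivN (is_derive_cos x))); rewrite opprK.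
- exact: is_derive_sin.
Qed.

Lemma cos_jet_le j x : `|cos_jet j x| <= 1.
Proof.
have c1 : `|cos x : R| <= 1 by rewrite ler_norml cos_geN1 cos_le1.
have s1 : `|sin x : R| <= 1 by rewrite ler_norml sin_geN1 sin_le1.
by case: j => [|[|[|[|[|j]]]]] /=; rewrite ?normrN ?normr0.
Qed.

Let S := nat -> R -> R.

Section series_solution.
Variables (C B : R) (G rho chi z : S).
Hypotheses (C0 : 0 < C) (B0 : 0 <= B).
Hypotheses (mG : forall N, maj C (-1) N B G) (mr : forall N, maj C 1 N B rho)
  (mc : forall N, maj C 1 N B chi) (mz : forall N, maj C 1 N B z).
Hypotheses (zE : z = z_ser G rho z) (cE : chi = chi_ser rho rho chi)
  (rE : rho = rho_ser (W_ser G rho (y_ser z)))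
  (GE : G = G_ser (W_ser G rho (y_ser z)) rho).
Hypotheses (my : forall N, maj C 1 N B (y_ser z))
  (mV : forall N, maj C (-1) N B (add_ser (W_ser G rho (y_ser z)) (mul_cos rho))).

Let W := W_ser G rho (y_ser z).
Let V := add_ser W (mul_cos rho).
Let K0 : R := 2 * pi + 2.

Let cV n : c2 (-1) (B * weight C n) (V n). Proof. exact: mV (ltnSn n). Qed.
Let cG n : c2 (-1) (B * weight C n) (G n). Proof. exact: mG (ltnSn n). Qed.
Let cr n : c2 1 (B * weight C n) (rho n). Proof. exact: mr (ltnSn n). Qed.
Let cc n : c2 1 (B * weight C n) (chi n). Proof. exact: mc (ltnSn n). Qed.
Let cz n : c2 1 (B * weight C n) (z n). Proof. exact: mz (ltnSn n). Qed.
Let cy n : c2 1 (B * weight C n) (y_ser z n). Proof. exact: my (ltnSn n). Qed.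

Let rho_const n x : rho n x = - avg (W n).
Proof. by rewrite [in LHS]rE. Qed.

Let G_Kop n x : G n x = - Kop (V n) x.
Proof. by rewrite [in LHS]GE. Qed.

Let cW n : continuous (W n).
Proof.
have c := c2_continuous (c2D (cV n) (c2Z (avg (W n)) (c2_cos R))).
suff -> : W n = (fun x => V n x + avg (W n) * cos x) by exact: c.
apply/funext => x; have -> : V n x = W n x + - avg (W n) * cos x by rewrite -(rho_const n x).
by rewrite mulNr addrNK.
Qed.

Let avgV n : avg (V n) = 0.
Proof.
have -> : V n = (fun x => W n x + - avg (W n) * cos x).
  by apply/funext => x; rewrite -(rho_const n x).
by rewrite avgD_cos ?subrr.
Qed.

Let G_jets : exists dG : nat -> S, [/\ dG 0%N = G,
  forall n, jets 4 (fun j => dG j n),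
  forall j n x, (j <= 4)%N -> `|dG j n x| <= K0 * B * weight C n &
  dG 2 = (fun n x => - V n x - G n x)].
Proof.
have /choice[d dP] : forall n, exists d : nat -> R -> R, [/\ d 0%N = Kop (V n),
    jets 4 d, forall j x, (j <= 4)%N -> `|d j x| <= K0 * (B * weight C n)
    & d 2 = (fun x => V n x - Kop (V n) x)].
  by move=> n; have [_ h] := Kop_props (cV n) (avgV n).
exists (fun j n x => - d n j x); split.
- apply/funext => n; apply/funext => x; have [-> _ _ _] := dP n.
  by rewrite G_Kop.
- by move=> n j j4 x; have [_ h _ _] := dP n; exact: (derivN (h j j4 x)).
- by move=> j n x j4; have [_ _ h _] := dP n; rewrite normrN -mulrA; exact: h.
- apply/funext => n; apply/funext => x; have [_ _ _ ->] := dP n.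
  by rewrite G_Kop; ring.
Qed.

Lemma prof_ser_half_wave n : half_wave (prof_ser G n).
Proof.
(* The index [n.-2] reflects the two shifts of [half_sqr]; the summand 2 covers the orders 0 and
   1. *)
have c : c2 (-1) (2 + B * weight C n.-2) (prof_ser G n).
  case: n => [|[|n]]; rewrite /prof_ser /add_ser /half_sqr /=.
  - rewrite (_ : (fun x => _) = cos); last by apply/funext => x; rewrite mulr0 addr0.
    by apply: c2_le (c2_cos R); have := c2_ge0 (cG 0); lra.
  - rewrite (_ : (fun x => _) = fun=> 0); last by apply/funext => x; rewrite mulr0 addr0.
    apply: c2_cst; last by rewrite mulr0.
    by rewrite normr0; have := c2_ge0 (cG 0); lra.
  - rewrite (_ : (fun x => _) = fun x => 2^-1 * G n x); last first.
      by apply/funext => x; rewrite add0r.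
    apply: c2_le (c2Z 2^-1 (cG n)); rewrite ger0_norm//.
    by have := c2_ge0 (cG n); lra.
by case: c => f1 [f2 [_ _ _ e p]]; split => // x; rewrite p mulN1r.
Qed.

Let M : R := 1 + 8 / C ^+ 2 * (K0 * B).

Let M0 : 0 <= M.
Proof.
have p0 := pi_gt0 R; have k0 : 0 <= K0 by rewrite /K0; lra.
have t0 : 0 <= 8 / C ^+ 2 by rewrite divr_ge0// exprn_ge0// ltW.
by apply: addr_ge0 => //; apply: mulr_ge0 => //; exact: mulr_ge0.
Qed.

(** The last clause is the formal version of h'' = - h - t V with t = eps^2 / 2, the differential
    equation before its nonlinearity is summed. *)
Lemma prof_ser_jets : exists D : nat -> S, [/\ D 0%N = prof_ser G,
  forall n, jets 4 (fun j => D j n),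
  forall j n x, (j <= 4)%N -> `|D j n x| <= M * weight C n &
  D 2 = add_ser (scale_ser (-1) (prof_ser G)) (scale_ser (-1) (half_sqr V))].
Proof.
have [dG [d0 dj dM d2]] := G_jets.
exists (fun j => add_ser (const_ser (cos_jet j)) (half_sqr (dG j))); split.
- by rewrite d0.
- move=> n j j4 x; have c : has_deriv (fun=> 0 : R) (fun=> 0 : R).
    by move=> y; exact: deriv_cst.
  have h0 : has_deriv (const_ser (cos_jet j) n) (const_ser (cos_jet j.+1) n).
    by case: n => [|n] /=; [exact: cos_jets|exact: c].
  have h1 : has_deriv (half_sqr (dG j) n) (half_sqr (dG j.+1) n).
    move=> y; apply: derivZ; case: n {h0} => [|[|n]] /=; try exact: deriv_cst.
    exact: (dj n j j4 y).
  exact: (derivD (h0 x) (h1 x)).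
- move=> j n x j4; rewrite /add_ser (le_trans (ler_normD _ _))// /M mulrDl lerD//.
    rewrite mul1r; case: n => [|n] /=.
      by rewrite /weight expr0 expr1n divr1 cos_jet_le.
    by rewrite normr0 ltW// weight_gt0.
  by apply: half_sqr_le => // m; exact: dM.
- rewrite d2; apply/funext => n; apply/funext => x.
  rewrite /add_ser /scale_ser /prof_ser /add_ser /half_sqr.
  by case: n => [|[|n]] /=; ring.
Qed.

Lemma gam_ser_le n : `|lam_ser chi n 0| <= (1 + 8 / C ^+ 2 * B) * weight C n.
Proof.
rewrite /lam_ser /add_ser (le_trans (ler_normD _ _))// mulrDl lerD//.
  rewrite mul1r; case: n => [|n] /=.
    by rewrite /weight expr0 expr1n divr1 normr1.
  by rewrite normr0 ltW// weight_gt0.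
by apply: half_sqr_le => // m; exact: c2_bound (cc m).
Qed.

(** The zero coefficient of order 3 makes the remainder of gamma quartic; it goes back to z 1 = 0,
    as corrections to lam and h start at order 2. *)
Lemma lindstedt_first_coefs : [/\ prof_ser G 0 = cos, lam_ser chi 0 0 = 1,
  lam_ser chi 1 0 = 0, lam_ser chi 2 0 = 3 / 8 & lam_ser chi 3 0 = 0].
Proof.
have h0 (c : S) x : half_sqr c 0 x = 0 by rewrite /half_sqr /= mulr0.
have h1 (c : S) x : half_sqr c 1 x = 0 by rewrite /half_sqr /= mulr0.
have P0 : prof_ser G 0 = cos.
  by apply/funext => x; rewrite /prof_ser /add_ser h0 addr0.
have P1 x : prof_ser G 1 x = 0 by rewrite /prof_ser /add_ser h1 addr0.
have L0 (c : S) x : lam_ser c 0 x = 1 by rewrite /lam_ser /add_ser h0 addr0.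
have L1 (c : S) x : lam_ser c 1 x = 0 by rewrite /lam_ser /add_ser h1 addr0.
have cv0 (c d : S) x : conv c d 0 x = c 0 x * d 0 x by rewrite /conv big_ord1.
have cv1 (c d : S) x : conv c d 1 x = c 0 x * d 1 x + c 1 x * d 0 x.
  by rewrite /conv big_ord_recl big_ord1.
have z0 x : z 0 x = sin x ^+ 2.
  rewrite [in LHS]zE /z_ser !cv0 !L0 !mul1r /add_ser /scale_ser cv0 P0 /=.
  by have := cos2Dsin2 x; lra.
have z1 x : z 1 x = 0.
  rewrite [in LHS]zE /z_ser !cv1 !L1 !mul0r !addr0 !L0 !mul1r /add_ser /scale_ser.
  by rewrite cv1 P1 /= mulr0 mul0r addr0 mulr0 addr0.
have W0 : W 0 = (fun x => 3 * sin x ^+ 2 * cos x).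
  apply/funext => x; rewrite /W /W_ser /y_ser /add_ser /scale_ser /mul_cos !h0.
  by rewrite z0 mulr0 !addr0.
have W1 : W 1 = (fun=> 0).
  apply/funext => x; rewrite /W /W_ser /y_ser /add_ser /scale_ser /mul_cos !h1.
  by rewrite z1 !mulr0 !addr0 mul0r.
have c0 : chi 0 0 = 3 / 4.
  rewrite [in LHS]cE /chi_ser /add_ser /scale_ser h0 mulr0 addr0 rho_const W0.
  by rewrite avg_sin2cos; ring.
have c1 : chi 1 0 = 0.
  rewrite [in LHS]cE /chi_ser /add_ser /scale_ser h1 mulr0 addr0 rho_const W1.
  have a0 : `|avg (fun=> 0 : R)| <= 2 * 0.
    apply: avg_le; first exact: cst_continuous.
    by move=> x; rewrite normr0.
  by move: a0; rewrite mulr0 normr_le0 => /eqP ->; rewrite oppr0 mulr0.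
split => //; rewrite /lam_ser /add_ser /half_sqr /=.
- by rewrite c0; field.
- by rewrite c1 mulr0 addr0.
Qed.

Section at_eps.
Variable eps : R.
Hypotheses (Ce : C * `|eps| <= 1 / 2) (Be : eps ^+ 2 * B <= 1 / 2)
  (e1 : eps ^+ 2 <= 1 / 4).

Let Ce1 : C * `|eps| < 1.
Proof. by apply: le_lt_trans Ce _; lra. Qed.
Let val := @value R eps.
Let tau := eps ^+ 2 / 2.

Let sG x : summable C G x. Proof. by exists B => n; exact: c2_bound (cG n). Qed.
Let sr x : summable C rho x. Proof. by exists B => n; exact: c2_bound (cr n). Qed.
Let sc x : summable C chi x. Proof. by exists B => n; exact: c2_bound (cc n). Qed.
Let sz x : summable C z x. Proof. by exists B => n; exact: c2_bound (cz n). Qed.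
Let sy x : summable C (y_ser z) x. Proof. by exists B => n; exact: c2_bound (cy n). Qed.

Let s_const (f : R -> R) x := summable_const C0 f x.

Let lam x := val (lam_ser rho) x.
Let v x := val (lam_ser z) x.
Let h x := val (prof_ser G) x.

Let s_lam (c : S) x : summable C c x -> summable C (lam_ser c) x.
Proof. by move=> cs; apply: summable_add => //; exact: summable_half_sqr. Qed.

Let val_lam (c : S) x : summable C c x -> val (lam_ser c) x = 1 + tau * val c x.
Proof.
move=> cs; rewrite /val (value_add C0 Ce1)//; last exact: summable_half_sqr.
by rewrite (value_const C0 Ce1) (value_half_sqr C0 Ce1).
Qed.

Let s_h x : summable C (prof_ser G) x.
Proof. by apply: summable_add => //; exact: summable_half_sqr. Qed.

Let val_h x : h x = cos x + tau * val G x.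
Proof.
rewrite /h /val (value_add C0 Ce1)//; last exact: summable_half_sqr.
by rewrite (value_const C0 Ce1) (value_half_sqr C0 Ce1).
Qed.

Let val_z x : val z x = lam x * (v x * (1 - h x ^+ 2)).
Proof.
have shh := summable_conv C0 (s_h x) (s_h x).
have s1 : summable C (add_ser (const_ser (fun=> 1))
    (scale_ser (-1) (conv (prof_ser G) (prof_ser G)))) x.
  by apply: summable_add => //; exact: summable_scale.
rewrite [in LHS]zE /val (value_conv C0 Ce1)//; [|exact: s_lam|]; last first.
  by apply: summable_conv => //; exact: s_lam.
rewrite (value_conv C0 Ce1)//; last exact: s_lam.
rewrite (value_add C0 Ce1)//; last exact: summable_scale.
rewrite (value_const C0 Ce1) (value_scale C0 Ce1)// (value_conv C0 Ce1)//.
by rewrite mulN1r expr2.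
Qed.

Let val_y x : val (y_ser z) x = 3 * val z x + 3 * tau * val z x ^+ 2 +
  tau ^+ 2 * val z x ^+ 3.
Proof.
have s2 := summable_conv C0 (sz x) (sz x).
have s3 := summable_conv C0 (sz x) s2.
have t1 := summable_half_sqr C0 s2.
have t2 := summable_half_sqr C0 (summable_half_sqr C0 s3).
rewrite /val (value_add C0 Ce1); last 2 first.
- exact: summable_scale.
- by apply: summable_add => //; exact: summable_scale.
rewrite (value_add C0 Ce1)//; last exact: summable_scale.
rewrite !(value_scale C0 Ce1 3)// !(value_half_sqr C0 Ce1)//; last exact: summable_half_sqr.
by rewrite !(value_conv C0 Ce1)// /tau; ring.
Qed.

Let sQ x : summable C (Q_ser G rho (y_ser z)) x.
Proof.
apply: summable_add; first by apply: summable_conv => //; exact: summable_add.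
by apply: summable_conv => //; exact: summable_conv.
Qed.

Let val_V x : val V x = val (y_ser z) x * cos x + tau * (val G x *
  (val rho x + val (y_ser z) x) + h x * (val rho x * val (y_ser z) x)) +
  val rho x * cos x.
Proof.
have s1 := summable_mul_cos (sy x); have s2 := summable_mul_cos (sr x).
have s3 := summable_half_sqr C0 (sQ x).
have s4 := summable_add (sr x) (sy x).
have s5 := summable_conv C0 (sr x) (sy x).
have s6 := summable_conv C0 (sG x) s4.
have s7 := summable_conv C0 (s_h x) s5.
rewrite /val /V /W /W_ser (value_add C0 Ce1)//; last exact: summable_add.
rewrite (value_add C0 Ce1)// !(value_mul_cos C0 Ce1)// (value_half_sqr C0 Ce1)//.
rewrite /Q_ser (value_add C0 Ce1)// !(value_conv C0 Ce1)//.
by rewrite (value_add C0 Ce1).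
Qed.

Let sV x : summable C V x. Proof. by exists B => n; exact: c2_bound (cV n). Qed.

Let tau0 : 0 <= tau. Proof. by rewrite divr_ge0// sqr_ge0. Qed.

Let small (c : S) x : (forall n, `|c n x| <= B * weight C n) -> `|tau * val c x| <= 1 / 2.
Proof.
move=> cB; have := value_le C0 Ce1 (summable_geometric C0 cB).
rewrite -/(val c x) => le1; rewrite normrM ger0_norm//.
have : B / (1 - C * `|eps|) <= 2 * B.
  have B0' := B0; have h1 := Ce; rewrite ler_pdivrMr; last by lra.
  by have := ler_wpM2l B0' h1; lra.
move=> le2; have := ler_wpM2l tau0 (le_trans le1 le2).
by have := Be; rewrite /tau; lra.
Qed.

Let rho0 x : val rho x = val rho 0.
Proof. by apply: value_ext => n; rewrite !rho_const. Qed.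

Let v_pos x : 1 / 2 <= v x.
Proof.
rewrite /v val_lam//; have := @small z x (fun n => c2_bound x (cz n)).
by rewrite ler_norml; lra.
Qed.

Let lam_itv x : 1 / 2 <= lam x <= 3 / 2.
Proof.
rewrite /lam val_lam//; have := @small rho x (fun n => c2_bound x (cr n)).
by rewrite ler_norml; lra.
Qed.

Let k := lam 0 * eps ^+ 2 / 4.

Let lam0E x : lam x = lam 0. Proof. by rewrite /lam !val_lam// rho0. Qed.

(** The recursion for z was set up so that v = 1 + tau lam v (1 - h^2), and 2 k = tau lam. *)
Let vq x : v x * (1 - 2 * k * (1 - h x ^+ 2)) = 1.
Proof.
have : v x = 1 + tau * (lam 0 * (v x * (1 - h x ^+ 2))).
  by rewrite {1}/v val_lam// val_z lam0E.
by rewrite /k /tau; move: (v x) (lam 0) (h x) => p q u; lra.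
Qed.

Let q_neq0 x : 1 - 2 * k * (1 - h x ^+ 2) != 0.
Proof. by apply/eqP => e; have := vq x; rewrite e mulr0 => /eqP; rewrite eq_sym oner_eq0. Qed.

Let vE x : v x = (1 - 2 * k * (1 - h x ^+ 2))^-1.
Proof. by apply: (mulIf (q_neq0 x)); rewrite vq mulVf. Qed.

Lemma lindstedt_osc : exists (l k : R) (h1 : R -> R), [/\ 0 < l, 0 <= k < 1 / 2,
  val (lam_ser chi) 0 * l = 1, l * eps ^+ 2 = 4 * k &
  osc l k (val (prof_ser G)) h1].
Proof.
have [D [D0 Dj DM D2]] := prof_ser_jets.
have DC j n x : (j <= 4)%N -> `|D j n x| <= M * C ^+ n.
  by move=> j4; apply: (summable_geometric C0 (fun n => DM j n x j4)).
have hd j : (j < 4)%N -> has_deriv (val (D j)) (val (D j.+1)).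
  move=> j4; apply: (value_has_deriv C0 Ce1 (A := M)) => [n|n x|n x].
  - exact: Dj.
  - by apply: DC; exact: ltnW.
  - exact: DC.
have dh : has_deriv h (val (D 1%N)) by have := hd 0%N isT; rewrite D0.
have /andP[l1 l2] := lam_itv 0.
have h2 : has_deriv (val (D 1%N))
    (fun x => - lam 0 * h x / (1 - 2 * k * (1 - h x ^+ 2)) ^+ 3).
  move=> x; apply: (is_derive1_eq (hd 1%N isT x)).
  have t1 := summable_half_sqr C0 (sV x).
  rewrite D2 /val (value_add C0 Ce1); last 2 first.
  - exact: summable_scale.
  - exact: summable_scale.
  rewrite !(value_scale C0 Ce1 (-1))// (value_half_sqr C0 Ce1)// -/tau -/(val V x).
  rewrite -[value eps (prof_ser G) x]/(h x) val_V -exprVn -vE.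
  have -> : v x = 1 + tau * val z x by rewrite /v val_lam.
  have -> : lam 0 = 1 + tau * val rho x by rewrite -(lam0E x) /lam val_lam.
  rewrite val_y val_h; ring.
have h0 : h 0 = 1.
  rewrite val_h cos0; have g0 n : `|G n 0| <= 0 * weight C n.
    by rewrite G_Kop Kop0 ?oppr0 ?normr0 ?mul0r//; exact: c2_continuous (cV n).
  have := value_le C0 Ce1 (summable_geometric C0 g0).
  by rewrite mul0r normr_le0 => /eqP; rewrite -/(val G 0) => ->; rewrite mulr0 addr0.
have hev x : h (- x) = h x.
  rewrite /h /val /value; congr power_sum; apply/funext => n.
  by case: (prof_ser_half_wave n) => + _; apply.
have h10 : val (D 1%N) 0 = 0.
  have d : has_deriv h (fun x => - val (D 1%N) (- x)).
    move=> x; have := deriv_comp (g := fun y => - y) (dh (- x)) (derivN (deriv_id x)).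
    rewrite mulrN1; congr (is_derive x (1 : R) _ _).
    by apply/funext => y; rewrite hev.
  have /(congr1 (fun f => f 0)) := has_deriv_uniq dh d; rewrite oppr0; lra.
have lmk : lam 0 * eps ^+ 2 = 4 * k by rewrite /k; field.
(* The first integral gives v^2 >= 1 and smallness gives v >= 1/2, so v >= 1 and its inverse 1 - 2 k
   (1 - h^2) is at most 1. For eps = 0 the modulus vanishes and h = cos is handled directly. *)
have hle x : `|h x| <= 1.
  have [e0|e0] := eqVneq eps 0.
    rewrite val_h /tau e0 expr0n mul0r mul0r addr0 ler_norml.
    by rewrite cos_geN1 cos_le1.
  have FI := first_integral lmk q_neq0 dh h2 h0 h10 x.
  have e2 : 0 < eps ^+ 2 by rewrite exprn_even_gt0.
  have k0 : 0 < k by rewrite /k divr_gt0// mulr_gt0//; lra.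
  have v1 : 1 <= v x ^+ 2 by rewrite vE exprVn -FI lerDl sqr_ge0.
  have vp := v_pos x.
  have v2 : 1 <= v x by rewrite -(ler_pXn2r (_ : 0 < 2)%N) ?nnegrE ?expr1n//; lra.
  have q1 : 1 - 2 * k * (1 - h x ^+ 2) <= 1.
    have := vq x; set q := 1 - _ => vq1.
    have q0 : 0 <= q by rewrite -(pmulr_rge0 _ (_ : 0 < v x)) ?vq1//; lra.
    by have := ler_wpM2r q0 v2; rewrite vq1; lra.
  have : 0 <= k * (1 - h x ^+ 2) by lra.
  rewrite (pmulr_rge0 _ k0) subr_ge0 => h1.
  by rewrite -(ler_pXn2r (_ : 0 < 2)%N) ?nnegrE// real_normK ?num_real// expr1n.
have e0 := sqr_ge0 eps.
exists (lam 0), k, (val (D 1%N)); split => //; first by lra.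
- apply/andP; split; first by rewrite /k divr_ge0// mulr_ge0//; lra.
  by have e4 := e1; have := ler_wpM2r e0 l2; rewrite /k; lra.
- rewrite val_lam// /lam val_lam//.
  (* This recursion is (1 + tau rho)(1 + tau chi) = 1 divided by tau. *)
  have E : val chi 0 = - val rho 0 - tau * (val rho 0 * val chi 0).
    have s1 := summable_conv C0 (sr 0) (sc 0); have s2 := summable_half_sqr C0 s1.
    rewrite [in LHS]cE /val (value_add C0 Ce1); last 2 first.
    - exact: summable_scale.
    - exact: summable_scale.
    rewrite !(value_scale C0 Ce1 (-1))// (value_half_sqr C0 Ce1)// (value_conv C0 Ce1)//.
    by rewrite !mulN1r.
  transitivity (1 + tau * (val chi 0 + val rho 0 + tau * (val rho 0 * val chi 0))).
    by ring.
  by rewrite {1}E; ring.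
Qed.

End at_eps.
End series_solution.

Theorem lindstedt_solution : exists (C M r : R) (H : nat -> R -> R) (g : nat -> R),
  [/\ [/\ 0 < C, 0 <= M, 0 < r & C * r <= 1 / 2],
    forall n, half_wave (H n) /\ exists d : nat -> R -> R, [/\ jets 4 d,
      d 0%N = H n & forall j x, (j <= 4)%N -> `|d j x| <= M * C ^+ n],
    forall n, `|g n| <= M * C ^+ n,
    [/\ H 0%N = cos, g 0%N = 1, g 1%N = 0, g 2 = 3 / 8 & g 3 = 0] &
    forall eps, `|eps| < r -> exists (l k : R) (h1 : R -> R),
      [/\ 0 < l, 0 <= k < 1 / 2, power_sum (g : nat -> R) eps * l = 1,
        l * eps ^+ 2 = 4 * k &
        osc l k (fun x => power_sum (fun n => H n x : R) eps) h1]].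
Proof.
have [C [B [G [rho [chi [z [C0 B0 [mG mr mc mz] [zE cE rE GE] [my mV]]]]]]]] := lindstedt R.
have p0 := pi_gt0 R.
pose M := 1 + 8 / C ^+ 2 * ((2 * pi + 2) * B).
have t0 : 0 <= 8 / C ^+ 2 by rewrite divr_ge0// exprn_ge0// ltW.
have KB : B <= (2 * pi + 2) * B by rewrite ler_peMl//; lra.
have MB : 1 + 8 / C ^+ 2 * B <= M by rewrite lerD2l ler_wpM2l.
have M0 : 0 <= M by apply: le_trans MB; rewrite addr_ge0// mulr_ge0.
(* The second entry yields eps^2 B <= 1/2 and, because B + 1 >= 1, also |eps| <= 1/2, which keeps k
   below 1/2. *)
pose r := Num.min (1 / (2 * C)) (1 / (2 * (B + 1))).
exists C, M, r, (prof_ser G), (fun n => lam_ser chi n 0); split.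
- split => //; first by rewrite lt_min !divr_gt0// mulr_gt0//; lra.
  have : r <= 1 / (2 * C) by rewrite ge_min lexx.
  by rewrite ler_pdivlMr ?mulr_gt0//; lra.
- move=> n; split; first exact: prof_ser_half_wave mG n.
  have [D [D0 Dj DM _]] := prof_ser_jets C0 rE GE mV.
  exists (fun j => D j n); split; [exact: Dj|by rewrite D0|].
  move=> j x j4; rewrite (le_trans (DM j n x j4))// ler_wpM2l//.
  exact: weight_le.
- move=> n; rewrite (le_trans (gam_ser_le C0 mc n))// ler_pM//.
  + by rewrite addr_ge0// mulr_ge0.
  + by rewrite ltW// weight_gt0.
  + exact: weight_le.
- exact: lindstedt_first_coefs zE cE rE.
- move=> eps; rewrite lt_min => /andP[r1 r2].
  have Ce : C * `|eps| <= 1 / 2.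
    by move: r1; rewrite ltr_pdivlMr ?mulr_gt0//; lra.
  have e2 : `|eps| <= 1 / 2.
    move: r2; rewrite ltr_pdivlMr; last by lra.
    by have := normr_ge0 eps; nra.
  have e2B : `|eps| * B <= 1 / 2.
    move: r2; rewrite ltr_pdivlMr; last by lra.
    by have := normr_ge0 eps; lra.
  have en := normr_ge0 eps.
  have Be : eps ^+ 2 * B <= 1 / 2.
    by rewrite -real_normK ?num_real// expr2; have := mulr_ge0 en B0; nra.
  have e1 : eps ^+ 2 <= 1 / 4.
    by rewrite -real_normK ?num_real// expr2; nra.
  exact: lindstedt_osc C0 B0 mG mr mc mz zE cE rE GE my mV eps Ce Be e1.
Qed.

End lindstedt_solution.

Lemma natr_eq_dist (R : realType) (n m : nat) : `|n%:R - m%:R| < 1 :> R -> n = m.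
Proof.
have [h|h|//] := ltngtP n m.
  by move: h; rewrite -(ler_nat R) -natr1 ltr_norml => h ?; exfalso; lra.
by move: h; rewrite -(ler_nat R) -natr1 ltr_norml => h ?; exfalso; lra.
Qed.

Lemma ltr_div_sqr (R : realType) (c x y : R) : 0 < c -> 0 < x -> 0 < y ->
  (c / x ^+ 2 < c / y ^+ 2) = (y < x).
Proof.
move=> c0 x0 y0; rewrite ltr_pM2l// ltf_pV2 ?posrE ?exprn_gt0//.
by rewrite ltr_pXn2r// nnegrE ltW.
Qed.

Section power_sum_linear.
Variables (R : realType) (V W : normedModType R).

(** Applied to the projection on gamma and to evaluation at a point, it identifies the sum taken in
    the product space with numerical series. *)
Lemma power_sum_linear (phi : V -> W) (c : nat -> V) (M B e : R) :
  geometrically_complete V -> 0 < B -> (forall n, `|c n| <= M * B ^+ n) ->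
  B * `|e| < 1 -> (forall (t : R) u v, phi (t *: u + v) = t *: phi u + phi v) ->
  phi u @[u --> power_sum c e] --> phi (power_sum c e) ->
  series (fun n => e ^+ n *: phi (c n)) @ \oo --> phi (power_sum c e).
Proof.
move=> Vc B0 cM Be lin cphi; have := power_sum_cvg Vc B0 cM Be => /(cvg_comp _ _) /(_ cphi).
have phi0 : phi 0 = 0.
  by have := lin (-1) 0 0; rewrite !scaleN1r !addNr => ->.
suff -> : series (fun n => e ^+ n *: phi (c n)) =
    phi \o series (fun n => e ^+ n *: c n) by [].
apply/funext => n; rewrite /series /=; elim: n => [|n IH]; first by rewrite !big_geq.
rewrite !big_nat_recr//= [\sum_(0 <= k < n) _ + _]addrC IH.
by rewrite [in RHS]addrC lin.
Qed.

End power_sum_linear.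

(** * The local branch *)

Section local_branch.
Variables (R : realType) (a w : R) (l : nat).
Hypotheses (a01 : 0 < a < 1) (w0 : 0 < w) (l1 : (1 <= l)%N).
Local Notation V := (R * C30e a)%type.
Variables (C M r : R) (H : nat -> R -> R) (g : nat -> R).
Hypotheses (C0 : 0 < C) (M0 : 0 <= M) (r0 : 0 < r) (Cr : C * r <= 1 / 2).
Hypotheses (HP : forall n, half_wave (H n) /\ exists d : nat -> R -> R, [/\ jets 4 d,
      d 0%N = H n & forall j x, (j <= 4)%N -> `|d j x| <= M * C ^+ n])
  (gM : forall n, `|g n| <= M * C ^+ n).
Hypotheses (H0 : H 0%N = cos) (g0 : g 0%N = 1) (g1 : g 1%N = 0) (g2 : g 2 = 3 / 8)
  (g3 : g 3 = 0).
Hypothesis oscP : forall eps, `|eps| < r -> exists (lam k : R) (h1 : R -> R),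
      [/\ 0 < lam, 0 <= k < 1 / 2, power_sum (g : nat -> R) eps * lam = 1,
        lam * eps ^+ 2 = 4 * k &
        osc lam k (fun x => power_sum (fun n => H n x : R) eps) h1].

Let lR : 0 < l%:R :> R. Proof. by rewrite ltr0n. Qed.
Let B : R := l%:R * C.
Let B0 : 0 < B. Proof. exact: mulr_gt0. Qed.

(** Coefficients of gamma = w / l^2 times the series g, and of f(x) = e h(l x), both with the mode 1
    series taken at l e. The prefactor e shifts [fc] by one index. *)
Let gamc n : R := w / l%:R ^+ 2 * (l%:R ^+ n * g n).
Let modec n : C30e a := toC30e a (fun x => H n (l%:R * x)).
Let fc n : C30e a := if n is m.+1 then l%:R ^+ m *: modec m else 0.
Definition branch_coef n : V := (gamc n, fc n).
Definition local_branch : R -> V := power_sum branch_coef.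

Let Hx n x : `|H n x| <= M * C ^+ n.
Proof. by have [_ [d [_ <- dM]]] := HP n; exact: dM. Qed.

Let modecP n : C30e_val (modec n) = (fun x => H n (l%:R * x)) /\
  `|modec n| <= 6 * l%:R ^+ 4 * (M * C ^+ n).
Proof.
have [hw [d [dj d0 dM]]] := HP n; rewrite /modec; move: (H n) d0 hw => _ <- hw.
have [mem nle] := half_wave_C30e a01 dj dM hw l1.
have E := toC30eK mem; split; first exact: E.
by rewrite C30e_normE E.
Qed.

Let A : R := w / l%:R ^+ 2 * M + 6 * l%:R ^+ 4 * M / B.

Let coefM n : `|branch_coef n| <= A * B ^+ n.
Proof.
have w1 : 0 <= w / l%:R ^+ 2 by rewrite divr_ge0 ?exprn_ge0// ltW.
have Bn m : 0 <= B ^+ m by rewrite exprn_ge0// ltW.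
have z1 : 0 <= w / l%:R ^+ 2 * M by rewrite mulr_ge0.
have z2 : 0 <= 6 * l%:R ^+ 4 * M / B.
  by rewrite divr_ge0 ?(ltW B0)// mulr_ge0// mulr_ge0// exprn_ge0.
rewrite prod_normE ge_max; apply/andP; split => /=.
  apply: (@le_trans _ _ (w / l%:R ^+ 2 * M * B ^+ n)); last first.
    by rewrite ler_wpM2r// lerDl.
  rewrite /gamc normrM ger0_norm// -mulrA ler_wpM2l// normrM ger0_norm ?exprn_ge0//.
  by rewrite /B exprMn mulrCA ler_wpM2l// exprn_ge0.
case: n => [|n]; first by rewrite normr0 mulr_ge0// addr_ge0.
apply: (@le_trans _ _ (6 * l%:R ^+ 4 * M / B * B ^+ n.+1)); last first.
  by rewrite ler_wpM2r// lerDr.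
rewrite [B ^+ n.+1]exprS [_ / B * _]mulrA divfK ?gt_eqF// /fc normrZ ger0_norm ?exprn_ge0//.
have [_ h] := modecP n; apply: (le_trans (ler_wpM2l (exprn_ge0 n (ler0n R l)) h)).
by rewrite /B exprMn le_eqVlt; apply/orP; left; apply/eqP; ring.
Qed.

Let Vc : geometrically_complete V := @pair_complete R a.
Let A0 : 0 <= A.
Proof. by have := le_trans (normr_ge0 _) (coefM 0); rewrite expr0 mulr1. Qed.

Let small (e : R) : l%:R * `|e| < r -> B * `|e| <= 1 / 2.
Proof.
move=> h; apply: le_trans Cr; rewrite /B [l%:R * C]mulrC -mulrA ler_wpM2l//; exact: ltW.
Qed.

Let small_lt (e : R) : l%:R * `|e| < r -> B * `|e| < 1.
Proof. by move=> /small h; apply: le_lt_trans h _; lra. Qed.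

Let scaled (e : R) : `|l%:R * e| = l%:R * `|e|.
Proof. by rewrite normrM ger0_norm// ltW. Qed.

Let Csmall (e : R) : l%:R * `|e| < r -> C * `|l%:R * e| < 1.
Proof. by move=> /small_lt; rewrite scaled /B mulrA [C * _]mulrC. Qed.

Lemma local_branch1 e : l%:R * `|e| < r ->
  (local_branch e).1 = w / l%:R ^+ 2 * power_sum (g : nat -> R) (l%:R * e).
Proof.
move=> er; set P := power_sum _ _.
have c1 : (fun N => \sum_(0 <= n < N) e ^+ n * gamc n) @ \oo --> (local_branch e).1.
  exact: (@power_sum_linear _ V R fst _ _ _ _ Vc B0 coefM (small_lt er)
    (fun t u v => erefl) (@fst_cvg R a _)).
have c2 : (fun N => \sum_(0 <= n < N) (l%:R * e) ^+ n * g n) @ \oo --> P.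
  exact: (power_sum_cvg (@real_complete R) C0 gM (Csmall er)).
have {}c2 := cvgM (cvg_cst (w / l%:R ^+ 2)) c2.
apply: (cvg_unique _ c1) => //; suff -> : (fun N => \sum_(0 <= n < N) e ^+ n * gamc n) =
  (fun N => w / l%:R ^+ 2 * \sum_(0 <= n < N) (l%:R * e) ^+ n * g n) by exact: c2.
apply/funext => N; rewrite big_distrr /=; apply: eq_bigr => i _.
by rewrite /gamc exprMn; ring.
Qed.

Lemma local_branch2 e x : l%:R * `|e| < r -> C30e_val (local_branch e).2 x =
  e * power_sum (fun n => H n (l%:R * x) : R) (l%:R * e).
Proof.
move=> er; set P := power_sum _ _.
pose F n := e ^+ n * C30e_val (fc n) x.
have c1 : (fun N => \sum_(0 <= n < N) F n) @ \oo --> C30e_val (local_branch e).2 x.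
  exact: (@power_sum_linear _ V R (fun p => C30e_val p.2 x) _ _ _ _ Vc B0 coefM
    (small_lt er) (fun t u v => erefl) (@eval_deriv_cvg R a _ 0 x isT)).
have c2 : (fun N => \sum_(0 <= n < N) (l%:R * e) ^+ n * H n (l%:R * x)) @ \oo --> P.
  exact: (power_sum_cvg (@real_complete R) C0 (fun n => Hx n (l%:R * x)) (Csmall er)).
have {}c2 := cvgM (cvg_cst e) c2.
have c3 : (fun N => \sum_(0 <= n < N.+1) F n) @ \oo --> C30e_val (local_branch e).2 x.
  by rewrite (cvg_shiftS (fun N => \sum_(0 <= n < N) F n)).
apply: (cvg_unique _ c3) => //.
suff -> : (fun N => \sum_(0 <= n < N.+1) F n) =
  (fun N => e * \sum_(0 <= n < N) (l%:R * e) ^+ n * H n (l%:R * x)) by exact: c2.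
apply/funext => N; rewrite big_nat_recl// [F 0](_ : _ = 0) ?add0r; last first.
  by rewrite /F -[C30e_val (fc 0) x]/(0 : R) mulr0.
rewrite big_distrr /=; apply: eq_bigr => i _.
have -> : F i.+1 = e ^+ i.+1 * (l%:R ^+ i * H i (l%:R * x)).
  have [E _] := modecP i; rewrite /F; congr (_ * _).
  by rewrite -[LHS]/(l%:R ^+ i * C30e_val (modec i) x) E.
by rewrite exprMn exprS; ring.
Qed.

(** Since h(0) = 1, the parameter can be read off the solution; injectivity and the comparison with
    other solutions rest on this. *)
Lemma local_branch_val0 e : l%:R * `|e| < r -> C30e_val (local_branch e).2 0 = e.
Proof.
move=> er; rewrite local_branch2// mulr0.
have [|lam [k [h1 [_ _ _ _ [_ _ h0 _ _]]]]] := oscP (eps := l%:R * e); first by rewrite scaled.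
by move: h0 => /= ->; rewrite mulr1.
Qed.

Lemma local_branch0 : local_branch 0 = (w * l%:R ^- 2, 0).
Proof.
have h : B * `|0 : R| < 1 by rewrite normr0 mulr0.
have := power_sum_tail Vc B0 coefM 1 h.
rewrite big_nat1 normr0 !mulr0 normr_le0 subr_eq0 => /eqP E.
by rewrite /local_branch E expr0 scale1r /branch_coef /gamc g0 expr0 !mulr1.
Qed.

Lemma local_branch_admissible e : l%:R * `|e| < r -> `|e| < 1 ->
  @admissible R a (local_branch e).
Proof.
move=> er e1; have [|lam [k [h1 [lam0 k01 gl lk oh]]]] := oscP (eps := l%:R * e).
  by rewrite scaled.
split => /=.
  rewrite in_itv/= andbT local_branch1// mulr_gt0// ?divr_gt0 ?exprn_gt0//.
  by rewrite -(pmulr_lgt0 _ lam0) gl.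
have [_ _ _ _ hle] := oh.
rewrite /Uset /=; apply: le_lt_trans e1; apply: sup_on_le; first by exists 0.
by move=> x _; rewrite local_branch2// normrM ler_piMr.
Qed.

Lemma local_branch_nontrivial e : l%:R * `|e| < r -> `|e| < 1 -> e != 0 ->
  @nontrivial_solution R a w (local_branch e).
Proof.
move=> er e1 e0; split; first exact: local_branch_admissible.
  apply/eqP => E; have := local_branch_val0 er; rewrite E.
  by move=> E0; move: e0; rewrite -E0 -[C30e_val 0 0]/(0 : R) eqxx.
have [|lam [k [h1 [lam0 k01 gl lk oh]]]] := oscP (eps := l%:R * e).
  by rewrite scaled.
have -> : C30e_val (local_branch e).2 = (fun x => e *
    power_sum (fun n => H n (l%:R * x) : R) (l%:R * e)).
  by apply/funext => x; exact: local_branch2.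
rewrite local_branch1//; apply: osc_Upsilon k01 _ _ (osc_scale l%:R oh).
  by rewrite -lk; ring.
move: gl; set P := power_sum _ _ => gl; transitivity (w * (P * lam)).
  by field; rewrite gt_eqF.
by rewrite gl mulr1.
Qed.

Lemma local_branch_analytic e : l%:R * `|e| < r -> analytic_at local_branch e.
Proof. by move=> er; exact: (power_sum_analytic Vc A0 B0 coefM (small_lt er)). Qed.

Lemma local_branch_continuous e : l%:R * `|e| < r -> {for e, continuous local_branch}.
Proof. by move=> er; exact: (power_sum_continuous Vc A0 B0 coefM (small_lt er)). Qed.

Let near_r : \forall e \near (0 : R), l%:R * `|e| < r.
Proof.
apply/nbhs_ballP; exists (r / l%:R) => /=; first exact: divr_gt0.
by move=> e; rewrite /ball/= sub0r normrN ltr_pdivlMr// mulrC.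
Qed.

Lemma local_branch_gamma_expansion :
  (fun e => (local_branch e).1 - (w * l%:R ^- 2 + 3 * w / 8 * e ^+ 2))
    =O_ (nbhs (0 : R)) (fun e : R => e ^+ 4).
Proof.
apply/eqO_exP; exists (w / l%:R ^+ 2 * (2 * M) * B ^+ 4 + 1).
  by rewrite ltr_wpDl// !mulr_ge0 ?exprn_ge0 ?divr_ge0 ?exprn_ge0// ltW.
apply: filterS near_r => e er; rewrite local_branch1//.
have w1 : 0 <= w / l%:R ^+ 2 by rewrite divr_ge0 ?exprn_ge0// ltW.
have := power_sum_tail (@real_complete R) C0 gM 4 (Csmall er).
rewrite !big_nat_recr//= big_geq// g0 g1 g2 g3 => T.
set P := power_sum _ _ in T *.
have -> : w / l%:R ^+ 2 * P - (w * l%:R ^- 2 + 3 * w / 8 * e ^+ 2) = w / l%:R ^+ 2 *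
    (P - (0 + (l%:R * e) ^+ 0 * 1 + (l%:R * e) ^+ 1 * 0 +
     (l%:R * e) ^+ 2 * (3 / 8) + (l%:R * e) ^+ 3 * 0)).
  by field; rewrite gt_eqF.
rewrite normrM (ger0_norm w1).
have CB : C * `|l%:R * e| = B * `|e| by rewrite scaled /B; ring.
rewrite CB in T; have Be := small er.
have T2 : M / (1 - B * `|e|) * (B * `|e|) ^+ 4 <= 2 * M * (B ^+ 4 * `|e| ^+ 4).
  rewrite exprMn; apply: ler_wpM2r; first by rewrite mulr_ge0// exprn_ge0// ltW.
  rewrite ler_pdivrMr; last by lra.
  by have := ler_wpM2l M0 Be; lra.
apply: (le_trans (ler_wpM2l w1 (le_trans T T2))).
have e4 : 0 <= `|e| ^+ 4 by exact: exprn_ge0.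
by rewrite normrX; move: (w / _) => K; lra.
Qed.

Lemma local_branch_profile_expansion :
  (fun e => (local_branch e).2 - e *: cos_mode a01 l1)
    =O_ (nbhs (0 : R)) (fun e : R => e ^+ 2).
Proof.
have f1E : fc 1 = cos_mode a01 l1.
  apply/val_inj; have [E _] := modecP 0; rewrite /fc expr0 scale1r.
  by rewrite -[LHS]/(C30e_val (modec 0)) E H0.
apply/eqO_exP; exists (2 * A * B ^+ 2 + 1).
  by rewrite ltr_wpDl// !mulr_ge0 ?exprn_ge0// ltW.
apply: filterS near_r => e er.
have T := power_sum_tail Vc B0 coefM 2 (small_lt er).
have Be := small er.
have T2 : A / (1 - B * `|e|) * (B * `|e|) ^+ 2 <= 2 * A * (B ^+ 2 * `|e| ^+ 2).
  rewrite exprMn; apply: ler_wpM2r; first by rewrite mulr_ge0// exprn_ge0// ltW.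
  rewrite ler_pdivrMr; last by lra.
  by have := ler_wpM2l A0 Be; lra.
rewrite !big_nat_recr//= big_geq// add0r expr0 scale1r expr1 in T.
have {}T : `|(local_branch e).2 - e *: cos_mode a01 l1| <= 2 * A * (B ^+ 2 * `|e| ^+ 2).
  apply: le_trans (le_trans T T2); rewrite prod_normE le_max; apply/orP; right.
  by rewrite -f1E -[e *: fc 1]add0r.
apply: (le_trans T); have e4 : 0 <= `|e| ^+ 2 by exact: exprn_ge0.
by rewrite normrX; move: A B => K K'; lra.
Qed.

Lemma local_branch_solution e : l%:R * `|e| < r -> `|e| < 1 ->
  @solution_closure R a w (local_branch e).
Proof.
move=> er e1; have [->|e0] := eqVneq e 0.
  by rewrite local_branch0 -branch0//; exact: branch0_sol.
split; last exact: local_branch_admissible.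
exact/subset_closure/local_branch_nontrivial.
Qed.

Let p_l : V := (w * l%:R ^- 2, 0).

(** The first clause settles nontrivial solutions; the window for gamma separates w / l^2 from all w
    / n^2 with another n, so [p_l] is the only trivial point left. *)
Let selects_l (p : V) := [/\ forall n, has_mode w p n -> n = l,
  w / (l%:R + 1 / 2) ^+ 2 < p.1 & p.1 < w / (l%:R - 1 / 2) ^+ 2].

Let selects_l_near : \forall p \near p_l, selects_l p.
Proof.
have gl0 : 0 < w * l%:R ^- 2 by rewrite divr_gt0// exprn_gt0.
have d0 : 0 < 1 / 2 :> R by lra.
have l1R : 1 <= l%:R :> R by rewrite ler1n.
have sq : Num.sqrt (w / (w * l%:R ^- 2)) = l%:R.
  rewrite (_ : w / _ = l%:R ^+ 2); first by rewrite sqrtr_sqr ger0_norm.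
  by field; rewrite !gt_eqF.
have h1 := @mode_near R a w _ _ gl0 d0.
have c := @fst_cvg _ a p_l.
have h2 : w / (l%:R + 1 / 2) ^+ 2 < p_l.1.
  by rewrite ltr_div_sqr//; lra.
have h3 : p_l.1 < w / (l%:R - 1 / 2) ^+ 2.
  by rewrite ltr_div_sqr//; lra.
have g2' := cvgr_gt _ c _ h2; have g3' := cvgr_lt _ c _ h3.
near=> p; split; [|by near: p; exact: g2'|by near: p; exact: g3'].
move=> n pn; have : `|n%:R - Num.sqrt (w / (w * l%:R ^- 2))| < 1 / 2.
  by move: n pn; near: p.
rewrite sq => nl; apply: (@natr_eq_dist R); lra.
Unshelve. all: by end_near. Qed.

(** A nontrivial solution near [p_l] and the local curve at e = f(0) both have mode l and the same
    value at 0, so [has_mode_inj] identifies them. Conversely, the curve is a connected set of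
    solutions through [p_l]. *)
Lemma local_branch_component : exists delta : R, [/\ 0 < delta,
  forall e, - delta < e < delta -> l%:R * `|e| < r /\ `|e| < 1 &
  exists2 N : set V, nbhs p_l N &
    connected_component (@solution_closure R a w) p_l `&` N =
    [set local_branch e | e in `]- delta, delta[]].
Proof.
have l0r : l%:R * `|0 : R| < r by rewrite normr0 mulr0.
have c0 : local_branch @ (0 : R) --> p_l.
  by rewrite /p_l -local_branch0; exact: local_branch_continuous.
have /nbhs_ballP[d /= d0 dP] : \forall e \near (0 : R), [/\ selects_l (local_branch e),
    l%:R * `|e| < r & `|e| < 1].
  have s := c0 _ selects_l_near.
  near=> e; split; [by near: e|by near: e; exact: near_r|].
  near: e; apply/nbhs_ballP; exists 1 => //= e.
  by rewrite /ball/= sub0r normrN.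
have {}dP e : - d < e < d -> [/\ selects_l (local_branch e), l%:R * `|e| < r & `|e| < 1].
  by move=> ed; apply: dP; rewrite /ball/= sub0r normrN ltr_norml.
exists d; split => //; first by move=> e /dP[].
have d00 : - d < 0 < d by rewrite d0 oppr_lt0 d0.
(* The bound on f(0) keeps the parameter of a given solution within the range of the curve. *)
exists [set p | selects_l p /\ `|C30e_val p.2 0| < d].
  have c := @eval_deriv_cvg _ a p_l 0 0 isT.
  have s2 : \forall p \near p_l, `|C30e_val p.2 0| < d.
    have /cvgrPdist_lt/(_ _ d0) := c; apply: filterS => p h.
    by have : `|0 - C30e_val p.2 0| < d := h; rewrite sub0r normrN.
  by have s1 := selects_l_near; near=> p; split; near: p.
apply/seteqP; split => p.
  move=> [/connected_component_sub Sp [[pl p1 p2] pd]].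
  rewrite ltr_norml in pd; have [[bl _ _] er e1] := dP _ pd.
  case: (sol_closure_cases w0 Sp) => [np|[n n1 pE]].
    have [n pn] := nontrivial_mode w0 np; have nl := pl n pn; rewrite nl in pn.
    exists (C30e_val p.2 0); first by rewrite /= in_itv.
    have e0 : C30e_val p.2 0 != 0.
      case: pn => _ _ /andP[m0 _] _ _; apply/eqP => E; move: m0.
      by rewrite /modulus E expr0n/= mulr0 mul0r ltxx.
    have [m bm] := nontrivial_mode w0 (local_branch_nontrivial er e1 e0).
    have ml := bl m bm; rewrite ml in bm.
    by apply: (has_mode_inj w0 bm pn); exact: local_branch_val0.
  exists 0; first by rewrite /= in_itv.
  rewrite local_branch0 pE; suff -> : n = l by [].
  move: p1 p2; rewrite pE /=.
  have nR : 1 <= n%:R :> R by rewrite ler1n.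
  have l1R : 1 <= l%:R :> R by rewrite ler1n.
  rewrite ltr_div_sqr ?ltr_div_sqr//; [|by lra..].
  by move=> a1 a2; apply: (@natr_eq_dist R); rewrite ltr_norml; lra.
move=> [e ed <-]; rewrite /= in_itv/= in ed; have [sl er e1] := dP _ ed.
split; last by split => //; rewrite local_branch_val0// ltr_norml.
have /connected_component_max : [set local_branch e | e in `]- d, d[] p_l.
  by exists 0; [rewrite /= in_itv|exact: local_branch0].
apply; last by exists e => //; rewrite /= in_itv.
- move=> _ [t td <-]; rewrite /= in_itv/= in td.
  by have [_ tr t1] := dP _ td; exact: local_branch_solution.
- apply: connected_continuous_connected.
    by apply/connected_intervalP; exact: interval_is_interval.
  apply: continuous_in_subspaceT => t; rewrite inE/= in_itv/= => /dP[_ tr _].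
  exact: local_branch_continuous.
Unshelve. all: by end_near. Qed.

End local_branch.

(** That the curve parametrises the component is expressed by injectivity together with the
    neighbourhood [N], inside which the component contains nothing else. *)
Theorem theorem6p1 (R : realType) (a : R) (a01 : 0 < a < 1)
    (w : R) (w0 : 0 < w) (l : nat) (l1 : (1 <= l)%N) :
  let gamma_bar (m : nat) : R := w * m%:R ^- 2 in
  let p_l : R * C30e a := (gamma_bar l, 0) in
  let Sol := @solution_closure R a w in
  let C_l := connected_component Sol p_l in
  [/\ Sol p_l,
      unbounded_in (@admissible R a) C_l,
      exists (delta : R) (gamma_l : R -> R) (f_l : R -> C30e a),
        [/\ 0 < delta,
            (forall e : R, - delta < e < delta ->
               @admissible R a (gamma_l e, f_l e) /\
               analytic_at (fun t => (gamma_l t, f_l t)) e),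
            {in `]- delta, delta[%R &, injective (fun e => (gamma_l e, f_l e))} /\
            (exists2 N : set (R * C30e a), nbhs p_l N &
               C_l `&` N = [set (gamma_l e, f_l e) | e in `]- delta, delta[]),
            (fun e => gamma_l e - (gamma_bar l + 3 * w / 8 * e ^+ 2))
              =O_ (nbhs (0 : R)) (fun e : R => e ^+ 4)
          & (fun e => f_l e - e *: cos_mode a01 l1)
              =O_ (nbhs (0 : R)) (fun e : R => e ^+ 2)]
    & forall gam : R, 0 < gam ->
        (forall m : nat, (1 <= m)%N -> gam <> gamma_bar m) ->
        ~ bifurcation_point a w gam].
Proof.
move=> gamma_bar p_l Sol C_l.
have plE : branch a w l 0 = p_l by exact: branch0.
split.
- by rewrite -plE; exact: branch0_sol.
- by rewrite /C_l -plE; exact: branch_unbounded.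
- have [C [M [r [H [g [[C0 M0 r0 Cr] HP gM [H0 g0 g1 g2 g3] oscP]]]]]] := lindstedt_solution R.
  have [delta [d0 dP [N Np NE]]] := local_branch_component a01 w0 l1 C0 M0 r0 Cr HP gM g0 oscP.
  pose u := @local_branch R a w l H g.
  have uE : (fun t => ((u t).1, (u t).2)) = u.
    by apply/funext => t; case: (u t).
  exists delta, (fun e => (u e).1), (fun e => (u e).2); split => //.
  + move=> e ed; have [er e1] := dP e ed; split; last first.
      by rewrite uE; exact: (local_branch_analytic a01 w0 l1 C0 M0 Cr HP gM er).
    rewrite -surjective_pairing.
    exact: (local_branch_admissible a01 w0 l1 C0 M0 Cr HP gM oscP er e1).
  + split; last by exists N => //; rewrite uE.
    move=> e e'; rewrite !in_itv/= => /dP[er _] /dP[er' _] ee.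
    have v := local_branch_val0 a01 w0 l1 C0 M0 Cr HP gM oscP.
    have ee0 := congr1 (fun p : R * C30e a => C30e_val p.2 0) ee.
    exact: etrans (esym (v e er)) (etrans ee0 (v e' er')).
  + exact: (local_branch_gamma_expansion a01 w0 l1 C0 M0 r0 Cr HP gM g0 g1 g2 g3).
  + exact: (local_branch_profile_expansion a01 w0 l1 C0 M0 r0 Cr HP gM H0).
- move=> gam gam0 nbar /bifurcation_closure /(closure_trivial w0 gam0)[n n1].
  exact: nbar.
Qed.
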